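(* Let $0<k_1<k_2$ be fixed, and let $k_{3,1}=k_{3,1}(n)\ge 0$, $k_{3,2}=k_{3,2}(n)\ge 0$. Consider the diatomic chain of length $2n$ (matrix $\mathcal L$ in the context) as $n\to\infty$. All assertions are for all sufficiently large $n$. (A) Suppose $|k_{3,1}-k_2|\not\approx k_2$. (A1) If $k_{3,2}\approx k_{3,1}$, there exist two (linearly independent) eigenstates, localized more at both edges in the sense that $\left|\frac{c_2}{c_1}a^{-2n}\right|\gg 1$. (A2) If $k_{3,2}\not\approx k_{3,1}$, there exists a left edge state. Moreover this left edge state satisfies: - if $k_{3,1}=k_2$, then $a\approx-\frac{k_1}{k_2}$ and $\left|a+\frac{k_1}{k_2}\right|=\mathcal O\left(\left(\frac{k_1}{k_2}\right)^{4n}\right)$; - if $k_{3,1}\approx k_2$, then $a\approx-\frac{k_1}{k_2}$ and $|a-\tilde a|=\mathcal O(|\tilde a|^{2n})$; - if $k_{3,1}\not\approx k_2$, then $a\approx\tilde a\not\approx-\frac{k_1}{k_2}$ and $|a-\tilde a|=\mathcal O(|\tilde a|^{2n})$. (A3) If $|k_{3,2}-k_2|\not\approx k_2$, there are no slow-decaying or non-localized eigenstates with $a\approx\pm1$. (A4) If $|k_{3,2}-k_2|\approx k_2$, there exists at most one eigenstate with $a\approx\pm1$. Moreover, if $\tau\in\{1,-1\}$ and $\sigma\in\{1,-1\}$ are such that $k_{3,2}-k_2\approx-\tau\sigma k_2$, then the eigenstate with $a\approx\tau$ (if it exists) satisfies $\omega^2\approx k_1+k_2-\sigma(k_1+\tau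 k_2)$. (B) Suppose $|k_{3,i}-k_2|\approx k_2$ for both $i=1,2$. Then there exist at most two eigenstates with $a\approx\pm1$. Moreover, if $\tau,\sigma\in\{1,-1\}$ are such that $k_{3,i}-k_2\approx-\tau\sigma k_2$ for $i=1,2$, then each eigenstate with $a\approx\tau$ (if it exists) satisfies $\omega^2\approx k_1+k_2-\sigma(k_1+\tau k_2)$.
   Context: **Chain.** $\mathcal L$ is the $2n\times2n$ real symmetric tridiagonal matrix with diagonal $(-k_1-k_{3,1},\,-k_1-k_2,\dots,-k_1-k_2,\,-k_1-k_{3,2})$ and off-diagonal entries $\mathcal L_{2m-1,2m}=k_1$ ($1\le m\le n$), $\mathcal L_{2m,2m+1}=k_2$ ($1\le m\le n-1$). An eigenstate is a nonzero $u\in\mathbb R^{2n}$ (up to scalar multiples) with $\mathcal L u=-\omega^2u$; $\omega\ge0$ is its eigenfrequency. The bands are $\omega^2\in[0,2k_1]\cup[2k_2,2k_1+2k_2]$; the band edges are $\omega^2\in\{0,2k_1,2k_2,2k_1+2k_2\}$. **The quantity $a$.** To an eigenstate with eigenfrequency $\omega$ associate the root $a$, $|a|\le1$, of $a+\frac1a=\frac{\omega^4-2\omega^2(k_1+k_2)+2k_1k_2}{k_1k_2}$. One has $\omega^2=k_1+k_2+\sigma\sqrt{(k_1+k_2a)(k_1+k_2/a)}$ with $\sigma=\pm1$. $a$ is real with $0<|a|<1$ exactly when $\omega^2$ is outside the bands, and $a=\pm1$ exactly at band edges. **Coefficients $c_1,c_2$.** For real $a\ne\pm1$ put $s=1$ if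 $a>0$, $s=-1$ if $a<0$ (here $k_1<k_2$), and $v_1=\left(\sqrt{|k_1+k_2/a|},\,-\sigma s\sqrt{|k_1+k_2a|}\right)^T$, $v_2=\left(\sqrt{|k_1+k_2a|},\,-\sigma s\sqrt{|k_1+k_2/a|}\right)^T$. Write $(u_1,u_2)^T=c_1v_1+c_2v_2$; then $(u_{2m+1},u_{2m+2})^T=c_1a^mv_1+c_2a^{-m}v_2$ for $0\le m\le n-1$. (If $c_1=0$, $|c_2/c_1|$ is read as $+\infty$.) **Edge states.** A (sequence in $n$ of) eigenstate(s) with frequency outside the bands is an edge state if $|a|\not\approx1$. It is a left edge state if in addition $\left|\frac{c_2}{c_1}a^{2-2n}\right|=\mathcal O(1)$. **The number $\tilde a$.** For $k_{3,1}\notin\{0,2k_2\}$, $\tilde a$ is the unique root with $|\tilde a|<1$ of $(k_{3,1}-k_2)^2k_1\tilde a^2+[k_2(k_{3,1}-k_2)^2-k_2^3]\tilde a-k_1k_2^2=0$ (so $\tilde a=-k_1/k_2$ when $k_{3,1}=k_2$). **Asymptotic notation** (as $n\to\infty$, $k_1,k_2$ fixed). $f\approx g$ means $f=g=0$ or $(f-g)/f\to0$; $f\approx 0$ means $f\to0$ (so for a constant $c$, $f\approx c$ means $f\to c$). $f\not\approx g$ means $\liminf_n|f-g|/\max(|f|,|g|)>0$ (for $g=0$: $\liminf|f|>0$). $|f|\ll|g|$ (equivalently $|g|\gg|f|$) means $f/g\to0$. $f=\mathcal O(g)$ means $|f|\le c|g|$ for some constant $c>0$ and all large $n$. **''Eigenstates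 with $a\approx\pm1$''** refers to eigenstates with real $a$ (frequency outside the bands or at a band edge) and $|a|$ close to $1$ (slow-decaying or non-localized). ''At most $N_0$ eigenstates with $a\approx\pm1$'' means: there are $\varepsilon>0$ and $N$ such that for every $n\ge N$ at most $N_0$ eigenstates have real $a$ with $1-\varepsilon<|a|\le1$. ''No eigenstates with $a\approx \pm1$'' is the case $N_0=0$. Properties of ''an eigenstate with $a\approx\tau$'' are for any sequence of eigenstates with real $a\to\tau$ (along $n\to\infty$ or a subsequence). *)

(* Defs.v *)
From HB Require Import structures.
From mathcomp Require Export all_boot all_order all_algebra.
From mathcomp Require Export all_classical all_reals all_analysis.

Set Implicit Arguments.
Unset Strict Implicit.
Unset Printing Implicit Defensive.

Import Order.TTheory GRing.Theory Num.Theory.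
Import numFieldNormedType.Exports.

Local Open Scope classical_set_scope.
Local Open Scope ring_scope.

(* ** Asymptotic comparison of real sequences *)

(* [(f - g) = o(f)] is "f = g = 0 or (f - g) / f --> 0", without a junk value
   of the quotient where [f n = 0].  The first disjunct is the convention for
   "f is asymptotically 0". For a constant [c], [asymp_eq f (cst c)] amounts to
   [f @ \oo --> c]. *)
Definition asymp_eq (R : realType) (f g : R^nat) : Prop :=
  (g = cst 0 /\ f @ \oo --> (0 : R)) \/ (f \- g) =o_\oo f.

(* This is not the negation of [asymp_eq]: it bounds the relative distance away
   from 0 for all large indices.  When [f n = g n = 0] the quotient below is 0.
   The last clause is the convention for the comparison with 0. *)
Definition asymp_neq (R : realType) (f g : R^nat) : Prop :=
  (0 < limn_einf
         (fun n => (`|f n - g n| / Num.max `|f n| `|g n|)%:E))%E /\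
  (g = cst 0 -> (0 < limn_einf (fun n => `|f n|%:E))%E).

Definition is_sign (R : realType) (x : R) : Prop := x = 1 \/ x = -1.

(* ** The chain *)

(* Rows and columns are numbered from 0, so that the site 2m - 1 of the usual
   numbering is the index 2m - 2: couplings k1 start at even indices. *)
Definition chain_mx (R : realType) (k1 k2 k31 k32 : R) (n : nat)
    : 'M[R]_(2 * n) :=
  \matrix_(i, j)
    if i == j then
      if val i == 0%N then - k1 - k31
      else if val i == (2 * n).-1 then - k1 - k32
      else - k1 - k2
    else if (i.+1 == j :> nat) || (j.+1 == i :> nat) then
      if odd (minn i j) then k2 else k1
    else 0.

Definition eigenstate (R : realType) (m : nat) (L : 'M[R]_m)
    (u : 'cV[R]_m) (w : R) : Prop :=
  [/\ u != 0, 0 <= w & L *m u = (- w ^+ 2) *: u].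

Definition bands (R : realType) (k1 k2 : R) : set R :=
  `[0, 2 * k1] `|` `[2 * k2, 2 * k1 + 2 * k2].

(* [a] is real: no such [a] exists when [w ^+ 2] is interior to a band, where
   the two roots are non-real of modulus 1.  When it exists it is unique. *)
Definition multiplier (R : realType) (k1 k2 w a : R) : Prop :=
  [/\ a != 0, `|a| <= 1 &
      a + a^-1 = (w ^+ 4 - 2 * w ^+ 2 * (k1 + k2) + 2 * k1 * k2) / (k1 * k2)].

(* At [a = - k1 / k2] both signs are possible; the choice only affects the sign
   of [c2] (relative to [c1]) below. *)
Definition branch (R : realType) (k1 k2 w a sg : R) : Prop :=
  is_sign sg /\
  w ^+ 2 = k1 + k2 + sg * Num.sqrt ((k1 + k2 * a) * (k1 + k2 / a)).

Definition col2 (R : realType) (x y : R) : 'cV[R]_2 :=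
  \col_i (if i == ord0 then x else y).

Definition mode1 (R : realType) (k1 k2 a sg : R) : 'cV[R]_2 :=
  col2 (Num.sqrt `|k1 + k2 / a|)
       (- sg * Num.sg a * Num.sqrt `|k1 + k2 * a|).

Definition mode2 (R : realType) (k1 k2 a sg : R) : 'cV[R]_2 :=
  col2 (Num.sqrt `|k1 + k2 * a|)
       (- sg * Num.sg a * Num.sqrt `|k1 + k2 / a|).

(* 0 outside the range of indices *)
Definition entry (R : realType) (m : nat) (u : 'cV[R]_m) (i : nat) : R :=
  if insub i is Some j then u j ord0 else 0.

Definition mode_coefs (R : realType) (k1 k2 : R) (n : nat)
    (u : 'cV[R]_(2 * n)) (a sg c1 c2 : R) : Prop :=
  col2 (entry u 0) (entry u 1) =
  c1 *: mode1 k1 k2 a sg + c2 *: mode2 k1 k2 a sg.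

Definition coef_ratio (R : realType) (c1 c2 : R) : \bar R :=
  if c1 == 0 then +oo%E else `|c2 / c1|%:E.

(* ** Localization; [u] is a sequence of states, one for each size *)

Definition both_edges (R : realType) (k1 k2 : R) (k31 k32 : R^nat)
    (u : forall n, 'cV[R]_(2 * n)) : Prop :=
  exists w a sg c1 c2 : R^nat,
  (\forall n \near \oo,
     [/\ eigenstate (chain_mx k1 k2 (k31 n) (k32 n) n) (u n) (w n),
         multiplier k1 k2 (w n) (a n) /\ (a n != 1 /\ a n != -1),
         branch k1 k2 (w n) (a n) (sg n) &
         mode_coefs k1 k2 (u n) (a n) (sg n) (c1 n) (c2 n)]) /\
  (fun n => (coef_ratio (c1 n) (c2 n) * `|a n ^- (2 * n)|%:E)%E)
    @ \oo --> +oo%E.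

Definition edge_state (R : realType) (k1 k2 : R) (k31 k32 : R^nat)
    (u : forall n, 'cV[R]_(2 * n)) (w a : R^nat) : Prop :=
  (\forall n \near \oo,
     [/\ eigenstate (chain_mx k1 k2 (k31 n) (k32 n) n) (u n) (w n),
         ~ bands k1 k2 (w n ^+ 2) &
         multiplier k1 k2 (w n) (a n)]) /\
  asymp_neq (fun n => `|a n|) (cst 1).

Definition left_edge_state (R : realType) (k1 k2 : R) (k31 k32 : R^nat)
    (u : forall n, 'cV[R]_(2 * n)) (w a : R^nat) : Prop :=
  edge_state k1 k2 k31 k32 u w a /\
  exists sg c1 c2 : R^nat,
  (\forall n \near \oo,
     branch k1 k2 (w n) (a n) (sg n) /\
     mode_coefs k1 k2 (u n) (a n) (sg n) (c1 n) (c2 n)) /\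
  exists2 C : R, 0 < C &
    \forall n \near \oo,
      (coef_ratio (c1 n) (c2 n) * `|a n ^ (2%:Z - (2 * n)%:Z)|%:E <= C%:E)%E.

(* The root is unique for [k31] different from 0 and [2 * k2]. *)
Definition atilde (R : realType) (k1 k2 k31 : R) : R :=
  xget 0 [set t : R | `|t| < 1 /\
    (k31 - k2) ^+ 2 * k1 * t ^+ 2
      + (k2 * (k31 - k2) ^+ 2 - k2 ^+ 3) * t - k1 * k2 ^+ 2 = 0].

(* ** Slowly decaying and non-localized states *)

(* Eigenstates are counted up to scalar multiples: among any [N0.+1] of them
   two are proportional.  For [N0 = 0] there is none. *)
Definition at_most_slow (R : realType) (k1 k2 : R) (k31 k32 : R^nat)
    (N0 : nat) : Prop :=
  exists2 eps : R, 0 < eps &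
  \forall n \near \oo, forall u : 'I_N0.+1 -> 'cV[R]_(2 * n),
    (forall i, exists w a : R,
       [/\ eigenstate (chain_mx k1 k2 (k31 n) (k32 n) n) (u i) w,
           multiplier k1 k2 w a & 1 - eps < `|a| <= 1]) ->
    exists i j, i != j /\ exists c : R, u j = c *: u i.

(* Every sequence of eigenstates with [a] tending to [tau], possibly along a
   subsequence [phi] of sizes, has [w ^+ 2] tending to [e]. *)
Definition slow_freq (R : realType) (k1 k2 : R) (k31 k32 : R^nat)
    (tau e : R) : Prop :=
  forall (phi : nat -> nat) (u : forall j, 'cV[R]_(2 * phi j)) (w a : R^nat),
    {homo phi : i j / (i < j)%N} ->
    (forall j,
       eigenstate (chain_mx k1 k2 (k31 (phi j)) (k32 (phi j)) (phi j))
         (u j) (w j) /\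
       multiplier k1 k2 (w j) (a j)) ->
    asymp_eq a (cst tau) ->
    asymp_eq (fun j => w j ^+ 2) (cst e).

(* Main.v *)
(* After the shift x = (k1 + k2 - w^2) / k2 and with kap = k1 / k2,
   P = k31 / k2 - 1, Q = k32 / k2 - 1, a state is a solution of a three-term
   recursion with end potentials - P and - Q.  For a multiplier a, the variable
   t = - x / (1 + kap a), tied to a by t^2 a (1 + kap a) = kap + a, turns the
   quantization condition into
     (t - P) (t - Q) = a^(2n) (1 - P t) (1 - Q t),
   whose division by 1 - a^2 makes sense also at the band edges a = 1, -1.
   The limit a_tilde is the multiplier at t = P, and
   c2 / c1 = (P - t) / (a (1 - P t)) up to sign.
   - Edge states: the right-hand side is exponentially small away from
     t = 1, -1, so the intermediate value theorem gives one root near t = P when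
     Q is apart from P, and two roots, one on each side of P, when Q is close
     to P.
   - Slow states: for |a| near 1 the factor sum_(j < n) a^(2j) of the divided
     equation is large, which forces P or Q to be close to t, hence to 1 or -1;
     signs decide on which side.  Multiplicities follow by interlacing:
     two roots for the ends (P, Q) enclose a root for (P, 0) or (0, Q), which is
     excluded by the preceding criteria. *)
Require Import Defs.
From mathcomp Require Import ring lra.

Set Implicit Arguments.
Unset Strict Implicit.
Unset Printing Implicit Defensive.

Import Order.TTheory GRing.Theory Num.Theory.
Import numFieldNormedType.Exports.

Local Open Scope classical_set_scope.
Local Open Scope ring_scope.

(** * The three-term recursion *)

Section Recursion.
Context {R : realType}.
Implicit Types (kap P Q x a t : R) (n j : nat).

(** The end stiffnesses vary with [n] and may be unbounded, so no compactness in [P] and [Q] is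
    available. Every distance is therefore measured relative to [1 + |P|], and the powers of
    [1 + |P|] that appear are paid for by factors [a]: the relation between [t] and [a] gives |a|
    t^2 <= 1, so |a| (1 + |P|)^2 stays bounded as soon as [t] is comparable with [P]. In this way
    all thresholds depend only on [kap] and on the margins between [P], [Q] and the signs 1, -1. The
    condition with a^(2n) serves to locate roots inside the unit disk, but at a = 1, -1 it holds
    identically in [P] and [Q]; slow states need the divided form, with its geometric sum. In the
    interlacing arguments an end is replaced by 0 because 0 has distance 1 from both 1 and -1: it is
    never near a band edge, whatever the margin. *)

Definition coupling kap j : R := if odd j then kap else 1.

(* Site [j] of the chain is index [j.+1]: the value at index 0 is that of a
   fictitious site, through which the boundary condition at the left end reads
   as one more step of the recursion. *)
Fixpoint gpair kap P x j : R * R :=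
  if j is i.+1 then
    ((gpair kap P x i).2,
     (x * (gpair kap P x i).2 - coupling kap i * (gpair kap P x i).1)
       / coupling kap i.+1)
  else (- P, 1).

Definition gsol kap P x j : R := (gpair kap P x j).1.

(** The right boundary condition, imposed on the solution that already satisfies the left one: a
    characteristic function, whose zeros are the shifted eigenvalues. *)
Definition charf kap n P Q x : R :=
  gsol kap P x (2 * n).+1 + Q * gsol kap P x (2 * n).

Lemma gsol0 kap P x : gsol kap P x 0 = - P. Proof. by []. Qed.

Lemma gsol1 kap P x : gsol kap P x 1 = 1. Proof. by []. Qed.

Lemma gsolSS kap P x j :
  gsol kap P x j.+2 =
  (x * gsol kap P x j.+1 - coupling kap j * gsol kap P x j) / coupling kap j.+1.
Proof. by []. Qed.

Lemma coupling_gt0 kap j : 0 < kap -> 0 < coupling kap j.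
Proof. by rewrite /coupling; case: odd. Qed.

Lemma gsol_even kap P x n :
  gsol kap P x (2 * n.+1) =
  (x * gsol kap P x (2 * n).+1 - gsol kap P x (2 * n)) / kap.
Proof.
rewrite (_ : (2 * n.+1)%N = (2 * n).+2) ?mulnS// gsolSS /coupling /= mul2n.
by rewrite odd_double /= mul1r.
Qed.

Lemma gsol_odd kap P x n :
  gsol kap P x (2 * n.+1).+1 =
  x * gsol kap P x (2 * n.+1) - kap * gsol kap P x (2 * n).+1.
Proof.
rewrite (_ : (2 * n.+1)%N = (2 * n).+2) ?mulnS// gsolSS /coupling /= mul2n.
by rewrite odd_double /= divr1.
Qed.

(** The couplings do not vanish, so the left boundary condition and one value determine all the
    others. *)
Lemma gsol_unique kap P x (e : nat -> R) m : 0 < kap ->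
  e 0%N = - P * e 1%N ->
  (forall j, (j < m)%N ->
    x * e j.+1 = coupling kap j * e j + coupling kap j.+1 * e j.+2) ->
  forall j, (j <= m.+1)%N -> e j = e 1%N * gsol kap P x j.
Proof.
move=> kap0 e0 eS j jm.
suff /(_ j jm)[//] : forall j, (j <= m.+1)%N ->
  e j = e 1%N * gsol kap P x j /\
  ((j <= m)%N -> e j.+1 = e 1%N * gsol kap P x j.+1).
elim=> [_|i IH im]; first by rewrite e0 gsol0 gsol1 mulr1 mulrC.
have [IH1 /(_ im) IH2] := IH (ltnW im); split => // im'.
have c0 := lt0r_neq0 (coupling_gt0 i.+1 kap0).
apply: (mulfI c0); move: (eS i im').
rewrite gsolSS IH1 IH2 => /eqP.
rewrite addrC -subr_eq => /eqP <-; field; exact: c0.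
Qed.

(** The quotient of 1 - a^(2n) by 1 - a^2, in a form that has the value [n] at a = 1, -1. *)
Definition geomS n a : R := \sum_(j < n) a ^+ (2 * j).

Lemma geomSS n a : geomS n.+1 a = 1 + a ^+ 2 * geomS n a.
Proof.
rewrite /geomS big_ord_recl muln0 expr0 mulr_sumr; congr (_ + _).
by apply: eq_bigr => j _; rewrite -exprD lift0 mulnS.
Qed.

Lemma geomS_closed n a : geomS n a * (1 - a ^+ 2) = 1 - a ^+ (2 * n).
Proof.
elim: n => [|n IH]; first by rewrite /geomS big_ord0 muln0 expr0; ring.
by rewrite geomSS mulrDl mul1r -mulrA IH mulnS exprD; ring.
Qed.

(** Induction over the cells avoids an expansion in powers of [a] and 1 / a, which degenerates at a
    = 1, -1. The hypothesis on [x] is the dispersion relation without denominators. *)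
Lemma gsol_closed kap P x a n : kap != 0 -> a != 0 ->
  x ^+ 2 * a = (kap + a) * (1 + kap * a) ->
  a ^+ n * kap * gsol kap P x (2 * n) =
    a * geomS n a * (x + P) + kap * P * (geomS n a - 1) /\
  a ^+ n * kap * gsol kap P x (2 * n).+1 =
    a * geomS n a * (x * (x + P) - kap ^+ 2) - kap * (geomS n a - 1).
Proof.
move=> k0 a0 xa.
elim: n => [|n [IH1 IH2]].
  by rewrite /geomS big_ord0 muln0 gsol0 gsol1 expr0; split; ring.
set A := a ^+ n in IH1 IH2; set S := geomS n a in IH1 IH2 *.
set g := gsol _ _ _ (2 * n) in IH1; set g' := gsol _ _ _ (2 * n).+1 in IH2.
have e1 : a ^+ n.+1 * kap * gsol kap P x (2 * n.+1) =
    a * geomS n.+1 a * (x + P) + kap * P * (geomS n.+1 a - 1).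
  rewrite gsol_even exprS geomSS -/A -/S -/g -/g'.
  have -> : a * A * kap * ((x * g' - g) / kap) =
     a / kap * (x * (A * kap * g') - A * kap * g) by field.
  rewrite IH1 IH2.
  have xa' : x ^+ 2 = (kap + a) * (1 + kap * a) / a by rewrite -xa; field.
  have -> : x * (a * S * (x * (x + P) - kap ^+ 2) - kap * (S - 1)) -
     (a * S * (x + P) + kap * P * (S - 1)) =
     a * S * (x * x ^+ 2 + x ^+ 2 * P - kap ^+ 2 * x) - kap * (S - 1) * x -
     (a * S * (x + P) + kap * P * (S - 1)) by ring.
  by rewrite xa'; field; rewrite k0 a0.
split=> //; rewrite gsol_odd.
have -> : a ^+ n.+1 * kap * (x * gsol kap P x (2 * n.+1) - kap * g') =
   x * (a ^+ n.+1 * kap * gsol kap P x (2 * n.+1)) - a * kap * (A * kap * g').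
  by rewrite exprS -/A; ring.
rewrite e1 IH2 geomSS -/S.
apply/eqP; rewrite -subr_eq0; apply/eqP.
transitivity (a * kap * S * ((kap + a) * (1 + kap * a) - x ^+ 2 * a)).
  by ring.
by rewrite xa subrr mulr0.
Qed.

(** The relation for [t] rewrites the term P Q (kap + a) as P Q t^2 a (1 + kap a), which completes
    the product of the two boundary factors. *)
Lemma charfE kap n P Q t a : kap != 0 -> a != 0 ->
  t ^+ 2 * a * (1 + kap * a) = kap + a ->
  a ^+ n * kap * charf kap n P Q (- (t * (1 + kap * a))) =
  geomS n a * (a * (1 + kap * a) * ((1 - P * t) * (1 - Q * t)))
    + kap * (1 - P * Q).
Proof.
move=> k0 a0 ta; set x := - _.
have xa : x ^+ 2 * a = (kap + a) * (1 + kap * a) by rewrite -ta /x; ring.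
have [e1 e2] := gsol_closed P n k0 a0 xa.
rewrite /charf mulrDr e2 mulrCA e1.
transitivity (geomS n a * (a * (1 + kap * a) * (1 - (P + Q) * t)
  + P * Q * (t ^+ 2 * a * (1 + kap * a))) + kap * (1 - P * Q)); last by ring.
rewrite ta.
transitivity (geomS n a * ((1 + kap * a) * (t ^+ 2 * a * (1 + kap * a)) - kap - a * kap ^+ 2
   - a * (1 + kap * a) * ((P + Q) * t) + P * Q * (kap + a)) + kap * (1 - P * Q)).
  by rewrite /x; ring.
by rewrite ta; ring.
Qed.

End Recursion.

(** * Wronskian and interlacing of eigenvalues *)

Section Interlacing.
Context {R : realType}.
Implicit Types (kap P Q x a t : R) (n j : nat).

Fixpoint dgpair kap P x j : R * R :=
  if j is i.+1 then
    ((dgpair kap P x i).2,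
     (gsol kap P x i.+1 + x * (dgpair kap P x i).2
        - coupling kap i * (dgpair kap P x i).1) / coupling kap i.+1)
  else (0, 0).

Lemma is_derive_gpair kap P x j :
  is_derive x 1 (fun y => (gpair kap P y j).1) (dgpair kap P x j).1 /\
  is_derive x 1 (fun y => (gpair kap P y j).2) (dgpair kap P x j).2.
Proof.
elim: j => [|j [IH1 IH2]] /=; first by split; exact: is_derive_cst.
split=> //.
pose c := (coupling kap j.+1)^-1; pose d := coupling kap j.
have -> : (fun y => (y * (gpair kap P y j).2 - coupling kap j * (gpair kap P y j).1)
     / coupling kap j.+1) =
   c \*: (((@idfun R) * (fun y => (gpair kap P y j).2)) - d \*: (fun y => (gpair kap P y j).1)).
  by apply/funext => y; rewrite !fctE /= /c /d; rewrite mulrC.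
have H : is_derive x 1 (c \*: (((@idfun R) * (fun y => (gpair kap P y j).2))
    - d \*: (fun y => (gpair kap P y j).1)))
  (c *: ((idfun x *: (dgpair kap P x j).2 + (gpair kap P x j).2 *: 1)
    - d *: (dgpair kap P x j).1)).
  apply: is_deriveZ; apply: is_deriveB.
  by apply: is_deriveM; exact: is_derive_id.
apply: is_derive_eq.
by rewrite /c /d /gsol /= /GRing.scale /=; ring.
Qed.

Definition dgsol kap P x j := (dgpair kap P x j).1.

Lemma is_derive_gsol kap P x j :
  is_derive x 1 (fun y => gsol kap P y j) (dgsol kap P x j).
Proof. by have [] := is_derive_gpair kap P x j. Qed.

(* Christoffel-Darboux *)
Lemma gsol_wronskian kap P x j : 0 < kap ->
  coupling kap j * (dgsol kap P x j.+1 * gsol kap P x j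
                    - gsol kap P x j.+1 * dgsol kap P x j) =
  \sum_(i < j) gsol kap P x i.+1 ^+ 2.
Proof.
move=> kap0; elim: j => [|j IH].
  by rewrite big_ord0 /dgsol /= mul0r mulr0 subr0 mulr0.
have c0 := lt0r_neq0 (coupling_gt0 j.+1 kap0).
rewrite big_ord_recr /= -IH gsolSS.
rewrite {1}/dgsol /= -/(dgsol kap P x j) -/(dgsol kap P x j.+1).
by rewrite -/(gsol kap P x j.+1); field.
Qed.

(** The sum of squares starts with the first entry, which is normalised to 1. *)
Lemma gsol_wronskian_gt0 kap P x n : 0 < kap -> (0 < n)%N ->
  0 < dgsol kap P x (2 * n).+1 * gsol kap P x (2 * n)
      - gsol kap P x (2 * n).+1 * dgsol kap P x (2 * n).
Proof.
move=> kap0 n0; have /(_ (2 * n)%N) := gsol_wronskian P x _ kap0.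
rewrite /coupling mul2n odd_double /= mul1r => ->.
case: n n0 => // n _; rewrite doubleS big_ord_recl gsol1 expr1n.
by rewrite ltr_pwDl// sumr_ge0// => i _; rewrite sqr_ge0.
Qed.

(** Sturm separation. If [charf] for [Q'] had no zero in between, Rolle's theorem would apply to the
    quotient of [charf] for [Q] by that for [Q']; but the numerator of its derivative is Q' - Q
    times the positive Wronskian. *)
Lemma charf_interlacing kap n P Q Q' x0 x1 : 0 < kap -> (0 < n)%N -> Q != Q' ->
  x0 < x1 -> charf kap n P Q x0 = 0 -> charf kap n P Q x1 = 0 ->
  exists2 x, x0 < x < x1 & charf kap n P Q' x = 0.
Proof.
move=> kap0 n0 QQ' x01 f0 f1.
apply: contrapT => nex.
(* A common zero for [Q] and [Q'] would make two consecutive values of [gsol] vanish, and with them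
   the Wronskian. *)
have g_end x : charf kap n P Q x = 0 -> charf kap n P Q' x != 0.
  move=> fx; apply/negP => /eqP gx.
  have h0 : gsol kap P x (2 * n) = 0.
    have : (Q - Q') * gsol kap P x (2 * n) = 0.
      by rewrite -[RHS](subrr 0) -{1}fx -gx /charf; ring.
    by move/eqP; rewrite mulf_eq0 subr_eq0 (negbTE QQ') => /eqP.
  have h1 : gsol kap P x (2 * n).+1 = 0 by rewrite -fx /charf h0 mulr0 addr0.
  by have := gsol_wronskian_gt0 P x kap0 n0; rewrite h0 h1 mulr0 mul0r subr0 ltxx.
have gN x : x0 <= x <= x1 -> charf kap n P Q' x != 0.
  move=> /andP[]; rewrite !le_eqVlt.
  move=> /predU1P[<-|xx0] /predU1P[->|xx1]; try exact: g_end.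
  by apply/negP => /eqP gx; apply: nex; exists x => //; rewrite xx0.
pose df S x := dgsol kap P x (2 * n).+1 + S *: dgsol kap P x (2 * n).
have fD S x : is_derive x 1 (charf kap n P S) (df S x).
  apply: is_deriveD; first exact: is_derive_gsol.
  by apply: is_deriveZ; exact: is_derive_gsol.
pose h x := charf kap n P Q x / charf kap n P Q' x.
pose dh x := charf kap n P Q x *: (- charf kap n P Q' x ^- 2 *: df Q' x)
  + (charf kap n P Q' x)^-1 *: df Q x.
have hD x : x0 <= x <= x1 -> is_derive x 1 h (dh x).
  move=> xI; apply: is_deriveM; apply: is_deriveV; exact: gN.
have [|||c] := @Rolle R h x0 x1 x01.
- move=> x; rewrite in_itv /= => /andP[/ltW xx0 /ltW xx1].
  by have [] := hD x; rewrite ?xx0.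
- apply: derivable_within_continuous => x; rewrite in_itv /= => xI.
  by have [] := hD x xI.
- by rewrite /h f0 f1 !mul0r.
rewrite in_itv /= => /andP[/ltW c0 /ltW c1] h'.
have cI : x0 <= c <= x1 by rewrite c0.
have gc := gN c cI.
have hd := hD c cI.
have : dh c = 0 by case: hd => _ <-; case: h'.
have w := gsol_wronskian_gt0 P c kap0 n0.
rewrite /dh /df /GRing.scale /= => /(congr1 (fun z => z * charf kap n P Q' c ^+ 2)).
rewrite mul0r => e.
have : (Q' - Q) * (dgsol kap P c (2 * n).+1 * gsol kap P c (2 * n)
      - gsol kap P c (2 * n).+1 * dgsol kap P c (2 * n)) = 0.
  rewrite -e /charf; move: gc; rewrite /charf => gc; field; exact: gc.
move/eqP; rewrite mulf_eq0 subr_eq0 eq_sym (negbTE QQ') /= => /eqP w0.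
by rewrite w0 ltxx in w.
Qed.

End Interlacing.

(** * Eigenvectors of the chain matrix *)

Section Chain.
Context {R : realType}.
Implicit Types (w : R) (n j : nat).

Lemma entry_ord m (u : 'cV[R]_m) (i : 'I_m) : entry u i = u i ord0.
Proof. by rewrite /entry valK. Qed.

Lemma entry_out m (u : 'cV[R]_m) j : (m <= j)%N -> entry u j = 0.
Proof. by move=> mj; rewrite /entry insubN// -leqNgt. Qed.

Lemma entry_col m (f : nat -> R) j : (j < m)%N ->
  entry (\col_(i < m) f i) j = f j.
Proof. by move=> jm; rewrite -[j]/(val (Ordinal jm)) entry_ord mxE. Qed.

Lemma sum_entry m (u : 'cV[R]_m) k :
  \sum_(j < m) (j == k :> nat)%:R * u j ord0 = entry u k.
Proof.
have [km|mk] := ltnP k m; last first.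
  rewrite entry_out// big1// => j _.
  by rewrite (_ : (_ == _) = false) ?mul0r//; apply/negbTE; rewrite neq_ltn (leq_trans _ mk).
rewrite (bigD1 (Ordinal km))//= eqxx mul1r -[k in entry u k]/(val (Ordinal km)) entry_ord.
rewrite big1 ?addr0// => j jk.
by rewrite (_ : (j == k :> nat) = false) ?mul0r//; apply/negbTE.
Qed.

Definition chain_diag (k1 k2 k31 k32 : R) n j : R :=
  if j == 0%N then - k1 - k31 else
  if j == (2 * n).-1 then - k1 - k32 else - k1 - k2.

Definition chain_coupling (k1 k2 : R) j : R := if odd j then k2 else k1.

Lemma chain_mx_row (k1 k2 k31 k32 : R) n (u : 'cV[R]_(2 * n)) (i : 'I_(2 * n)) :
  (chain_mx k1 k2 k31 k32 n *m u) i ord0 =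
  chain_diag k1 k2 k31 k32 n i * entry u i
  + (if (0 < i)%N then chain_coupling k1 k2 i.-1 * entry u i.-1 else 0)
  + chain_coupling k1 k2 i * entry u i.+1.
Proof.
have -> : (if (0 < i)%N then chain_coupling k1 k2 i.-1 * entry u i.-1 else 0) =
   chain_coupling k1 k2 i.-1 * (0 < i)%:R * entry u i.-1.
  by case: ifP => _; rewrite ?mulr1// mulr0 mul0r.
rewrite mxE -!sum_entry !mulr_sumr -!big_split/=.
apply: eq_bigr => j _; rewrite !mxE !mulrA -!mulrDl; congr (_ * _).
rewrite -val_eqE /= [(i == j :> nat)]eq_sym.
have [ji|ji] := eqVneq (j : nat) i.
  rewrite ji /chain_diag.
  have -> : (i == i.+1 :> nat) = false by apply/negbTE; rewrite neq_ltn ltnSn.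
  case: (val i) => [|k] /=; first by rewrite !mulr0 mulr1 mul0r !addr0.
  have -> : (k.+1 == k)%N = false by apply/negbTE; rewrite neq_ltn ltnSn orbT.
  by rewrite !mulr0 mulr1 !addr0.
rewrite mulr0 add0r [(i.+1 == j :> nat)]eq_sym.
have [ji1|ji1] := eqVneq (j : nat) i.+1.
  rewrite ji1 /= (_ : (i.+1 == i.-1)%N = false) ?mulr0 ?mulr1 ?add0r; last first.
    by apply/negbTE; rewrite neq_ltn orbC ltnS leq_pred.
  by rewrite /chain_coupling (minn_idPl _)// leqnSn.
rewrite mulr0 addr0 /=.
have [|ji2] := eqVneq (j : nat).+1 i.
  case: (val i) => // k [<-] /=; rewrite eqxx !mulr1.
  by rewrite /chain_coupling (minn_idPr _)// leqnSn.
case i0 : (val i) ji2 => [|k]; first by rewrite mulr0 mul0r.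
by rewrite eqSS => /negbTE /= ->; rewrite mulr0.
Qed.

(* The state extended by the two fictitious sites that encode the boundary
   conditions, with the index shift of [gsol]. *)
Definition extension (P Q : R) n (u : 'cV[R]_(2 * n)) j : R :=
  if j == 0%N then - P * entry u 0 else
  if j == (2 * n).+1 then - Q * entry u (2 * n).-1 else entry u j.-1.

Lemma extensionS P Q n (u : 'cV[R]_(2 * n)) j : (j < 2 * n)%N ->
  extension P Q u j.+1 = entry u j.
Proof.
by move=> jn; rewrite /extension /= eqSS (_ : (j == _) = false)//; apply/negbTE; rewrite neq_ltn jn.
Qed.

(** The fictitious neighbours turn the boundary rows into interior ones: -k1 - k31 is the interior
    value -k1 - k2 plus the contribution -k2 P of the left neighbour. *)
Lemma chain_eigenP (k1 k2 k31 k32 : R) w n (u : 'cV[R]_(2 * n)) :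
  let kap := k1 / k2 in let x := (k1 + k2 - w ^+ 2) / k2 in
  let e := extension (k31 / k2 - 1) (k32 / k2 - 1) u in
  0 < k2 ->
  chain_mx k1 k2 k31 k32 n *m u = (- w ^+ 2) *: u <->
  forall j, (j < 2 * n)%N ->
    x * e j.+1 = coupling kap j * e j + coupling kap j.+1 * e j.+2.
Proof.
move=> kap x e k20.
have k2N := lt0r_neq0 k20.
suff row (i : 'I_(2 * n)) :
    (chain_mx k1 k2 k31 k32 n *m u) i ord0 + w ^+ 2 * u i ord0 =
    - k2 * (x * e i.+1 - (coupling kap i * e i + coupling kap i.+1 * e i.+2)).
  split=> [Lu j jn|rec].
    have := row (Ordinal jn); rewrite Lu mxE mulNr addNr => /esym/eqP.
    by rewrite mulf_eq0 oppr_eq0 (negbTE k2N)/= subr_eq0 => /eqP.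
  apply/matrixP => i z; rewrite (ord1 z) [RHS]mxE; apply/eqP.
  by rewrite mulNr -subr_eq0 opprK row rec// subrr mulr0.
rewrite chain_mx_row -entry_ord /e extensionS//.
have n0 : (0 < n)%N by have := leq_ltn_trans (leq0n i) (ltn_ord i); rewrite muln_gt0.
have n2 : (1 < 2 * n)%N by rewrite leq_pmulr.
have e2 : extension (k31 / k2 - 1) (k32 / k2 - 1) u i.+2 =
    if i == (2 * n).-1 :> nat then - (k32 / k2 - 1) * entry u i else entry u i.+1.
  have predE (k : nat) : (k.+1 == 2 * n)%N = (k == (2 * n).-1).
    by rewrite -[in LHS](prednK (ltnW n2)) eqSS.
  by rewrite /extension /= eqSS predE; case: eqP => // ->.
have last0 : (i == (2 * n).-1 :> nat) -> entry u i.+1 = 0.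
  by move=> /eqP ->; rewrite entry_out// prednK// ltnW.
(* The last index is odd, so the link to the right fictitious site has strength [k2], as on the
   left. *)
have last_odd : odd (2 * n).-1 by rewrite -subn1 oddB// ?mul2n ?odd_double// -mul2n ltnW.
rewrite e2 /chain_diag /chain_coupling /coupling.
case i0 : (val i) e2 last0 => [|k] _ last0.
  rewrite /= (_ : (0 == (2 * n).-1)%N = false); last first.
    by rewrite eq_sym; apply/negbTE; rewrite -lt0n -ltnS prednK// ltnW.
  by rewrite /extension /= /x /kap; field.
rewrite /extension /= eqSS (_ : (k == (2 * n))%N = false); last first.
  by apply/negbTE; rewrite neq_ltn (leq_trans _ (ltn_ord i))// i0.
case: ifP => kn.
  rewrite last0//; move: last_odd; rewrite -(eqP kn) /= => ok.
  by rewrite ok (negbTE ok) /= /x /kap; field.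
by case: (odd k); rewrite /= /x /kap; field.
Qed.

(** A state is determined by its first entry, so eigenspaces are lines; later this turns the
    counting of states into a counting of values of [x]. *)
Lemma chain_eigen_gsol (k1 k2 k31 k32 : R) w n (u : 'cV[R]_(2 * n)) :
  let kap := k1 / k2 in let x := (k1 + k2 - w ^+ 2) / k2 in
  let P := k31 / k2 - 1 in let Q := k32 / k2 - 1 in
  0 < k1 -> 0 < k2 -> (0 < n)%N ->
  chain_mx k1 k2 k31 k32 n *m u = (- w ^+ 2) *: u ->
  u = entry u 0 *: \col_i gsol kap P x i.+1 /\
  (u != 0 -> charf kap n P Q x = 0).
Proof.
move=> kap x P Q k10 k20 n0 /(chain_eigenP _ _ _ _ _ k20); rewrite -/kap -/x -/P -/Q => rec.
have kap0 : 0 < kap by rewrite divr_gt0.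
have n2 : (0 < 2 * n)%N by rewrite muln_gt0.
have e0 : extension P Q u 0 = - P * extension P Q u 1 by rewrite extensionS.
have gE := gsol_unique kap0 e0 rec.
have uE : u = entry u 0 *: \col_i gsol kap P x i.+1.
  apply/matrixP => i z; rewrite (ord1 z) !mxE -entry_ord.
  by rewrite -(extensionS P Q)// gE ?ltnS 1?ltnW// extensionS.
split=> // uN0; apply/eqP.
have u0 : entry u 0 != 0.
  by apply: contra_neq uN0 => u0; rewrite uE u0 scale0r.
have := gE (2 * n).+1 (leqnn _); have := gE (2 * n)%N (leqnSn _).
have -> : extension P Q u (2 * n) = entry u (2 * n).-1.
  by rewrite -(extensionS P Q) prednK.
rewrite (extensionS P Q)// /extension /= eqxx => -> /eqP.
rewrite -subr_eq0 => /eqP E.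
apply/eqP; apply: (mulfI u0); rewrite mulr0 -[RHS]oppr0 -E /charf; ring.
Qed.

Lemma chain_eigen_of_charf (k1 k2 k31 k32 : R) w n :
  let kap := k1 / k2 in let x := (k1 + k2 - w ^+ 2) / k2 in
  let P := k31 / k2 - 1 in let Q := k32 / k2 - 1 in
  0 < k1 -> 0 < k2 -> (0 < n)%N -> 0 <= w ->
  charf kap n P Q x = 0 ->
  eigenstate (chain_mx k1 k2 k31 k32 n) (\col_i gsol kap P x i.+1) w.
Proof.
move=> kap x P Q k10 k20 n0 w0 f0.
have n2 : (0 < 2 * n)%N by rewrite muln_gt0.
split=> //.
  apply/negP => /eqP/matrixP/(_ (Ordinal n2) ord0).
  by rewrite !mxE gsol1 => /eqP; rewrite oner_eq0.
apply/(chain_eigenP _ _ _ _ _ k20); rewrite -/kap -/x -/P -/Q.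
set u := \col_i _.
suff extE j : (j <= (2 * n).+1)%N -> extension P Q u j = gsol kap P x j.
  move=> j jn; rewrite !extE// 1?ltnW// 1?ltnW// gsolSS.
  have cN := lt0r_neq0 (coupling_gt0 j.+1 (divr_gt0 k10 k20)).
  by field.
case: j => [_|j]; first by rewrite /extension /= (entry_col (fun i => gsol kap P x i.+1)) ?gsol1 ?gsol0 ?mulr1.
rewrite ltnS leq_eqVlt => /predU1P[->|jn]; last first.
  by rewrite extensionS// (entry_col (fun i => gsol kap P x i.+1)).
rewrite /extension /= eqxx (entry_col (fun i => gsol kap P x i.+1)) ?prednK//.
by apply/eqP; rewrite -subr_eq0 -oppr_eq0 -f0 /charf; apply/eqP; ring.
Qed.

End Chain.

(** * Multipliers and quantization *)

Section Dispersion.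
Context {R : realType}.
Variable kap : R.
Hypotheses (kap_gt0 : 0 < kap) (kap_lt1 : kap < 1).
Implicit Types (P Q x a t s d : R) (n : nat).

(* In the pure mode [a], [u_(2m+1) = - (a * t) * u_(2m)].  In the variable [t]
   the two boundary factors become Blaschke factors. *)
Definition disp x t a : Prop :=
  [/\ a != 0, `|a| <= 1, t ^+ 2 * a * (1 + kap * a) = kap + a &
      x = - (t * (1 + kap * a))].

Lemma disp_factor_gt0 a : `|a| <= 1 -> 0 < 1 + kap * a.
Proof.
rewrite ler_norml => /andP[a1 _].
by have := ler_wpM2l (ltW kap_gt0) a1; move: kap_lt1; lra.
Qed.

Lemma disp_intro x a : a != 0 -> `|a| <= 1 ->
  x ^+ 2 = 1 + kap ^+ 2 + kap * (a + a^-1) ->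
  disp x (- x / (1 + kap * a)) a.
Proof.
move=> a0 a1 xE; have h0 := lt0r_neq0 (disp_factor_gt0 a1).
split=> //; last by field.
have -> : (- x / (1 + kap * a)) ^+ 2 * a * (1 + kap * a) = x ^+ 2 * a / (1 + kap * a) by field.
by rewrite xE; field; rewrite h0 a0.
Qed.

Lemma disp_sqr x t a : disp x t a -> x ^+ 2 = 1 + kap ^+ 2 + kap * (a + a^-1).
Proof.
move=> [a0 a1 tE ->]; have h0 := lt0r_neq0 (disp_factor_gt0 a1).
have -> : (- (t * (1 + kap * a))) ^+ 2 = (t ^+ 2 * a * (1 + kap * a)) * (1 + kap * a) / a by field.
by rewrite tE; field.
Qed.

Lemma dispN x t a : disp x t a -> disp (- x) (- t) a.
Proof. by move=> [a0 a1 tE ->]; split; rewrite ?sqrrN// mulNr. Qed.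

(** Inside the unit disk [t ^+ 2 - 1] has the sign of [a]; the band edges are exactly t = 1, -1. *)
Lemma disp_sqrB1 x t a : disp x t a ->
  (t ^+ 2 - 1) * (a * (1 + kap * a)) = kap * (1 - a ^+ 2).
Proof. by move=> [_ _ tE _]; rewrite mulrBl mulrA tE; ring. Qed.

Lemma disp_le1 x t a : disp x t a -> a < 0 -> `|t| <= 1.
Proof.
move=> D aN; have [_ a1 _ _] := D; have h0 := disp_factor_gt0 a1.
have := disp_sqrB1 D; have a2 : a ^+ 2 <= 1 by rewrite -(real_normK (num_real a)) expr_le1.
rewrite -(ler_pXn2r (n := 2)) ?nnegrE// expr1n (real_normK (num_real t)) => e.
have ah : a * (1 + kap * a) < 0 by rewrite nmulr_rlt0.
by rewrite -subr_le0 -(nmulr_lge0 _ ah) e mulr_ge0 ?subr_ge0// ltW.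
Qed.

Lemma disp_ge1 x t a : disp x t a -> 0 < a -> 1 <= `|t|.
Proof.
move=> D aP; have [_ a1 _ _] := D; have h0 := disp_factor_gt0 a1.
have := disp_sqrB1 D; have a2 : a ^+ 2 <= 1 by rewrite -(real_normK (num_real a)) expr_le1.
rewrite -[1 <= _](ler_pXn2r (n := 2)) ?nnegrE// expr1n (real_normK (num_real t)) => e.
have ah : 0 < a * (1 + kap * a) by rewrite mulr_gt0.
by rewrite -subr_ge0 -(pmulr_lge0 _ ah) e mulr_ge0 ?subr_ge0// ltW.
Qed.

Definition quantized n P Q t a : Prop :=
  geomS n a * (a * (1 + kap * a) * ((1 - P * t) * (1 - Q * t)))
    + kap * (1 - P * Q) = 0.

Lemma charf_quantized n P Q x t a : disp x t a ->
  charf kap n P Q x = 0 <-> quantized n P Q t a.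
Proof.
move=> [a0 _ tE ->].
rewrite /quantized -(charfE n P Q (lt0r_neq0 kap_gt0) a0 tE).
split=> [->|/eqP]; first by rewrite mulr0.
have c : a ^+ n * kap != 0 by rewrite mulf_neq0 ?expf_neq0// lt0r_neq0.
by rewrite mulf_eq0 (negbTE c) => /eqP.
Qed.

Lemma quantizedC n P Q t a : quantized n P Q t a -> quantized n Q P t a.
Proof. by rewrite /quantized [(1 - Q * t) * _]mulrC [Q * P]mulrC. Qed.

Lemma quantizedN n P Q t a :
  quantized n P Q t a -> quantized n (- P) (- Q) (- t) a.
Proof. by rewrite /quantized !mulrNN. Qed.

(** Multiply by 1 - a^2 and use [disp_sqrB1]; what remains is the identity (1 - P t)(1 - Q t) + (t^2
    - 1)(1 - P Q) = (t - P)(t - Q). *)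
Lemma quantized_blaschke n P Q x t a : disp x t a ->
  quantized n P Q t a ->
  (t - P) * (t - Q) = a ^+ (2 * n) * ((1 - P * t) * (1 - Q * t)).
Proof.
move=> D q; have [a0 a1 tE _] := D.
have h0 := lt0r_neq0 (disp_factor_gt0 a1).
apply: (mulfI (mulf_neq0 a0 h0)).
have S := geomS_closed n a.
have -> : a ^+ (2 * n) = 1 - geomS n a * (1 - a ^+ 2) by rewrite S; ring.
apply/eqP; rewrite -subr_eq0; apply/eqP.
transitivity ((1 - a ^+ 2) * (geomS n a * (a * (1 + kap * a) * ((1 - P * t) * (1 - Q * t)))
   + kap * (1 - P * Q))
   + (1 - P * Q) * ((t ^+ 2 - 1) * (a * (1 + kap * a)) - kap * (1 - a ^+ 2))).
  by ring.
by rewrite (disp_sqrB1 D) q; ring.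
Qed.

Lemma blaschke_quantized n P Q x t a : disp x t a -> a ^+ 2 != 1 ->
  (t - P) * (t - Q) = a ^+ (2 * n) * ((1 - P * t) * (1 - Q * t)) ->
  quantized n P Q t a.
Proof.
move=> D a2 e; have [a0 a1 tE _] := D.
apply: (mulfI (x := 1 - a ^+ 2)); first by rewrite subr_eq0 eq_sym.
rewrite mulr0.
transitivity (a * (1 + kap * a) * ((t - P) * (t - Q) - (1 - geomS n a * (1 - a ^+ 2))
      * ((1 - P * t) * (1 - Q * t)))
   - (1 - P * Q) * ((t ^+ 2 - 1) * (a * (1 + kap * a)) - kap * (1 - a ^+ 2))).
  by ring.
by rewrite (disp_sqrB1 D) geomS_closed e; ring.
Qed.

(** [x] fixes a + 1 / a, hence [a] up to inversion; two mutually inverse real numbers in [-1, 1] are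
    both 1 or both -1. *)
Lemma disp_inj x t a t' a' : disp x t a -> disp x t' a' -> t = t' /\ a = a'.
Proof.
move=> D D'; have [a0 a1 _ xE] := D; have [a0' a1' _ xE'] := D'.
suff aa : a = a'.
  split=> //; apply: (mulIf (lt0r_neq0 (disp_factor_gt0 a1))).
  by apply: oppr_inj; rewrite -xE xE' aa.
have := disp_sqr D; rewrite {1}(disp_sqr D') => /addrI/(mulfI (lt0r_neq0 kap_gt0)) e.
have : (a' - a) * (a * a' - 1) = 0.
  transitivity (a * a' * ((a' + a'^-1) - (a + a^-1))); last by rewrite e subrr mulr0.
  by field; rewrite a0 a0'.
move/eqP; rewrite mulf_eq0 => /orP[/eqP/subr0_eq//|/eqP/subr0_eq].
move: a1 a1'; rewrite !ler_norml => /andP[? ?] /andP[? ?] aa.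
by nra.
Qed.

Lemma affine_between (c b b' lo hi u0 u1 u : R) :
  lo <= c * (u0 - b - b') <= hi -> lo <= c * (u1 - b - b') <= hi ->
  Num.min u0 u1 <= u -> u <= Num.max u0 u1 -> lo <= c * (u - b - b') <= hi.
Proof.
rewrite le_max ge_min => /andP[? ?] /andP[? ?].
have [c0|/ltW c0] := lerP 0 c.
  by move=> /orP[] /(ler_wpM2l c0) ? /orP[] /(ler_wpM2l c0) ?; apply/andP; split; lra.
by move=> /orP[] /(ler_wnM2l c0) ? /orP[] /(ler_wnM2l c0) ?; apply/andP; split; lra.
Qed.

(* The values of [x] belonging to slow modes with given signs of [a] and [t]
   form an interval. *)
Lemma disp_between eps x0 t0 a0 x1 t1 a1 x :
  disp x0 t0 a0 -> disp x1 t1 a1 -> 1 - eps < `|a0| -> 1 - eps < `|a1| ->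
  0 < a0 * a1 -> 0 < t0 * t1 -> x0 < x < x1 ->
  exists t a, [/\ disp x t a, 1 - eps < `|a|, 0 < a * a0 & 0 < t * t0].
Proof.
move=> D0 D1 e0 e1 a01 t01 /andP[xx0 xx1].
have [a0N a0le _ x0E] := D0; have [a1N a1le _ x1E] := D1.
have h0 := disp_factor_gt0 a0le; have h1 := disp_factor_gt0 a1le.
have x01 : 0 < x0 * x1 by rewrite x0E x1E mulrNN mulrACA mulr_gt0// mulr_gt0.
have [xle xge xsg] : [/\ x ^+ 2 <= Num.max (x0 ^+ 2) (x1 ^+ 2),
   Num.min (x0 ^+ 2) (x1 ^+ 2) <= x ^+ 2 & 0 < x * x0].
  rewrite le_max ge_min.
  have [x0P|x0P] := ltP 0 x0.
    have x1P : 0 < x1 by rewrite -(pmulr_rgt0 _ x0P).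
    by split; [apply/orP; right|apply/orP; left|]; nra.
  have x0N : x0 < 0.
    by rewrite lt_neqAle x0P andbT; apply: contraTneq x01 => ->; rewrite mul0r ltxx.
  have x1P : x1 < 0 by rewrite -(nmulr_rgt0 _ x0N).
  by split; [apply/orP; left|apply/orP; right|]; nra.
pose sg := Num.sg a0.
have [sg2 sga0 sga1] : [/\ sg * sg = 1, a0 = sg * `|a0| & a1 = sg * `|a1|].
  split; first by rewrite /sg -expr2 sqr_sg a0N.
    by rewrite -numEsg.
  rewrite /sg; have -> : Num.sg a0 = Num.sg a1; last by rewrite -numEsg.
  have : Num.sg (a0 * a1) = 1 by rewrite gtr0_sg.
  rewrite sgrM => s01; have s0 := sqr_sg a0; have s1 := sqr_sg a1.
  rewrite a0N in s0; rewrite a1N in s1.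
  by rewrite -[LHS]mulr1 -[1]s1 expr2 mulrA s01 mul1r.
pose m := Num.min `|a0| `|a1|.
have m0 : 0 < m by rewrite lt_min !normr_gt0 a0N.
have m1 : m <= 1 by rewrite ge_min a0le.
have me : 1 - eps < m by rewrite lt_min e0.
(* At the two ends this is |a| + 1 / |a|. It is affine in x^2, so its value at [x] lies between the
   end values. *)
pose y := sg * (x ^+ 2 - 1 - kap ^+ 2) / kap.
have yE b : b != 0 -> sg * b^-1 = (sg * b)^-1 :> R.
  by move=> b0; apply: (mulrI (x := sg)); rewrite ?mulrA ?sg2; [rewrite unitfE; apply: contra_eq_neq sg2 => ->; rewrite mul0r eq_sym oner_eq0|rewrite invfM mulrA mulfV ?mul1r//; apply: contra_eq_neq sg2 => ->; rewrite mul0r eq_sym oner_eq0].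
have y0E b z : z ^+ 2 = 1 + kap ^+ 2 + kap * (sg * b + (sg * b)^-1) -> b != 0 ->
   sg * (z ^+ 2 - 1 - kap ^+ 2) / kap = b + b^-1.
  move=> -> b0; rewrite -yE//.
  transitivity (sg * sg * (b + b^-1)); last by rewrite sg2 mul1r.
  by field; rewrite b0 lt0r_neq0.
have a0n : `|a0| != 0 by rewrite normr_eq0.
have a1n : `|a1| != 0 by rewrite normr_eq0.
have Y0 := y0E `|a0| x0; rewrite -sga0 in Y0; have {}Y0 := Y0 (disp_sqr D0) a0n.
have Y1 := y0E `|a1| x1; rewrite -sga1 in Y1; have {}Y1 := Y1 (disp_sqr D1) a1n.
have ge2 (b : R) : 0 < b -> 2 <= b + b^-1.
  move=> b0; rewrite -subr_ge0 (_ : _ - 2 = (b - 1) ^+ 2 / b).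
    by apply: divr_ge0; [exact: sqr_ge0|exact: ltW].
  by field; exact: lt0r_neq0.
have le2 (b : R) : m <= b <= 1 -> b + b^-1 <= m + m^-1.
  move=> /andP[mb b1]; have b0 := lt_le_trans m0 mb.
  rewrite -subr_ge0 (_ : _ - _ = (b - m) * (1 - b * m) / (b * m)).
    have bm : b * m <= 1 by rewrite mulr_ile1// ltW.
    by apply: divr_ge0; apply: mulr_ge0; rewrite ?subr_ge0// ltW.
  by field; rewrite !lt0r_neq0.
have yb : 2 <= y <= m + m^-1.
  have u0 : `|a0| + `|a0|^-1 <= m + m^-1 by apply: le2; rewrite ge_min lexx.
  have u1 : `|a1| + `|a1|^-1 <= m + m^-1 by apply: le2; rewrite ge_min lexx orbT.
  have l0 : 2 <= `|a0| + `|a0|^-1 by apply: ge2; rewrite lt0r a0n /=.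
  have l1 : 2 <= `|a1| + `|a1|^-1 by apply: ge2; rewrite lt0r a1n /=.
  rewrite -Y0 in u0 l0; rewrite -Y1 in u1 l1.
  have ylin z : sg * (z ^+ 2 - 1 - kap ^+ 2) / kap = (sg / kap) * (z ^+ 2 - 1 - kap ^+ 2) by rewrite mulrAC.
  rewrite /y; rewrite !ylin in u0 u1 l0 l1 *.
  by apply: (affine_between _ _ xge xle); apply/andP; split.
(* The new |a| solves z + 1 / z = y; the quadratic is nonnegative at [m] and nonpositive at 1. *)
have [z zI zr] : exists2 z, m <= z <= 1 & root ('X^2 - y *: 'X + 1) z.
  have [z zI] : exists2 z, m <= z <= 1 & root (- ('X^2 - y *: 'X + 1)) z.
    apply: poly_ivt => //; rewrite !hornerE /=; case/andP: yb => y2 ym.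
    apply/andP; split; last by lra.
    rewrite oppr_le0; have := ler_wpM2r (ltW m0) ym.
    by rewrite mulrDl mulVf ?lt0r_neq0//; lra.
  by rewrite rootN => zr; exists z.
have /andP[mz z1] := zI; have z0 := lt_le_trans m0 mz.
have zy : z + z^-1 = y.
  move: zr; rewrite rootE !hornerE /= => /eqP e.
  apply: (mulfI (lt0r_neq0 z0)); rewrite mulrDr mulfV ?lt0r_neq0//; lra.
have sgn : `|sg| = 1 by rewrite /sg normr_sg a0N.
have az : sg * z != 0 by rewrite -normr_gt0 normrM sgn mul1r normr_gt0 lt0r_neq0.
have D : disp x (- x / (1 + kap * (sg * z))) (sg * z).
  apply: disp_intro => //; first by rewrite normrM sgn mul1r gtr0_norm.
  rewrite -yE ?lt0r_neq0// -mulrDr zy /y.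
  rewrite (_ : sg * (sg * _ / kap) = sg * sg * (x ^+ 2 - 1 - kap ^+ 2) / kap); last by ring.
  by rewrite sg2; field; exact: lt0r_neq0.
exists (- x / (1 + kap * (sg * z))), (sg * z); split=> //.
- by rewrite normrM sgn mul1r gtr0_norm// (lt_le_trans me).
- by rewrite [X in _ * X]sga0 mulrACA sg2 mul1r mulr_gt0// normr_gt0.
- have [_ hz _ _] := D; have := disp_factor_gt0 hz => h.
  move: xsg; rewrite x0E mulrN -mulNr mulrA pmulr_lgt0// => xt.
  by rewrite mulrAC divr_gt0.
Qed.

End Dispersion.

(** * Slowly decaying states *)

Section SlowStates.
Context {R : realType}.
Variable kap : R.
Hypotheses (kap_gt0 : 0 < kap) (kap_lt1 : kap < 1).
Implicit Types (P Q x a t s d eps eta nu : R) (n : nat).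
Local Notation disp := (disp kap).
Local Notation quantized := (quantized kap).

(** Acts as a filter in [n] and [a]. The thresholds are fixed before [x], [t], [P] and [Q], which
    makes the slow estimates uniform in the stiffnesses. *)
Definition slowly (Pr : nat -> R -> Prop) : Prop :=
  exists2 eps, 0 < eps & exists N, forall n a,
    (N <= n)%N -> 1 - eps < `|a| -> `|a| <= 1 -> Pr n a.

Lemma slowly_and Pr Pr' :
  slowly Pr -> slowly Pr' -> slowly (fun n a => Pr n a /\ Pr' n a).
Proof.
move=> [e e0 [N H]] [e' e0' [N' H']].
exists (Num.min e e'); first by rewrite lt_min e0.
exists (maxn N N') => n a; rewrite geq_max => /andP[nN nN'] ae a1.
have m1 : Num.min e e' <= e by rewrite ge_min lexx.
have m2 : Num.min e e' <= e' by rewrite ge_min lexx orbT.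
by split; [apply: H|apply: H'] => //; apply: le_lt_trans ae; rewrite lerB.
Qed.

Lemma slowlyW Pr Pr' : (forall n a, Pr n a -> Pr' n a) ->
  slowly Pr -> slowly Pr'.
Proof.
move=> PP [e e0 [N H]]; exists e => //; exists N => n a nN ae a1.
exact/PP/H.
Qed.

Lemma geomS_ge1 n a : (0 < n)%N -> 1 <= geomS n a.
Proof.
case: n => // n _; rewrite geomSS lerDl mulr_ge0 ?sqr_ge0// sumr_ge0// => j _.
by rewrite exprM exprn_ge0 ?sqr_ge0.
Qed.

Lemma bernoulli_le (u : R) n : 0 <= u <= 1 -> 1 - n%:R * u <= (1 - u) ^+ n.
Proof.
move=> /andP[u0 u1]; elim: n => [|n IH]; first by rewrite mul0r subr0.
rewrite exprS; have := ler_wpM2l (x := 1 - u) _ IH.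
rewrite subr_ge0 => /(_ u1); apply: le_trans.
rewrite -(natr1 n); have : 0 <= n%:R * u ^+ 2 by rewrite mulr_ge0 ?sqr_ge0.
lra.
Qed.

(** A fixed number m + 1 of terms suffices: for |a| within 1 / (4 (m + 1)) of 1, each of them is at
    least 1 / 2 by Bernoulli's inequality. *)
Lemma slowly_geomS (M : R) : slowly (fun n a => M <= geomS n a).
Proof.
have [m Mm] : exists m : nat, 2 * M <= m%:R.
  exists (Num.trunc `|2 * M|).+1; apply: ltW.
  by rewrite (le_lt_trans (ler_norm _))// truncnS_gt.
pose e : R := (4 * m.+1%:R)^-1.
have m0 : 0 < 4 * m.+1%:R :> R by rewrite mulr_gt0.
have e0 : 0 < e by rewrite invr_gt0.
have e1 : e <= 1.
  by rewrite invf_le1// -natrM ler1n.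
exists e => //; exists m.+1 => n a mn ae a1.
have half j : (j < m.+1)%N -> 1 / 2 <= a ^+ (2 * j).
  move=> jm; rewrite exprM -(real_normK (num_real a)) -exprM.
  apply: (@le_trans _ _ ((1 - e) ^+ (2 * j))); last first.
    by rewrite lerXn2r ?nnegrE ?subr_ge0// ltW.
  apply: le_trans (bernoulli_le _ _); last by rewrite e1 ltW.
  have : (2 * j)%:R * e <= 1 / 2.
    rewrite /e ler_pdivrMr// natrM.
    have : j%:R <= m.+1%:R :> R by rewrite ler_nat ltnW.
    by lra.
  by lra.
rewrite /geomS -(subnKC mn) big_split_ord /= -[M]addr0 lerD//; last first.
  by apply: sumr_ge0 => j _; rewrite exprM exprn_ge0 ?sqr_ge0.
apply: (@le_trans _ _ (\sum_(j < m.+1) 1 / 2)); last first.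
  by apply: ler_sum => j _; apply: half; case: j.
by rewrite sumr_const card_ord -[leRHS]mulr_natl -(natr1 m); lra.
Qed.

Lemma slowly_half : slowly (fun _ a => 1 / 2 <= `|a|).
Proof. by exists (1 / 2) => //; exists 0%N => n a _ h _; lra. Qed.

(** By [disp_sqrB1], t^2 - 1 is of the order of 1 - a^2. The extra bound 1 / 2 on it keeps [t] away
    from 0, so that its sign is meaningful. *)
Lemma slowly_t eta : 0 < eta ->
  slowly (fun _ a => forall x t, disp x t a -> t != 0 /\ `|t - Num.sg t| <= eta).
Proof.
move=> eta0; pose e := Num.min eta (1 / 2) * (1 - kap) / 4.
have k1 : 0 < 1 - kap by rewrite subr_gt0.
have e0 : 0 < Num.min eta (1 / 2) by rewrite lt_min eta0; lra.
have : slowly (fun _ a => 1 - e < `|a| <= 1).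
  exists e; first by rewrite /e !mulr_gt0.
  by exists 0%N => n a _ -> ->.
move/(slowly_and slowly_half); apply: slowlyW => _ a [a2 /andP[ae a1]] x t D.
have h0 := disp_factor_gt0 kap_gt0 kap_lt1 a1.
have hk : 1 - kap <= 1 + kap * a.
  move: a1; rewrite ler_norml => /andP[a1 _].
  by have := ler_wpM2l (ltW kap_gt0) a1; lra.
have E := disp_sqrB1 D.
have a2n : 0 <= 1 - a ^+ 2 <= 2 * e.
  rewrite -(real_normK (num_real a)); apply/andP; split.
    by rewrite subr_ge0 expr_le1.
  rewrite (_ : 1 - _ = (1 - `|a|) * (1 + `|a|)); last by ring.
  have : (1 - `|a|) * (1 + `|a|) <= e * 2 by apply: ler_pM; lra.
  lra.
have T : `|t ^+ 2 - 1| <= Num.min eta (1 / 2).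
  have c0 : 0 < (1 - kap) / 2 by rewrite divr_gt0.
  rewrite -(ler_pM2r c0).
  apply: (@le_trans _ _ (`|t ^+ 2 - 1| * `|a * (1 + kap * a)|)).
    apply: ler_wpM2l => //; rewrite normrM (gtr0_norm h0).
    by have : 1 / 2 * (1 - kap) <= `|a| * (1 + kap * a); [apply: ler_pM; lra|lra].
  rewrite -normrM E ger0_norm; last by apply: mulr_ge0; [exact: ltW|case/andP: a2n].
  case/andP: a2n => a20 a2e.
  apply: le_trans (ler_wpM2r a20 (ltW kap_lt1)) _; rewrite /e in a2e; lra.
have tN : t != 0.
  apply/eqP => t0; move: T; rewrite t0 expr0n /= sub0r normrN normr1 le_min => /andP[_].
  lra.
split=> //.
apply: (@le_trans _ _ `|t ^+ 2 - 1|); last by rewrite (le_trans T)// ge_min lexx.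
have -> : t ^+ 2 - 1 = (t - Num.sg t) * (t + Num.sg t).
  by rewrite -subr_sqr sqr_sg tN.
rewrite normrM ler_peMr//.
have -> : t + Num.sg t = Num.sg t * (`|t| + 1) by rewrite mulrDr -numEsg mulr1.
by rewrite normrM normr_sg tN mul1r ger0_norm ?addr_ge0// lerDr.
Qed.

(** For a sign [s] the right side is the distance from [P] to [s]; the scaling by 1 + |P| admits
    unbounded stiffnesses. *)
Definition far d s P : Prop := d * (1 + `|P|) <= `|1 - s * P|.

Lemma far_t d s P t : far d s P -> `|t - s| <= d / 2 ->
  d / 2 * (1 + `|P|) <= `|1 - P * t|.
Proof.
rewrite /far => f ts.
have -> : 1 - P * t = (1 - s * P) - P * (t - s) by ring.
apply: le_trans (lerB_dist _ _); rewrite normrM.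
have : `|P| * `|t - s| <= `|P| * (d / 2) by rewrite ler_wpM2l.
have d0 : 0 <= d / 2 by exact: le_trans ts.
lra.
Qed.

(** Both terms of [quantized] are compared with (1 + |P|)(1 + |Q|): the one with the geometric sum
    is at least twice this product, the other at most once. *)
Lemma slowly_not_quantized d : 0 < d ->
  slowly (fun n a => forall x t P Q, disp x t a ->
    far d (Num.sg t) P -> far d (Num.sg t) Q -> ~ quantized n P Q t a).
Proof.
move=> d0; have k1 : 0 < 1 - kap by rewrite subr_gt0.
(* Lower bounds multiplied together: 1 / 2 for |a|, 1 - kap for 1 + kap a, and d / 2 for each
   boundary factor after scaling. *)
pose c := 1 / 2 * (1 - kap) * (d / 2) ^+ 2.
have d2 : 0 < d / 2 by rewrite divr_gt0.
have c0 : 0 < c by rewrite /c mulr_gt0 ?exprn_gt0// mulr_gt0//; lra.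
have S1 := slowly_geomS (2 / c).
have S2 := slowly_t d2.
have S3 : slowly (fun _ a => `|a| <= 1) by exists 1 => //; exists 0%N.
apply: slowlyW (slowly_and (slowly_and S1 S2) (slowly_and slowly_half S3)).
move=> n a [[Sn St] [a2 a1]] x t P Q D fP fQ.
have [_ ts] := St _ _ D.
have hk : 1 - kap <= 1 + kap * a.
  move: a1; rewrite ler_norml => /andP[a1 _].
  by have := ler_wpM2l (ltW kap_gt0) a1; lra.
have p := far_t fP ts; have q := far_t fQ ts.
have S0 : 0 < geomS n a by apply: lt_le_trans Sn; rewrite divr_gt0.
rewrite /quantized => /eqP; rewrite addr_eq0 => /eqP/(congr1 Num.norm).
rewrite normrN !normrM (gtr0_norm S0) (gtr0_norm kap_gt0).
rewrite (gtr0_norm (disp_factor_gt0 kap_gt0 kap_lt1 a1)) => E.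
have l : c * ((1 + `|P|) * (1 + `|Q|)) <=
   `|a| * (1 + kap * a) * (`|1 - P * t| * `|1 - Q * t|).
  rewrite (_ : c * _ = 1 / 2 * (1 - kap) * (d / 2 * (1 + `|P|) * (d / 2 * (1 + `|Q|)))).
    have p0 : 0 <= d / 2 * (1 + `|P|) by rewrite mulr_ge0 ?addr_ge0// ltW.
    have q0 : 0 <= d / 2 * (1 + `|Q|) by rewrite mulr_ge0 ?addr_ge0// ltW.
    apply: ler_pM; [lra|exact: mulr_ge0| |exact: ler_pM].
    by apply: ler_pM; lra.
  by rewrite /c; ring.
have r : kap * `|1 - P * Q| <= (1 + `|P|) * (1 + `|Q|).
  apply: (@le_trans _ _ (1 * `|1 - P * Q|)); first by rewrite ler_wpM2r// ltW.
  rewrite mul1r; apply: le_trans (ler_normB _ _) _; rewrite normr1 normrM.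
  have := normr_ge0 P; have := normr_ge0 Q; lra.
have PQ0 : 0 < (1 + `|P|) * (1 + `|Q|).
  by have := normr_ge0 P; have := normr_ge0 Q => ? ?; rewrite mulr_gt0//; lra.
have : 2 / c * (c * ((1 + `|P|) * (1 + `|Q|))) <= (1 + `|P|) * (1 + `|Q|).
  apply: le_trans r; rewrite -E; apply: ler_pM => //.
    by rewrite divr_ge0 ?ltW.
  by rewrite mulr_ge0 ?ltW.
rewrite mulrA divfK ?lt0r_neq0//; lra.
Qed.

End SlowStates.

(** * Sign rules for slow states *)

Section SlowCount.
Context {R : realType}.
Variable kap : R.
Hypotheses (kap_gt0 : 0 < kap) (kap_lt1 : kap < 1).
Implicit Types (P Q x a t s d eps eta nu : R) (n : nat).
Local Notation disp := (disp kap).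
Local Notation quantized := (quantized kap).

Lemma slowly_disp d : 0 < d -> slowly (fun n a => (0 < n)%N /\
  forall x t, disp x t a -> t != 0 /\ `|t - Num.sg t| <= d).
Proof.
(* A positive geometric sum excludes [n = 0]. *)
move=> d0; apply: (slowlyW (Pr := fun n a => 1 <= geomS n a /\
    forall x t, disp x t a -> t != 0 /\ `|t - Num.sg t| <= d)); last first.
  exact: (slowly_and (slowly_geomS 1) (slowly_t kap_gt0 kap_lt1 d0)).
move=> n a [S1 ts]; split=> //; case: n S1 => //.
by rewrite /geomS big_ord0 ler10.
Qed.

Lemma far_abs P d : 0 < d -> far d 1 P ->
  P < 1 /\ d * (1 + `|P|) <= 1 - P \/ 1 < P /\ d * (1 + `|P|) <= P - 1.
Proof.
rewrite /far mul1r => d0; have [p|p] := lerP 0 (1 - P); last first.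
  by rewrite (ltr0_norm p) => f; right; split; lra.
rewrite (ger0_norm p) => f; have [p1|p1] := ltP P 1; first by left; split.
by have := mulr_ge0 (ltW d0) (normr_ge0 P); lra.
Qed.

(* Dividing [quantized] by [1 - P * t] and [1 - P * Q], which have the same
   sign, leaves only the sign of [a * (1 - Q * t)]. *)
Lemma slowly_sign_pos d : 0 < d -> d <= 1 ->
  slowly (fun n a => forall x t P Q, disp x t a -> 0 < t ->
    far d 1 P -> `|1 - Q| <= d / 4 -> quantized n P Q t a ->
    (a < 0 -> Q < 1) /\ (0 < a -> 1 < Q)).
Proof.
move=> d0 d1; have d4 : 0 < d / 4 by rewrite divr_gt0.
have S1 : slowly (fun _ a => `|a| <= 1) by exists 1 => //; exists 0%N.
apply: slowlyW (slowly_and S1 (slowly_disp d4)) => n a [a1 [n0 St]] x t P Q D t0 fP nQ q.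
have [aN _ _ _] := D; have h0 := disp_factor_gt0 kap_gt0 kap_lt1 a1.
have [_] := St _ _ D; rewrite gtr0_sg// => ts.
have S0 : 0 < geomS n a by apply: lt_le_trans (geomS_ge1 a n0).
have A0 : 0 < a ^+ (2 * n) by rewrite exprM exprn_gt0// exprn_even_gt0//= aN.
have B := quantized_blaschke kap_gt0 kap_lt1 D q.
have Pn := normr_ge0 P.
(* [t] and [Q] are within d / 4 of 1, so 1 - P t, 1 - P Q and t - P are all positive for P < 1 and
   all negative for P > 1. *)
have [sgn1 sgn2] : 0 < (1 - P * t) * (1 - P * Q) /\ 0 < (t - P) * (1 - P * t).
  have e1 : `|P * (t - 1)| <= `|P| * (d / 4) by rewrite normrM ler_wpM2l.
  have e2 : `|P * (Q - 1)| <= `|P| * (d / 4) by rewrite normrM ler_wpM2l// distrC.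
  have dP : 0 <= d * `|P| by rewrite mulr_ge0// ltW.
  move: e1 e2 ts; rewrite !ler_norml => /andP[? ?] /andP[? ?] /andP[? ?].
  case: (far_abs d0 fP) => -[p1 p2].
    by split; apply: mulr_gt0; lra.
  by split; rewrite -mulrNN; apply: mulr_gt0; lra.
have aQ : a * (1 - Q * t) < 0.
  have : (1 - P * t) * (1 - P * Q) *
     (geomS n a * (1 + kap * a) * (a * (1 - Q * t)) * (1 - P * t) + kap * (1 - P * Q)) = 0.
    by rewrite -[X in _ * X]/(_ + _) -[RHS](mulr0 ((1 - P * t) * (1 - P * Q))) -q; congr (_ * (_ + _)); ring.
  move/eqP; rewrite mulf_eq0 gt_eqF//= addr_eq0 => /eqP E.
  have : geomS n a * (1 + kap * a) * (1 - P * t) ^+ 2 * (a * (1 - Q * t)) =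
     - (kap * ((1 - P * t) * (1 - P * Q))).
    transitivity (geomS n a * (1 + kap * a) * (a * (1 - Q * t)) * (1 - P * t) * (1 - P * t)); first by ring.
    by rewrite E; ring.
  move=> E'; have P1 : 1 - P * t != 0 by apply: contraTneq sgn1 => ->; rewrite mul0r ltxx.
  have c0 : 0 < geomS n a * (1 + kap * a) * (1 - P * t) ^+ 2.
    by apply: mulr_gt0; [exact: mulr_gt0|rewrite exprn_even_gt0].
  by rewrite -(pmulr_rlt0 _ c0) E' oppr_lt0 mulr_gt0.
have tQ : (t - Q) * ((t - P) * (1 - P * t)) = a ^+ (2 * n) * (1 - P * t) ^+ 2 * (1 - Q * t).
  transitivity ((t - P) * (t - Q) * (1 - P * t)); first by ring.
  by rewrite B; ring.
have P1 : 0 < (1 - P * t) ^+ 2.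
  by rewrite exprn_even_gt0//=; apply: contraTneq sgn1 => ->; rewrite mul0r ltxx.
have C0 : 0 < a ^+ (2 * n) * (1 - P * t) ^+ 2 by rewrite mulr_gt0.
(* A negative [a] yields Q < t <= 1, a positive one Q > t >= 1. *)
split=> aS.
  have qt : 0 < 1 - Q * t by rewrite -(nmulr_rlt0 _ aS).
  have := disp_le1 kap_gt0 kap_lt1 D aS; rewrite gtr0_norm// => t1.
  have : 0 < t - Q by rewrite -(pmulr_lgt0 _ sgn2) tQ mulr_gt0.
  lra.
have qt : 1 - Q * t < 0 by rewrite -(pmulr_rlt0 _ aS).
have := disp_ge1 kap_gt0 kap_lt1 D aS; rewrite gtr0_norm// => t1.
have : t - Q < 0 by rewrite -(pmulr_llt0 _ sgn2) tQ pmulr_rlt0.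
lra.
Qed.

Lemma sgrN (y : R) : Num.sg (- y) = - Num.sg y.
Proof. by rewrite -mulN1r sgrM sgrN1 mulN1r. Qed.

Lemma slowly_sign d : 0 < d -> d <= 1 ->
  slowly (fun n a => forall x t P Q s, disp x t a -> t != 0 -> Num.sg t = s ->
    far d s P -> `|1 - s * Q| <= d / 4 -> quantized n P Q t a ->
    (a < 0 -> s * Q < 1) /\ (0 < a -> 1 < s * Q)).
Proof.
move=> d0 d1; apply: slowlyW (slowly_sign_pos d0 d1) => n a H x t P Q s D tN ts fP nQ q.
have [t0|t0] := ltP 0 t.
  have s1 : s = 1 by rewrite -ts gtr0_sg.
  by move: fP nQ; rewrite s1 !mul1r => fP nQ; apply: (H x t P Q).
have t0' : t < 0 by rewrite lt_neqAle tN.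
have s1 : s = -1 by rewrite -ts ltr0_sg.
move: fP nQ; rewrite s1 !mulN1r => fP nQ.
apply: (H (- x) (- t) (- P) (- Q)); rewrite ?oppr_gt0//.
- exact: dispN.
- by move: fP; rewrite /far normrN mulN1r mul1r.
- exact: quantizedN.
Qed.

(** The two forms of the condition collide: as P Q < 1, the divided one makes (1 - P t)(1 - Q t)
    negative, while t >= 1 > P, Q in the other one makes it positive. *)
Lemma no_positive_mode n P Q x t a : (0 < n)%N -> disp x t a -> 0 < t ->
  0 < P < 1 -> 0 < Q < 1 -> 0 < a -> ~ quantized n P Q t a.
Proof.
move=> n0 D t0 /andP[P0 P1] /andP[Q0 Q1] a0 q.
have [aN a1 _ _] := D; have h0 := disp_factor_gt0 kap_gt0 kap_lt1 a1.
have S0 : 0 < geomS n a by apply: lt_le_trans (geomS_ge1 a n0).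
have A0 : 0 < a ^+ (2 * n) by rewrite exprn_gt0.
have := disp_ge1 kap_gt0 kap_lt1 D a0; rewrite gtr0_norm// => t1.
have B := quantized_blaschke kap_gt0 kap_lt1 D q.
have PQ : P * Q < 1 by rewrite mulr_ilt1// ltW.
have neg : (1 - P * t) * (1 - Q * t) < 0.
  rewrite ltNge; apply/negP => pos; move: q; rewrite /quantized => q.
  have : 0 <= geomS n a * (a * (1 + kap * a) * ((1 - P * t) * (1 - Q * t))).
    by apply: mulr_ge0; [exact: ltW|apply: mulr_ge0 => //; apply: ltW; exact: mulr_gt0].
  have : 0 < kap * (1 - P * Q) by rewrite mulr_gt0// subr_gt0.
  lra.
have : 0 < (t - P) * (t - Q) by rewrite mulr_gt0//; lra.
by rewrite B pmulr_rgt0// => /(lt_trans neg); rewrite ltxx.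
Qed.

(** The same collision with P Q > 1, a < 0 and t <= 1 < P, Q. *)
Lemma no_negative_mode n P Q x t a : (0 < n)%N -> disp x t a -> 0 < t ->
  1 < P -> 1 < Q -> a < 0 -> ~ quantized n P Q t a.
Proof.
move=> n0 D t0 P1 Q1 a0 q.
have [aN a1 _ _] := D; have h0 := disp_factor_gt0 kap_gt0 kap_lt1 a1.
have S0 : 0 < geomS n a by apply: lt_le_trans (geomS_ge1 a n0).
have A0 : 0 < a ^+ (2 * n) by rewrite exprM exprn_gt0// exprn_even_gt0//= aN.
have := disp_le1 kap_gt0 kap_lt1 D a0; rewrite gtr0_norm// => t1.
have B := quantized_blaschke kap_gt0 kap_lt1 D q.
have PQ : 1 < P * Q by apply: mulr_egt1.
have neg : (1 - P * t) * (1 - Q * t) < 0.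
  rewrite ltNge; apply/negP => pos; move: q; rewrite /quantized => q.
  have : geomS n a * (a * (1 + kap * a) * ((1 - P * t) * (1 - Q * t))) <= 0.
    by rewrite pmulr_rle0//; apply: mulr_le0_ge0 => //; apply: ltW; rewrite pmulr_llt0.
  have : kap * (1 - P * Q) < 0 by rewrite pmulr_rlt0// subr_lt0.
  lra.
have : 0 < (t - P) * (t - Q) by rewrite -mulrNN mulr_gt0//; lra.
by rewrite B pmulr_rgt0// => /(lt_trans neg); rewrite ltxx.
Qed.

(** States are sorted by the signs of [t] and [a] because each class occupies an interval of [x]
    ([disp_between]): a root found by interlacing stays in its class. *)
Definition slow_state eps n P Q s sig x : Prop := exists t a,
  [/\ disp x t a, 1 - eps < `|a|, quantized n P Q t a &
      [/\ Num.sg t = s, Num.sg a = sig, t != 0 & a != 0]].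

Lemma slow_stateC eps n P Q s sig x :
  slow_state eps n P Q s sig x -> slow_state eps n Q P s sig x.
Proof. by move=> [t [a [? ? q ?]]]; exists t, a; split=> //; exact: quantizedC. Qed.

Lemma slow_stateN eps n P Q s sig x : slow_state eps n P Q s sig x ->
  slow_state eps n (- P) (- Q) (- s) sig (- x).
Proof.
move=> [t [a [D ? q [ts ? ? ?]]]]; exists (- t), a.
by split; [exact: dispN|by []|exact: quantizedN|rewrite sgrN ts oppr_eq0].
Qed.

Lemma sg_eq_mulr_gt0 (y z : R) : y != 0 -> Num.sg y = Num.sg z -> 0 < y * z.
Proof. by move=> y0 e; rewrite -sgr_cp0 sgrM -e -expr2 sqr_sg y0. Qed.

Lemma mulr_gt0_sg_eq (y z : R) : 0 < y * z -> Num.sg y = Num.sg z.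
Proof.
rewrite -sgr_cp0 sgrM => /eqP e.
have z0 : Num.sg z ^+ 2 = 1.
  by rewrite sqr_sg; case: eqVneq e => // ->; rewrite sgr0 mulr0 => /eqP; rewrite eq_sym oner_eq0.
by rewrite -[LHS]mulr1 -z0 expr2 mulrA e mul1r.
Qed.

Lemma slow_state_interlacing eps n P Q Q' s sig x0 x1 :
  (0 < n)%N -> Q != Q' -> x0 < x1 ->
  slow_state eps n P Q s sig x0 -> slow_state eps n P Q s sig x1 ->
  exists2 x, x0 < x < x1 & slow_state eps n P Q' s sig x.
Proof.
move=> n0 QQ' x01 [t0 [a0 [D0 e0 q0 [ts0 as0 t0N a0N]]]] [t1 [a1 [D1 e1 q1 [ts1 as1 t1N a1N]]]].
have [x xI fx] := charf_interlacing kap_gt0 n0 QQ' x01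
  ((charf_quantized kap_gt0 n P Q D0).2 q0) ((charf_quantized kap_gt0 n P Q D1).2 q1).
exists x => //.
have a01 : 0 < a0 * a1 by apply: sg_eq_mulr_gt0; rewrite ?as0.
have t01 : 0 < t0 * t1 by apply: sg_eq_mulr_gt0; rewrite ?ts0.
have [t [a [D e aa0 tt0]]] := disp_between kap_gt0 kap_lt1 D0 D1 e0 e1 a01 t01 xI.
exists t, a; split=> //; first by apply/(charf_quantized kap_gt0 n P Q' D).
rewrite (mulr_gt0_sg_eq aa0) (mulr_gt0_sg_eq tt0); split=> //.
  by apply: contraTneq tt0 => ->; rewrite mul0r ltxx.
by apply: contraTneq aa0 => ->; rewrite mul0r ltxx.
Qed.

End SlowCount.

(** * Counting slow states with prescribed signs *)

Section SlowCount2.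
Context {R : realType}.
Variable kap : R.
Hypotheses (kap_gt0 : 0 < kap) (kap_lt1 : kap < 1).
Implicit Types (P Q x a t s d eps eta nu : R) (n : nat).
Local Notation disp := (disp kap).
Local Notation quantized := (quantized kap).
Local Notation slow_state := (slow_state kap).

Lemma slow_state_sig eps n P Q s sig x :
  slow_state eps n P Q s sig x -> is_sign s /\ is_sign sig.
Proof.
move=> [t [a [_ _ _ [<- <- tN aN]]]].
by split; rewrite /is_sign; [case: sgrP tN|case: sgrP aN]; rewrite ?eqxx//; [left|right|left|right].
Qed.

Lemma no_positive_state eps n P Q s x : (0 < n)%N ->
  0 < s * P < 1 -> 0 < s * Q < 1 -> ~ slow_state eps n P Q s 1 x.
Proof.
move=> n0 p q H; have [sS _] := slow_state_sig H.
wlog : P Q s x p q H sS / s = 1 => [hw|s1].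
  case: sS => s1; first by apply: (hw P Q s x) => //; left.
  apply: (hw (- P) (- Q) (- s) (- x)); rewrite ?mulrNN//.
  - exact: slow_stateN.
  - by left; rewrite s1 opprK.
  - by rewrite s1 opprK.
move: p q H; rewrite s1 !mul1r => p q [t [a [D _ Qt [ts as1 _ _]]]].
apply: (no_positive_mode kap_gt0 kap_lt1 n0 D _ p q _ Qt).
  by rewrite -sgr_cp0 ts.
by rewrite -sgr_cp0 as1.
Qed.

Lemma no_negative_state eps n P Q s x : (0 < n)%N ->
  1 < s * P -> 1 < s * Q -> ~ slow_state eps n P Q s (-1) x.
Proof.
move=> n0 p q H; have [sS _] := slow_state_sig H.
wlog : P Q s x p q H sS / s = 1 => [hw|s1].
  case: sS => s1; first by apply: (hw P Q s x) => //; left.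
  apply: (hw (- P) (- Q) (- s) (- x)); rewrite ?mulrNN//.
  - exact: slow_stateN.
  - by left; rewrite s1 opprK.
  - by rewrite s1 opprK.
move: p q H; rewrite s1 !mul1r => p q [t [a [D _ Qt [ts as1 _ _]]]].
apply: (no_negative_mode kap_gt0 kap_lt1 n0 D _ p q _ Qt).
  by rewrite -sgr_cp0 ts.
by rewrite -sgr_cp0 as1.
Qed.

Lemma far0 d s : d <= 1 -> far d s 0.
Proof. by move=> d1; rewrite /far mulr0 subr0 normr0 normr1 addr0 mulr1. Qed.

Lemma near_neq0 d s Q : d <= 1 -> `|1 - s * Q| <= d / 4 -> Q != 0.
Proof. by move=> d1 q; apply: contraTneq q => ->; rewrite mulr0 subr0 normr1; lra. Qed.

Lemma slow_state_rules d : 0 < d -> d <= 1 ->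
  exists2 eps, 0 < eps & exists N, forall n, (N <= n)%N -> (0 < n)%N /\
    forall P Q s sig x, far d s P -> slow_state eps n P Q s sig x ->
    ~ far d s Q /\ (`|1 - s * Q| <= d / 4 ->
       (sig = -1 -> s * Q < 1) /\ (sig = 1 -> 1 < s * Q)).
Proof.
move=> d0 d1.
have [e e0 [N H]] := slowly_and (slowly_sign kap_gt0 kap_lt1 d0 d1)
   (slowly_not_quantized kap_gt0 kap_lt1 d0).
exists e => //; exists (maxn N 1) => n; rewrite geq_max => /andP[nN n0].
split=> // P Q s sig x fP [t [a [D ea q [ts as1 tN aN]]]].
have [_ a1 _ _] := D; have [H1 H2] := H n a nN ea a1.
split=> [fQ|nQ]; first by apply: (H2 _ _ _ _ D _ _ q); rewrite ts.
have [h1 h2] := H1 _ _ _ _ _ D tN ts fP nQ q.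
split=> s1; [apply: h1|apply: h2]; first by rewrite -sgr_cp0 as1 s1.
by rewrite -sgr_cp0 as1 s1.
Qed.

(** The side of 1 on which s Q lies fixes the sign of [a]. Two states of the same class would
    enclose one for the ends [P] and 0, both far from [s]. *)
Lemma slow_unique d : 0 < d -> d <= 1 ->
  exists2 eps, 0 < eps & exists N, forall n, (N <= n)%N ->
    forall P Q s, far d s P -> `|1 - s * Q| <= d / 4 ->
    forall sig sig' x x', slow_state eps n P Q s sig x ->
      slow_state eps n P Q s sig' x' -> x = x'.
Proof.
move=> d0 d1; have [e e0 [N H]] := slow_state_rules d0 d1.
exists e => //; exists N => n /H[n0 {}H] P Q s fP nQ sig sig' x x' Sx Sx'.
have Q0 := near_neq0 d1 nQ.
have ss : sig = sig'.
  have [_ S1] := slow_state_sig Sx; have [_ S2] := slow_state_sig Sx'.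
  have [_ /(_ nQ)[h1 h2]] := H _ _ _ _ _ fP Sx.
  have [_ /(_ nQ)[h1' h2']] := H _ _ _ _ _ fP Sx'.
  case: S1 => s1; case: S2 => s2; rewrite s1 s2 //.
    by have := lt_trans (h1' s2) (h2 s1); rewrite ltxx.
  by have := lt_trans (h1 s1) (h2' s2); rewrite ltxx.
have no y y' : y < y' -> slow_state e n P Q s sig y -> slow_state e n P Q s sig y' -> False.
  move=> yy' Sy Sy'.
  have [z _ Sz] := slow_state_interlacing kap_gt0 kap_lt1 n0 Q0 yy' Sy Sy'.
  by have [] := H _ _ _ _ _ fP Sz; have := far0 s d1.
rewrite -ss in Sx'.
by case: (ltgtP x x') => // l; [case: (no _ _ l Sx Sx')|case: (no _ _ l Sx' Sx)].
Qed.

Lemma sorted3 (S : R -> Prop) x y z :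
  (forall u v w : R, u < v -> v < w -> S u -> S v -> S w -> False) ->
  S x -> S y -> S z -> x != y -> x != z -> y != z -> False.
Proof.
move=> H Sx Sy Sz; rewrite !neq_lt.
move=> /orP[] xy /orP[] xz /orP[] yz.
- exact: (H x y z).
- exact: (H x z y).
- by have := lt_trans (lt_trans xy yz) xz; rewrite ltxx.
- exact: (H z x y).
- exact: (H y x z).
- by have := lt_trans (lt_trans xy xz) yz; rewrite ltxx.
- exact: (H y z x).
- exact: (H z y x).
Qed.

(** Three states with the same sign of [a] enclose two states with [Q] replaced by 0, and these
    enclose one for the ends 0 and 0, which is excluded. If only two of the signs agree, that pair
    puts s P and s Q on the same side of 1, which excludes the opposite sign for the third state. *)
Lemma same_sign_at_most_two :
  exists2 eps, 0 < eps & exists N, forall n, (N <= n)%N ->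
    forall P Q s, `|1 - s * P| <= 1 / 4 -> `|1 - s * Q| <= 1 / 4 ->
    forall sig0 sig1 sig2 x0 x1 x2, slow_state eps n P Q s sig0 x0 ->
      slow_state eps n P Q s sig1 x1 -> slow_state eps n P Q s sig2 x2 ->
      x0 != x1 -> x0 != x2 -> x1 != x2 -> False.
Proof.
have [e e0 [N H]] := slow_state_rules ltr01 (lexx 1).
exists e => //; exists N => n /H[n0 {}H] P Q s nP nQ.
have P0 := near_neq0 (lexx 1) nP; have Q0 := near_neq0 (lexx 1) nQ.
have f0 : far 1 s 0 := far0 s (lexx 1).
have [pP pQ] : 0 < s * P /\ 0 < s * Q.
  by move: nP nQ; rewrite !ler_norml => /andP[? ?] /andP[? ?]; split; lra.
have lt2 sig y y' : y < y' -> slow_state e n P Q s sig y -> slow_state e n P Q s sig y' ->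
    (sig = -1 -> s * P < 1 /\ s * Q < 1) /\ (sig = 1 -> 1 < s * P /\ 1 < s * Q).
  move=> yy' Sy Sy'.
  have [z _ /slow_stateC Sz] := slow_state_interlacing kap_gt0 kap_lt1 n0 Q0 yy' Sy Sy'.
  have [w _ /slow_stateC Sw] := slow_state_interlacing kap_gt0 kap_lt1 n0 P0 yy'
     (slow_stateC Sy) (slow_stateC Sy').
  have [_ /(_ nP)[h1 h2]] := H _ _ _ _ _ f0 Sz.
  have [_ /(_ nQ)[h3 h4]] := H _ _ _ _ _ f0 Sw.
  by split=> s1; split; auto.
have neq2 sig y y' : y != y' -> slow_state e n P Q s sig y -> slow_state e n P Q s sig y' ->
    (sig = -1 -> s * P < 1 /\ s * Q < 1) /\ (sig = 1 -> 1 < s * P /\ 1 < s * Q).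
  by rewrite neq_lt => /orP[] l Sy Sy'; [exact: lt2 l Sy Sy'|exact: lt2 l Sy' Sy].
have lt3 sig u v w : u < v -> v < w -> slow_state e n P Q s sig u ->
    slow_state e n P Q s sig v -> slow_state e n P Q s sig w -> False.
  move=> uv vw Su Sv Sw.
  have [y /andP[_ yv] /slow_stateC Sy] := slow_state_interlacing kap_gt0 kap_lt1 n0 Q0 uv Su Sv.
  have [z /andP[vz _] /slow_stateC Sz] := slow_state_interlacing kap_gt0 kap_lt1 n0 Q0 vw Sv Sw.
  have [r _ Sr] := slow_state_interlacing kap_gt0 kap_lt1 n0 P0 (lt_trans yv vz) Sy Sz.
  by have [] := H _ _ _ _ _ f0 Sr.
have mixed sig y y' z : y != y' -> slow_state e n P Q s sig y -> slow_state e n P Q s sig y' ->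
    slow_state e n P Q s (- sig) z -> False.
  move=> yy' Sy Sy' Sz; have [h1 h2] := neq2 _ _ _ yy' Sy Sy'.
  have [_ [s1|s1]] := slow_state_sig Sy; rewrite s1 ?opprK in Sz.
    have [? ?] := h2 s1; exact: (no_negative_state n0 _ _ Sz).
  have [? ?] := h1 s1; by apply: (no_positive_state n0 _ _ Sz); apply/andP.
move=> sig0 sig1 sig2 x0 x1 x2 S0 S1 S2 x01 x02 x12.
have [_ g0] := slow_state_sig S0; have [_ g1] := slow_state_sig S1.
have [_ g2] := slow_state_sig S2.
have dich (u v : R) : is_sign u -> is_sign v -> u = v \/ u = - v.
  by move=> [->|->] [->|->]; rewrite ?opprK; auto.
have [e1|e1] := dich _ _ g1 g0; have [e2|e2] := dich _ _ g2 g0; subst sig1 sig2.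
- exact: (sorted3 (lt3 sig0) S0 S1 S2).
- exact: (mixed _ _ _ _ x01 S0 S1 S2).
- exact: (mixed _ _ _ _ x02 S0 S2 S1).
- by apply: (mixed _ _ _ x0 x12 S1 S2); rewrite opprK.
Qed.

Definition slow eps n P Q x : Prop := exists t a,
  [/\ disp x t a, 1 - eps < `|a| & quantized n P Q t a].


End SlowCount2.

(** * Counting slow states of all signs *)

Section SlowFinal.
Context {R : realType}.
Variable kap : R.
Hypotheses (kap_gt0 : 0 < kap) (kap_lt1 : kap < 1).
Implicit Types (P Q x a t s d eps eta nu : R) (n : nat).
Local Notation disp := (disp kap).
Local Notation quantized := (quantized kap).
Local Notation slow_state := (slow_state kap).
Local Notation slow := (slow kap).

Lemma slow_state_le eps eps' n P Q s sig x : eps <= eps' ->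
  slow_state eps n P Q s sig x -> slow_state eps' n P Q s sig x.
Proof.
move=> ee [t [a [D e q H]]]; exists t, a; split=> //.
by apply: le_lt_trans e; rewrite lerB.
Qed.

Lemma slow_to_state eps : 0 < eps ->
  exists2 eps', 0 < eps' & exists N, forall n P Q x, (N <= n)%N ->
    slow eps' n P Q x -> exists s sig, slow_state eps n P Q s sig x.
Proof.
move=> e0; have [e' e'0 [N H]] := slowly_disp kap_gt0 kap_lt1 ltr01.
exists (Num.min eps e'); first by rewrite lt_min e0.
exists N => n P Q x nN [t [a [D e q]]].
have [_ a1 _ _] := D; have [aN _ _ _] := D.
have [_ Ht] : (0 < n)%N /\ forall x t, disp x t a -> t != 0 /\ `|t - Num.sg t| <= 1.
  by apply: H => //; apply: le_lt_trans e; rewrite lerB// ge_min lexx orbT.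
have [tN _] := Ht _ _ D.
exists (Num.sg t), (Num.sg a), t, a; split=> //.
by apply: le_lt_trans e; rewrite lerB// ge_min lexx.
Qed.

(** If s Q is negative, 1 - s Q equals 1 + |Q|, which is [far] for every d <= 1. *)
Lemma near_or_far d s Q : d <= 1 -> is_sign s -> `| `|Q| - 1| <= d / 4 ->
  `|1 - s * Q| <= d / 4 \/ far d s Q.
Proof.
move=> d1 sS nQ; have s1 : `|s| = 1 by case: sS => ->; rewrite ?normrN normr1.
rewrite /far; have [h|h] := lerP 0 (s * Q).
  by left; rewrite distrC -(ger0_norm h) normrM s1 mul1r.
right; have -> : s * Q = - `|Q|.
  by apply: oppr_inj; rewrite opprK -(ltr0_norm h) normrM s1 mul1r.
have Q0 := normr_ge0 Q; rewrite opprK (ger0_norm (addr_ge0 ler01 Q0)).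
have := ler_wpM2r (addr_ge0 ler01 Q0) d1; lra.
Qed.

Lemma near_sign_unique s s' Q : is_sign s -> is_sign s' ->
  `|1 - s * Q| <= 1 / 4 -> `|1 - s' * Q| <= 1 / 4 -> s = s'.
Proof.
move=> [->|->] [->|->]//; rewrite !ler_norml => /andP[? ?] /andP[? ?]; exfalso; lra.
Qed.

Lemma near_sign Q : `| `|Q| - 1| <= 1 / 4 -> exists2 s, is_sign s & `|1 - s * Q| <= 1 / 4.
Proof.
move=> nQ; have [Q0|Q0] := lerP 0 Q.
  by exists 1; [left|rewrite mul1r distrC -{1}(ger0_norm Q0)].
by exists (-1); [right|rewrite mulN1r distrC -(ltr0_norm Q0)].
Qed.

Lemma no_slow d : 0 < d -> d <= 1 ->
  exists2 eps, 0 < eps & exists N, forall n P Q x, (N <= n)%N ->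
    (forall s, is_sign s -> far d s P) -> (forall s, is_sign s -> far d s Q) ->
    ~ slow eps n P Q x.
Proof.
move=> d0 d1; have [e e0 [N H]] := slow_state_rules kap_gt0 kap_lt1 d0 d1.
have [e' e'0 [N' H']] := slow_to_state e0.
exists e' => //; exists (maxn N N') => n P Q x; rewrite geq_max => /andP[nN nN'] fP fQ.
move=> /(H' _ _ _ _ nN')[s [sig S]]; have [sS _] := slow_state_sig S.
have [_ /(_ _ Q _ _ _ (fP _ sS) S)[+ _]] := H n nN.
by apply; exact: fQ.
Qed.

(** [Q] must be near the sign of [t], since otherwise both ends are far from it; this fixes the
    sign, and [slow_unique] applies. *)
Lemma slow_at_most_one d : 0 < d -> d <= 1 ->
  exists2 eps, 0 < eps & exists N, forall n P Q, (N <= n)%N ->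
    (forall s, is_sign s -> far d s P) -> `| `|Q| - 1| <= d / 4 ->
    forall x x', slow eps n P Q x -> slow eps n P Q x' -> x = x'.
Proof.
move=> d0 d1; have [e1 e10 [N1 H1]] := slow_state_rules kap_gt0 kap_lt1 d0 d1.
have [e2 e20 [N2 H2]] := slow_unique kap_gt0 kap_lt1 d0 d1.
have e0 : 0 < Num.min e1 e2 by rewrite lt_min e10.
have [e e'0 [N H]] := slow_to_state e0.
exists e => //; exists (maxn N (maxn N1 N2)) => n P Q.
rewrite !geq_max => /and3P[nN nN1 nN2] fP nQ x x' Sx Sx'.
have st y : slow e n P Q y -> exists s sig, [/\ is_sign s,
    slow_state e2 n P Q s sig y & `|1 - s * Q| <= d / 4].
  move=> /(H _ _ _ _ nN)[s [sig S]]; exists s, sig.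
  have [sS _] := slow_state_sig S.
  have S2 : slow_state e2 n P Q s sig y.
    by apply: slow_state_le S; rewrite ge_min lexx orbT.
  split=> //; have [//|fQ] := near_or_far d1 sS nQ.
  have S1 : slow_state e1 n P Q s sig y by apply: slow_state_le S; rewrite ge_min lexx.
  by have [_ /(_ _ Q _ _ _ (fP _ sS) S1)[+ _]] := H1 n nN1 => /(_ fQ).
have [s [sig [sS S n1]]] := st _ Sx; have [s' [sig' [sS' S' n1']]] := st _ Sx'.
have d4 : d / 4 <= 1 / 4 by lra.
have ss := near_sign_unique sS sS' (le_trans n1 d4) (le_trans n1' d4).
rewrite -ss in S'.
exact: (H2 n nN2 P Q s (fP _ sS) n1 _ _ _ _ S S').
Qed.

(** The sign of [t] is that of [P] or that of [Q]. If the two agree, [same_sign_at_most_two]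
    applies; if not, each sign carries at most one state, because the other end is far from it. *)
Lemma slow_at_most_two :
  exists2 eps, 0 < eps & exists N, forall n P Q, (N <= n)%N ->
    `| `|P| - 1| <= 1 / 4 -> `| `|Q| - 1| <= 1 / 4 ->
    forall x0 x1 x2, slow eps n P Q x0 -> slow eps n P Q x1 -> slow eps n P Q x2 ->
    x0 != x1 -> x0 != x2 -> x1 != x2 -> False.
Proof.
have [e1 e10 [N1 H1]] := slow_state_rules kap_gt0 kap_lt1 ltr01 (lexx 1).
have [e2 e20 [N2 H2]] := slow_unique kap_gt0 kap_lt1 ltr01 (lexx 1).
have [e3 e30 [N3 H3]] := same_sign_at_most_two kap_gt0 kap_lt1.
pose m := Num.min e1 (Num.min e2 e3).
have e0 : 0 < m by rewrite !lt_min e10 e20.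
have [m1 m2 m3] : [/\ m <= e1, m <= e2 & m <= e3].
  by rewrite /m !ge_min !lexx !orbT.
have [e e'0 [N H]] := slow_to_state e0.
exists e => //; exists (maxn N (maxn N1 (maxn N2 N3))) => n P Q.
rewrite !geq_max => /and4P[nN nN1 nN2 nN3] nP nQ.
have [p pS np] := near_sign nP; have [q qS nq] := near_sign nQ.
have st y : slow e n P Q y -> exists s sig, (s = p \/ s = q) /\ slow_state m n P Q s sig y.
  move=> /(H _ _ _ _ nN)[s [sig S]]; exists s, sig; split=> //.
  have [sS _] := slow_state_sig S.
  have [n1|fP] := near_or_far (lexx 1) sS nP; first by left; exact: near_sign_unique np.
  have [n1|fQ] := near_or_far (lexx 1) sS nQ; first by right; exact: near_sign_unique nq.
  by have [_ /(_ _ Q _ _ _ fP (slow_state_le m1 S))[+ _]] := H1 n nN1 => /(_ fQ).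
move=> x0 x1 x2 /st[s0 [g0 [h0 S0]]] /st[s1 [g1 [h1 S1]]] /st[s2 [g2 [h2 S2]]] x01 x02 x12.
have [pq|pq] := eqVneq p q.
  have [e00 e11 e22] : [/\ s0 = p, s1 = p & s2 = p] by rewrite -pq in h0 h1 h2; case: h0; case: h1; case: h2.
  subst s0 s1 s2; rewrite -pq in nq.
  by apply: (H3 n nN3 P Q p np nq _ _ _ _ _ _ (slow_state_le m3 S0) (slow_state_le m3 S1) (slow_state_le m3 S2)).
have fP : far 1 q P.
  have [n1|//] := near_or_far (lexx 1) qS nP.
  by move: pq; rewrite (near_sign_unique pS qS np n1) eqxx.
have fQ : far 1 p Q.
  have [n1|//] := near_or_far (lexx 1) pS nQ.
  by move: pq; rewrite (near_sign_unique pS qS n1 nq) eqxx.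
have uq g g' y y' : slow_state m n P Q q g y -> slow_state m n P Q q g' y' -> y != y' -> False.
  move=> Sy Sy'; rewrite (H2 n nN2 P Q q fP nq _ _ _ _ (slow_state_le m2 Sy) (slow_state_le m2 Sy')).
  by rewrite eqxx.
have up g g' y y' : slow_state m n P Q p g y -> slow_state m n P Q p g' y' -> y != y' -> False.
  move=> /slow_stateC Sy /slow_stateC Sy'.
  rewrite (H2 n nN2 Q P p fQ np _ _ _ _ (slow_state_le m2 Sy) (slow_state_le m2 Sy')).
  by rewrite eqxx.
by case: h0 => ?; case: h1 => ?; case: h2 => ?; subst s0 s1 s2;
  solve [exact: (uq _ _ _ _ S0 S1)|exact: (uq _ _ _ _ S0 S2)|exact: (uq _ _ _ _ S1 S2)
        |exact: (up _ _ _ _ S0 S1)|exact: (up _ _ _ _ S0 S2)|exact: (up _ _ _ _ S1 S2)].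
Qed.

(** [t] is near one of the two signs, and -s is ruled out because both ends are far from it; this
    selects the limiting frequency. *)
Lemma slowly_t_sign d eta : 0 < d -> 0 < eta ->
  slowly (fun n a => forall x t P Q s, is_sign s -> disp x t a ->
    far d (- s) P -> far d (- s) Q -> quantized n P Q t a -> `|t - s| <= eta).
Proof.
move=> d0 eta0.
apply: slowlyW (slowly_and (slowly_not_quantized kap_gt0 kap_lt1 d0) (slowly_t kap_gt0 kap_lt1 eta0)).
move=> n a [H1 H2] x t P Q s sS D fP fQ q.
have [tN ts] := H2 _ _ D.
have [e|e] : Num.sg t = s \/ Num.sg t = - s.
  by case: sS => ->; case: sgrP tN; rewrite ?opprK; auto.
  by rewrite -e.
by case: (H1 _ _ _ _ D _ _ q); rewrite e.
Qed.

End SlowFinal.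

(** * Existence of edge modes *)

Section Existence.
Context {R : realType}.
Variable kap : R.
Hypotheses (kap_gt0 : 0 < kap) (kap_lt1 : kap < 1).
Implicit Types (P Q x a t s d eps eta g : R) (n : nat).
Local Notation disp := (disp kap).
Local Notation quantized := (quantized kap).

(* The root [a] of [kap t^2 a^2 + (t^2 - 1) a - kap] in the open unit disk,
   for [g] the sign of [t^2 - 1]; rationalised so that it makes sense at [t = 0]. *)
Definition mode g t : R := 2 * kap * g /
  (g * (t ^+ 2 - 1) + Num.sqrt ((t ^+ 2 - 1) ^+ 2 + 4 * kap ^+ 2 * t ^+ 2)).

Lemma is_sign_sqr g : is_sign g -> g * g = 1.
Proof. by case=> ->; rewrite ?mulrNN mulr1. Qed.

(** This amounts to |mode| < 1. With d = g (t^2 - 1), the squares to be compared differ by 4 kap d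
    (1 + kap g), which is positive because kap < 1. *)
Lemma mode_den g t : is_sign g -> 0 < g * (t ^+ 2 - 1) ->
  2 * kap < g * (t ^+ 2 - 1) + Num.sqrt ((t ^+ 2 - 1) ^+ 2 + 4 * kap ^+ 2 * t ^+ 2).
Proof.
move=> gS d0; set d := g * _ in d0 *; set D := Num.sqrt _.
have g2 := is_sign_sqr gS.
have D2 : D ^+ 2 = d ^+ 2 + 4 * kap ^+ 2 * t ^+ 2.
  rewrite sqr_sqrtr; last by rewrite addr_ge0 ?sqr_ge0// mulr_ge0 ?sqr_ge0// mulr_ge0 ?sqr_ge0.
  by rewrite /d exprMn [g ^+ 2]g2 mul1r.
have D0 : 0 <= D by exact: sqrtr_ge0.
have tE : t ^+ 2 = 1 + g * d by rewrite /d mulrA g2; ring.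
have E : D ^+ 2 - (2 * kap - d) ^+ 2 = 4 * kap * d * (1 + kap * g).
  by rewrite D2 tE; ring.
have kg : 0 < 1 + kap * g by move: kap_gt0 kap_lt1; case: gS => ->; lra.
have : 0 < D ^+ 2 - (2 * kap - d) ^+ 2 by rewrite E mulr_gt0// mulr_gt0// mulr_gt0.
rewrite subr_gt0 ltNge => /negP H; rewrite ltNge; apply/negP => le; apply: H.
have le' : D <= 2 * kap - d by lra.
by rewrite lerXn2r ?nnegrE// (le_trans D0).
Qed.

Lemma mode_disp g t : is_sign g -> 0 < g * (t ^+ 2 - 1) ->
  [/\ disp (- (t * (1 + kap * mode g t))) t (mode g t), `|mode g t| < 1 &
      0 < g * mode g t].
Proof.
move=> gS d0; have w := mode_den gS d0; rewrite /mode.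
set W := (X in _ < X) in w; rewrite -/W.
have g2 := is_sign_sqr gS.
have k2 : 0 < 2 * kap by rewrite mulr_gt0.
have W0 : 0 < W by exact: lt_trans w.
have g1 : `|g| = 1 by case: gS => ->; rewrite ?normrN normr1.
have gN : g != 0 by rewrite -normr_gt0 g1.
have a1 : `|2 * kap * g / W| < 1.
  by rewrite !normrM g1 mulr1 normfV (gtr0_norm W0) -normrM (gtr0_norm k2) ltr_pdivrMr// mul1r.
split=> //; last first.
  have -> : g * (2 * kap * g / W) = g * g * (2 * kap / W) by ring.
  by rewrite g2 mul1r divr_gt0.
split=> //; first by rewrite !mulf_neq0// ?invr_neq0// lt0r_neq0.
  exact: ltW.
have WE : W ^+ 2 = 2 * g * (t ^+ 2 - 1) * W + 4 * kap ^+ 2 * t ^+ 2.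
  rewrite /W; set D := Num.sqrt _.
  have D2 : D ^+ 2 = (t ^+ 2 - 1) ^+ 2 + 4 * kap ^+ 2 * t ^+ 2.
    by rewrite sqr_sqrtr// addr_ge0 ?sqr_ge0// mulr_ge0 ?sqr_ge0// mulr_ge0 ?sqr_ge0.
  transitivity (g * g * (t ^+ 2 - 1) ^+ 2 + 2 * g * (t ^+ 2 - 1) * D + D ^+ 2); first by ring.
  rewrite D2; transitivity (g * g * (t ^+ 2 - 1) ^+ 2 + 2 * g * (t ^+ 2 - 1) * D + (g * g * (t ^+ 2 - 1) ^+ 2 + 4 * kap ^+ 2 * t ^+ 2)).
    by rewrite g2; ring.
  by ring.
apply/eqP; rewrite -subr_eq0; apply/eqP.
transitivity (kap / W ^+ 2 * (2 * g * (t ^+ 2 - 1) * W + 4 * kap ^+ 2 * t ^+ 2 * (g * g) - W ^+ 2)).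
  by field; exact: lt0r_neq0.
by rewrite g2 WE; ring.
Qed.

(** Distinct roots [a], [b] of the quadratic satisfy t^2 a b = -1 and so have opposite signs,
    whereas [g] prescribes the sign. *)
Lemma mode_unique g t x a : is_sign g -> 0 < g * (t ^+ 2 - 1) ->
  disp x t a -> a = mode g t.
Proof.
move=> gS d0 D; have [D' m1 m0] := mode_disp gS d0.
have [aN a1 tE xE] := D; have [mN _ tE' _] := D'.
set b := mode g t in D' m1 m0 mN tE' *.
have h0 := disp_factor_gt0 kap_gt0 kap_lt1 a1.
have hb := disp_factor_gt0 kap_gt0 kap_lt1 (ltW m1).
have E := disp_sqrB1 D; have Eb := disp_sqrB1 D'.
have e : (a - b) * (kap * t ^+ 2 * (a * b) + kap) = 0.
  transitivity (b * (t ^+ 2 * a * (1 + kap * a) - (kap + a)) - a * (t ^+ 2 * b * (1 + kap * b) - (kap + b))); first by ring.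
  by rewrite tE tE'; ring.
have ab : 0 < a * b.
  have ga : 0 < g * a.
    have : 0 <= (g * (t ^+ 2 - 1)) * ((g * a) * (1 + kap * a)).
      rewrite (_ : _ * _ = g * g * ((t ^+ 2 - 1) * (a * (1 + kap * a)))); last by ring.
      rewrite (is_sign_sqr gS) mul1r E mulr_ge0 ?(ltW kap_gt0)// subr_ge0.
      by rewrite -(real_normK (num_real a)) expr_le1.
    rewrite pmulr_rge0// pmulr_lge0// le_eqVlt => /predU1P[/esym/eqP|//].
    by rewrite mulf_eq0 (negbTE aN) orbF => /eqP g0; move: (is_sign_sqr gS); rewrite g0 mul0r => /eqP; rewrite eq_sym oner_eq0.
  have := mulr_gt0 ga m0; rewrite mulrACA (is_sign_sqr gS) mul1r; exact.
move/eqP: e; rewrite mulf_eq0 => /orP[/eqP/subr0_eq//|].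
rewrite gt_eqF// ltr_wpDl//; apply: mulr_ge0; last exact: ltW.
by apply: mulr_ge0; [exact: ltW|exact: sqr_ge0].
Qed.

Lemma cvg_exprn (f : R -> R) (t l : R) n :
  f u @[u --> t] --> l -> f u ^+ n @[u --> t] --> l ^+ n.
Proof.
by move=> fl; apply: (@continuous_cvg _ _ _ _ _ f (fun u => u ^+ n) l) => //; exact: exprn_continuous.
Qed.

Lemma mode_continuous g t : is_sign g -> 0 < g * (t ^+ 2 - 1) ->
  {for t, continuous (mode g)}.
Proof.
move=> gS d0; have w := mode_den gS d0.
have k2 : 0 < 2 * kap by rewrite mulr_gt0.
have c2 : (fun u : R => u ^+ 2 - 1) u @[u --> t] --> t ^+ 2 - 1.
  by apply: cvgB; [apply: cvg_exprn; exact: cvg_id|exact: cvg_cst].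
apply: cvgM; first exact: cvg_cst.
apply: cvgV; first by rewrite gt_eqF// (lt_trans k2).
apply: cvgD; first by apply: cvgM; [exact: cvg_cst|exact: c2].
apply: (@continuous_cvg _ _ _ _ _ _ Num.sqrt); first exact: sqrt_continuous.
apply: cvgD; first exact: (cvg_exprn (f := fun u => u ^+ 2 - 1)).
by apply: cvgM; [exact: cvg_cst|apply: cvg_exprn; exact: cvg_id].
Qed.

Definition defect g n P Q t : R :=
  (t - P) * (t - Q) - mode g t ^+ (2 * n) * ((1 - P * t) * (1 - Q * t)).

Lemma defect_quantized g n P Q t : is_sign g -> 0 < g * (t ^+ 2 - 1) ->
  defect g n P Q t = 0 -> quantized n P Q t (mode g t).
Proof.
move=> gS d0 /eqP; rewrite subr_eq0 => /eqP e.
have [D a1 _] := mode_disp gS d0.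
apply: (blaschke_quantized D) => //.
by rewrite -(real_normK (num_real (mode g t))) lt_eqF// expr_lt1.
Qed.

Lemma defect_root g n P Q l r : is_sign g -> l <= r ->
  (forall t, l <= t <= r -> 0 < g * (t ^+ 2 - 1)) ->
  defect g n P Q l * defect g n P Q r < 0 ->
  exists2 t, l <= t <= r & defect g n P Q t = 0.
Proof.
move=> gS lr H neg.
have [||t] := @IVT R (defect g n P Q) l r 0 lr.
- apply: continuous_in_subspaceT => t; rewrite inE/= in_itv/= => /H d0.
  apply: cvgB.
    by apply: cvgM; apply: cvgB; try exact: cvg_cst; exact: cvg_id.
  apply: cvgM.
    by apply: cvg_exprn; exact: mode_continuous.
  by apply: cvgM; apply: cvgB; try exact: cvg_cst; apply: cvgM; try exact: cvg_cst; exact: cvg_id.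
- rewrite ge_min le_max.
  have [h|h] := lerP 0 (defect g n P Q l).
    have h' : defect g n P Q r <= 0.
      by rewrite leNgt; apply/negP => h'; move: neg; rewrite ltNge mulr_ge0// ltW.
    by rewrite h' orbT.
  have h' : 0 <= defect g n P Q r.
    by rewrite leNgt; apply/negP => h'; move: neg; rewrite ltNge -mulrNN mulr_ge0// oppr_ge0 ltW.
  by rewrite (ltW h) h' orbT.
by rewrite in_itv/= => tI t0; exists t.
Qed.

End Existence.

(** * Estimates uniform in the end stiffnesses *)

Section Estimates.
Context {R : realType}.
Variable kap : R.
Hypotheses (kap_gt0 : 0 < kap) (kap_lt1 : kap < 1).
Implicit Types (P Q x a t s d eps eta g : R) (n : nat).
Local Notation disp := (disp kap).

(** The left side is the modulus of the Moebius factor (kap + a) / (1 + kap a) of the unit disk. *)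
Lemma disp_at2 x t a : disp x t a -> `|a| * t ^+ 2 <= 1.
Proof.
move=> [_ a1 tE _]; have h0 := disp_factor_gt0 kap_gt0 kap_lt1 a1.
rewrite -(ler_pM2r h0) mul1r -{1}(gtr0_norm h0) -[t ^+ 2]ger0_norm ?sqr_ge0//.
rewrite -!normrM [a * _]mulrC tE ler_norml.
move: a1; rewrite ler_norml => /andP[? ?].
have u0 : 0 <= (1 + kap) * (1 + a) by apply: mulr_ge0; [apply: addr_ge0 => //; exact: ltW|lra].
have u1 : 0 <= (1 - kap) * (1 - a) by rewrite mulr_ge0 ?subr_ge0// ltW.
by apply/andP; split; lra.
Qed.

(** If |a| > 1 / 2, [disp_sqrB1] bounds 1 - |a|^2 from below by eta (1 - kap) / 2. *)
Lemma disp_le_rho eta : 0 < eta -> exists2 rho, 0 < rho < 1 &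
  forall x t a, disp x t a -> eta <= `|t ^+ 2 - 1| -> `|a| <= rho.
Proof.
move=> eta0; have k1 : 0 < 1 - kap by rewrite subr_gt0.
pose c := Num.min 1 (eta * (1 - kap) / 2).
have c0 : 0 < c by rewrite lt_min ltr01 divr_gt0// mulr_gt0.
have c1 : c <= 1 by rewrite ge_min lexx.
exists (Num.max (1 / 2) (1 - c / 2)); first by rewrite lt_max gt_max; lra.
move=> x t a D te; have [_ a1 _ _] := D.
rewrite le_max; have [//|a2] := lerP `|a| (1 / 2); rewrite /=.
have h0 := disp_factor_gt0 kap_gt0 kap_lt1 a1.
have hk : 1 - kap <= 1 + kap * a.
  move: a1; rewrite ler_norml => /andP[a1 _].
  by have := ler_wpM2l (ltW kap_gt0) a1; lra.
have a0 := normr_ge0 a.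
have E : `|t ^+ 2 - 1| * (`|a| * (1 + kap * a)) = kap * (1 - `|a| ^+ 2).
  rewrite -(gtr0_norm h0) -!normrM (disp_sqrB1 D) real_normK ?num_real// ger0_norm//.
  by rewrite mulr_ge0 ?(ltW kap_gt0)// subr_ge0 -(real_normK (num_real a)) expr_le1.
have l : eta * (1 / 2 * (1 - kap)) <= 1 - `|a| ^+ 2.
  apply: (@le_trans _ _ (kap * (1 - `|a| ^+ 2))).
    rewrite -E; apply: ler_pM => //; [exact: ltW|lra|].
    by apply: ler_pM => //; lra.
  by rewrite -[leRHS]mul1r ler_wpM2r ?(ltW kap_lt1)// subr_ge0 expr_le1.
have : c <= eta * (1 - kap) / 2 by rewrite ge_min lexx orbT.
move=> cl; rewrite leNgt; apply/negP => h; nra.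
Qed.

(** 4 |a| (1 + |t|)^2 <= 8 (|a| + |a| t^2), and both summands are at most 1. *)
Lemma disp_scale x t a P : disp x t a -> 1 + `|P| <= 2 * (1 + `|t|) ->
  `|a| * (1 + `|P|) ^+ 2 <= 16.
Proof.
move=> D le; have [_ a1 _ _] := D; have at2 := disp_at2 D.
have a0 := normr_ge0 a; have P0 := normr_ge0 P; have t0 := normr_ge0 t.
have : (1 + `|P|) ^+ 2 <= (2 * (1 + `|t|)) ^+ 2 by rewrite lerXn2r ?nnegrE//; lra.
move=> /(ler_wpM2l a0) h; apply: le_trans h _.
rewrite -(real_normK (num_real t)) in at2.
have : 0 <= `|a| * (`|t| - 1) ^+ 2 by rewrite mulr_ge0 ?sqr_ge0.
nra.
Qed.

(** A difference quotient of t^2 = (kap + a) / (a (1 + kap a)), bounded from below for multipliers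
    of equal sign. The factor |a| |a'| is kept to compensate large [t]. *)
Lemma disp_dist x t a x' t' a' : disp x t a -> disp x' t' a' -> 0 < a * a' ->
  `|a - a'| <= 4 / (kap * (1 - kap) ^+ 2) *
     (`|t ^+ 2 - t' ^+ 2| * (`|a| * `|a'|)).
Proof.
move=> [_ a1 tE _] [_ a1' tE' _] aa.
have k1 : 0 < 1 - kap by rewrite subr_gt0.
have h0 := disp_factor_gt0 kap_gt0 kap_lt1 a1.
have h0' := disp_factor_gt0 kap_gt0 kap_lt1 a1'.
have E : (t ^+ 2 - t' ^+ 2) * (a * a') * ((1 + kap * a) * (1 + kap * a')) =
   (a' - a) * (kap * (1 + kap * (a + a') + a * a')).
  transitivity ((t ^+ 2 * a * (1 + kap * a)) * (a' * (1 + kap * a')) -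
     (t' ^+ 2 * a' * (1 + kap * a')) * (a * (1 + kap * a))); first by ring.
  by rewrite tE tE'; ring.
have low : (1 - kap) ^+ 2 <= 1 + kap * (a + a') + a * a'.
  move: a1 a1'; rewrite !ler_norml => /andP[? ?] /andP[? ?].
  have : 0 <= kap * (1 + a) by rewrite mulr_ge0 ?(ltW kap_gt0)//; lra.
  have : 0 <= kap * (1 + a') by rewrite mulr_ge0 ?(ltW kap_gt0)//; lra.
  move=> u v; have : 0 <= (kap * (1 + a)) * (1 - kap) by rewrite mulr_ge0// ltW.
  have : 0 <= (kap * (1 + a')) * (1 - kap) by rewrite mulr_ge0// ltW.
  have : 0 <= (kap * (1 + a')) * (kap * (1 + a)) by rewrite mulr_ge0.
  have : 0 <= (1 - kap) * (1 + kap) * (a * a').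
    by rewrite mulr_ge0// ?(ltW aa)// mulr_ge0 ?(ltW k1)// addr_ge0// ltW.
  nra.
have up b : `|b| <= 1 -> 1 + kap * b <= 2.
  rewrite ler_norml => /andP[_ b1].
  by have := ler_wpM2l (ltW kap_gt0) b1; move: kap_lt1; lra.
have c0 : 0 < kap * (1 - kap) ^+ 2 by rewrite mulr_gt0// exprn_gt0.
set c := kap * _ in c0 *; rewrite -(ler_pM2l c0).
rewrite (mulrA c) (mulrC 4) (mulrA c) divff ?lt0r_neq0// mul1r /c.
have hh : (1 + kap * a) * (1 + kap * a') <= 4.
  by have := ler_pM (ltW h0) (ltW h0') (up _ a1) (up _ a1'); lra.
apply: (@le_trans _ _ (`|t ^+ 2 - t' ^+ 2| * (`|a| * `|a'|) *
    ((1 + kap * a) * (1 + kap * a')))); last first.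
  by rewrite mulrC ler_wpM2r// !mulr_ge0.
rewrite -(gtr0_norm h0) -(gtr0_norm h0') -!normrM E distrC normrM mulrC.
rewrite ler_wpM2l// [in leRHS]gtr0_norm; last first.
  by rewrite mulr_gt0// (lt_le_trans _ low)// exprn_gt0.
by rewrite ler_wpM2l// ltW.
Qed.

(** Being [far] from 1 and from -1 at once. *)
Definition away d P : Prop := d * (1 + `|P|) <= `| `|P| - 1|.

(** 1 - P t differs from 1 - P^2 by P (t - P), and |1 - P^2| = ||P| - 1| (1 + |P|) is at least d (1
    + |P|)^2, so the sign and the order of magnitude persist. *)
Lemma away_near d eta P t : 0 < d -> d <= 1 -> away d P ->
  0 <= eta -> eta <= d / 4 -> `|t - P| <= eta * (1 + `|P|) ->
  let g := Num.sg (P ^+ 2 - 1) in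
  [/\ is_sign g, 0 < g * (P ^+ 2 - 1), 0 < g * (t ^+ 2 - 1) &
      d / 2 <= `|t ^+ 2 - 1|] /\
  [/\ `|t| <= 2 * (1 + `|P|), 1 + `|P| <= 2 * (1 + `|t|),
     `|1 - P * t| <= 2 * (1 + `|P|) ^+ 2,
     d / 2 * (1 + `|P|) ^+ 2 <= `|1 - P * t| &
     0 < (1 - P ^+ 2) * (1 - P * t)].
Proof.
move=> d0 d1 aw e0 ed tP g.
have P0 := normr_ge0 P; have t0 := normr_ge0 t.
set s := 1 + `|P| in aw tP *.
have s1 : 1 <= s by rewrite lerDl.
have es : eta * s <= d / 4 * s by rewrite ler_wpM2r// (le_trans ler01).
have ds : 0 <= d * s by rewrite mulr_ge0 ?(ltW d0)// (le_trans ler01).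
have dsd : d <= d * s by rewrite ler_peMr// ltW.
have dss : d * s <= s by rewrite ler_piMl// (le_trans ler01).
have pE : P ^+ 2 = `|P| ^+ 2 by rewrite real_normK ?num_real.
have tE : t ^+ 2 = `|t| ^+ 2 by rewrite real_normK ?num_real.
have tPn : `| `|t| - `|P| | <= d / 4 * s.
  by apply: le_trans (le_trans tP es); exact: ler_dist_dist.
have tPn' : `|t - P| <= d / 4 * s by exact: le_trans es.
have PP : `|P| <= s by rewrite /s lerDr.
have Pt : `|1 - P * t - (1 - P ^+ 2)| <= d / 4 * s * s.
  rewrite (_ : _ - _ = P * (P - t)); last by ring.
  by rewrite normrM mulrC distrC ler_pM.
have Pt' : `|1 - P ^+ 2| = `| `|P| - 1| * s.
  rewrite pE distrC (_ : _ - 1 = (`|P| - 1) * s); last by rewrite /s; ring.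
  by rewrite normrM (ger0_norm (le_trans ler01 s1)).
have aws : d * s * s <= `|1 - P ^+ 2|.
  by rewrite Pt' ler_wpM2r// (le_trans ler01).
have sq : d * s <= d * s * s by rewrite ler_peMr.
have t2 : t ^+ 2 - 1 = (`|t| - 1) * (`|t| + 1) by rewrite tE; ring.
have p2 : P ^+ 2 - 1 = (`|P| - 1) * (`|P| + 1) by rewrite pE; ring.
have key : [/\ is_sign g, 0 < g * (P ^+ 2 - 1), 0 < g * (t ^+ 2 - 1) & d / 2 <= `|t ^+ 2 - 1|].
  move: tPn; rewrite ler_norml => /andP[h1 h2].
  rewrite /g p2 t2 sgrM [Num.sg (`|P| + 1)]gtr0_sg ?ltr_wpDl// mulr1 !mulrA.
  move: aw; rewrite /away -/s.
  have t1 : 1 <= `|t| + 1 by rewrite lerDr.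
  have p1 : 0 < `|P| + 1 by rewrite ltr_wpDl.
  have [c|c] := lerP 0 (`|P| - 1).
    rewrite (ger0_norm c) => aw; rewrite gtr0_sg ?mul1r; last by lra.
    have h : d / 2 <= `|t| - 1 by lra.
    split; [by left|by rewrite mulr_gt0//; lra|by rewrite mulr_gt0//; lra|].
    rewrite ger0_norm; last by rewrite mulr_ge0//; lra.
    by rewrite (le_trans h)// ler_peMr//; lra.
  rewrite (ltr0_norm c) => aw; rewrite ltr0_sg// !mulN1r.
  have h : d / 2 <= 1 - `|t| by lra.
  split; [by right|by rewrite mulr_gt0//; lra|by rewrite mulr_gt0//; lra|].
  rewrite -normrN -mulNr ger0_norm; last by rewrite mulr_ge0//; lra.
  by rewrite opprB (le_trans h)// ler_peMr//; lra.
split=> //.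
have tle : `|t| <= 2 * s.
  move: tPn; rewrite ler_norml => /andP[h1 h2]; rewrite /s in h2 dss *; lra.
split=> //.
- by move: tPn; rewrite ler_norml => /andP[h1 h2]; rewrite /s in h1 h2 dss *; lra.
- apply: le_trans (ler_normB _ _) _; rewrite normr1 normrM.
  have : `|P| * `|t| <= `|P| * (2 * s) by rewrite ler_wpM2l.
  by rewrite /s; lra.
- have := ler_distD (1 - P * t) 0 (1 - P ^+ 2); rewrite !sub0r !normrN => h.
  by move: h aws Pt ds sq; rewrite [`|1 - P * t - _|]distrC; lra.
have aw0 : 0 < d * s * s.
  by rewrite !mulr_gt0// (lt_le_trans ltr01).
have [p|p] := ltP 0 (1 - P ^+ 2).
  apply: mulr_gt0 => //; rewrite (gtr0_norm p) in aws.
  by move: Pt; rewrite ler_norml => /andP[? ?]; lra.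
rewrite (ler0_norm p) in aws; rewrite -mulrNN; apply: mulr_gt0; first lra.
by move: Pt; rewrite ler_norml => /andP[? ?]; lra.
Qed.

Lemma geometric_small (rho c : R) : 0 <= rho < 1 -> 0 < c ->
  exists N, forall n, (N <= n)%N -> rho ^+ n < c.
Proof.
move=> /andP[r0 r1] c0.
have /cvgrPdist_lt/(_ _ c0)[N _ H] : rho ^+ n @[n --> \oo] --> (0 : R).
  by apply: cvg_expr; rewrite ger0_norm.
exists N => n nN; have := H n nN; rewrite /= sub0r normrN ger0_norm//.
exact: exprn_ge0.
Qed.

(** The decay is kept as rho^n, while [k] factors |a| are set aside to absorb powers of 1 + |P|. *)
Lemma expr_even_le (a rho : R) n k : (k <= n)%N -> `|a| <= rho -> rho < 1 ->
  a ^+ (2 * n) <= `|a| ^+ k * rho ^+ n.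
Proof.
move=> kn ar r1; have a0 := normr_ge0 a.
rewrite exprM -(real_normK (num_real a)) -exprM.
have -> : (2 * n = k + (n + (n - k)))%N by rewrite addnCA subnKC// mul2n addnn.
rewrite !exprD ler_wpM2l ?exprn_ge0//.
rewrite -[leRHS]mulr1 ler_pM ?exprn_ge0 ?lerXn2r ?nnegrE ?(le_trans a0 ar)//.
by rewrite exprn_ile1// (le_trans ar)// ltW.
Qed.

End Estimates.

(** * An edge mode when the two ends are apart *)

Section Modes.
Context {R : realType}.
Variable kap : R.
Hypotheses (kap_gt0 : 0 < kap) (kap_lt1 : kap < 1).
Implicit Types (P Q x a t s d eps eta g : R) (n : nat).
Local Notation quantized := (quantized kap).
Local Notation mode := (mode kap).
Local Notation defect := (defect kap).
Local Notation side P := (Num.sg (P ^+ 2 - 1)).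

Lemma dominated_sign (u v : R) : `|v| < `|u| -> 0 < u * (u - v).
Proof.
move=> vu; have u0 : 0 < `|u| by apply: le_lt_trans vu.
have : u * v <= `|u| * `|v| by rewrite -normrM ler_norm.
have : `|u| * `|v| < `|u| * `|u| by rewrite ltr_pM2l.
have : `|u| * `|u| = u * u by rewrite -expr2 real_normK ?num_real// expr2.
rewrite mulrBr; lra.
Qed.

Lemma opposite_signs (u v y z : R) :
  0 < u * y -> 0 < v * z -> u * v < 0 -> y * z < 0.
Proof. by move=> uy vz uv; have := mulr_gt0 uy vz; rewrite mulrACA nmulr_rgt0. Qed.

Lemma mode_near d : 0 < d -> d <= 1 -> exists2 rho, 0 < rho < 1 &
  forall P t eta, away d P -> 0 <= eta -> eta <= d / 4 ->
    `|t - P| <= eta * (1 + `|P|) ->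
    [/\ `|mode (side P) t| <= rho, mode (side P) t != 0 &
        `|mode (side P) t| * (1 + `|P|) ^+ 2 <= 16] /\
    0 < side P * mode (side P) t.
Proof.
move=> d0 d1; have d2 : 0 < d / 2 by rewrite divr_gt0.
have [rho r01 H] := disp_le_rho kap_gt0 kap_lt1 d2.
exists rho => // P t eta aw e0 ed tP.
have [[gS _ gt t2] [_ sc _ _ _]] := away_near d0 d1 aw e0 ed tP.
have [D _ m0] := mode_disp kap_gt0 kap_lt1 gS gt; have [aN _ _ _] := D.
by do !split => //; [exact: H D t2|exact: disp_scale D sc].
Qed.

(** (t - P)(t - Q) changes sign across [P], and at distance eta (1 + |P|) from [P] it dominates the
    exponentially small right-hand side. *)
Lemma left_mode d (gam : R) : 0 < d -> d <= 1 -> 0 < gam ->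
  exists C rho N, [/\ 0 < C, 0 < rho < 1 & forall n P Q, (N <= n)%N ->
    away d P -> gam * (1 + `|P| + `|Q|) <= `|P - Q| ->
    exists t, let a := mode (side P) t in
      [/\ is_sign (side P), 0 < side P * (t ^+ 2 - 1),
         0 < side P * (P ^+ 2 - 1), quantized n P Q t a & `|a| <= rho] /\
      [/\ 0 < (1 - P ^+ 2) * (1 - P * t), t - Q != 0, `|1 - Q * t| * `|a| <= C * `|t - Q|,
         `|a - mode (side P) P| <= C * a ^+ (2 * n) &
         `|t - P| <= C * a ^+ (2 * n) * (1 + `|P|) ^+ 3]].
Proof.
move=> d0 d1 g0; have [rho r01 Hnear] := mode_near d0 d1.
have [r0 r1] := andP r01.
(* d / 4 gives access to [away_near], gam / 2 keeps [t] away from [Q]. *)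
pose eta := Num.min (d / 4) (gam / 2).
have e0 : 0 < eta by rewrite lt_min !divr_gt0.
have ed : eta <= d / 4 by rewrite ge_min lexx.
have eg : eta <= gam / 2 by rewrite ge_min lexx orbT.
(* 128 is 8 times the 16 of [disp_scale]; the 8 comes from the bounds 2 s^2 on 1 - P t, 2 s B on 1 -
   Q t and gam / 2 B on t - Q. *)
pose c := eta * gam / 128.
have c0 : 0 < c by rewrite divr_gt0// mulr_gt0.
have rr : 0 <= rho < 1 by rewrite ltW.
have [N HN] := geometric_small rr c0.
pose K := 4 / (kap * (1 - kap) ^+ 2).
have K0 : 0 < K by rewrite divr_gt0// mulr_gt0// exprn_gt0// subr_gt0.
(* The first summand serves the coefficient ratio. In the second, 24 = 8 * 3 with |t + P| <= 3 s,
   and 256 = 16 * 16 applies [disp_scale] to both multipliers. *)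
pose C := 64 / gam + K * (24 / gam * 256).
have C0 : 0 < C by rewrite addr_gt0 ?divr_gt0// mulr_gt0// mulr_gt0// divr_gt0.
exists C, rho, (maxn N 1); split=> // n P Q; rewrite geq_max => /andP[nN n1] aw PQ.
set g := side P; set s := 1 + `|P|; set B := 1 + `|P| + `|Q| in PQ.
have P0 := normr_ge0 P; have Q0 := normr_ge0 Q.
have s1 : 1 <= s by rewrite lerDl.
have s0 : 0 < s by exact: lt_le_trans s1.
have sB : s <= B by rewrite /B lerDl.
have B0 : 0 < B by exact: lt_le_trans sB.
have es0 : 0 <= eta * s by rewrite mulr_ge0// ltW.
have egB : eta * s <= gam / 2 * B by rewrite ler_pM// ltW.
have gB0 : 0 < gam / 2 * B by rewrite mulr_gt0// divr_gt0.
have near t : `|t - P| <= eta * s ->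
  [/\ gam / 2 * B <= `|t - Q|, `|1 - Q * t| <= 2 * s * B,
      `|mode g t| * s ^+ 2 <= 16, 0 <= mode g t ^+ (2 * n) &
      mode g t ^+ (2 * n) * `|(1 - P * t) * (1 - Q * t)| <=
      8 / gam * (mode g t ^+ (2 * n) * s ^+ 3) * `|t - Q| ] /\
  8 / gam * (mode g t ^+ (2 * n) * s ^+ 3) < eta * s.
  move=> tP; have [[ar aN a16] _] := Hnear P t eta aw (ltW e0) ed tP.
  have [_ [t2s _ Pt _ _]] := away_near d0 d1 aw (ltW e0) ed tP.
  rewrite -/s in t2s Pt a16; rewrite -/g in ar aN a16.
  have tQ : gam / 2 * B <= `|t - Q|.
    have := ler_distD t P Q; rewrite [`|P - t|]distrC; lra.
  have Qt : `|1 - Q * t| <= 2 * s * B.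
    apply: le_trans (ler_normB _ _) _; rewrite normr1 normrM.
    have : `|Q| * `|t| <= `|Q| * (2 * s) by rewrite ler_wpM2l.
    have : 0 <= s * (B - 1 - `|Q|) by apply: mulr_ge0; [exact: ltW|rewrite /B; lra].
    by lra.
  have A0 : 0 <= mode g t ^+ (2 * n) by rewrite exprM exprn_ge0// sqr_ge0.
  have s30 : 0 <= s ^+ 3 by rewrite exprn_ge0// ltW.
  split; [split=> //|].
    have e1 : 2 * s ^+ 2 * (2 * s * B) = s ^+ 3 * (8 / gam * (gam / 2 * B)).
      by field; exact: lt0r_neq0.
    have -> : 8 / gam * (mode g t ^+ (2 * n) * s ^+ 3) * `|t - Q| =
        mode g t ^+ (2 * n) * (s ^+ 3 * (8 / gam * `|t - Q|)) by ring.
    apply: ler_wpM2l => //; rewrite normrM.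
    have h := ler_pM (normr_ge0 _) (normr_ge0 _) Pt Qt.
    apply: le_trans h _; rewrite e1; apply: ler_wpM2l => //.
    by apply: ler_wpM2l => //; rewrite divr_ge0// ltW.
  have Ale : mode g t ^+ (2 * n) <= `|mode g t| ^+ 1 * rho ^+ n by exact: expr_even_le.
  have rn : 0 <= rho ^+ n by rewrite exprn_ge0// ltW.
  have : mode g t ^+ (2 * n) * s ^+ 3 <= 16 * rho ^+ n * s.
    apply: le_trans (ler_wpM2r s30 Ale) _; rewrite expr1.
    rewrite (_ : _ * s ^+ 3 = `|mode g t| * s ^+ 2 * (rho ^+ n * s)); last by ring.
    rewrite -[leRHS]mulrA; apply: ler_wpM2r => //.
    by apply: mulr_ge0 => //; exact: ltW.
  have g8 : 0 < 8 / gam by rewrite divr_gt0.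
  rewrite -(ler_pM2l g8) => h; apply: le_lt_trans h _.
  have -> : 8 / gam * (16 * rho ^+ n * s) = 128 / gam * rho ^+ n * s.
    by field; exact: lt0r_neq0.
  rewrite ltr_pM2r//; have g128 : 0 < 128 / gam by rewrite divr_gt0.
  have h : 128 / gam * rho ^+ n < 128 / gam * c by rewrite ltr_pM2l// HN.
  apply: lt_le_trans h _; rewrite /c.
  by have -> : 128 / gam * (eta * gam / 128) = eta by field; exact: lt0r_neq0.
have pm : [/\ `|P - eta * s - P| <= eta * s & `|P + eta * s - P| <= eta * s].
  by rewrite addrAC subrr sub0r normrN addrAC subrr add0r ger0_norm.
have [pml pmr] := pm.
have end_sign t : `|t - P| = eta * s -> 0 < ((t - P) * (t - Q)) * defect g n P Q t.
  move=> tP; have tP' : `|t - P| <= eta * s by rewrite tP.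
  have [[tQ _ _ A0 h1] h2] := near t tP'.
  apply: dominated_sign; rewrite [ltLHS]normrM (ger0_norm A0) [ltRHS]normrM tP.
  by apply: le_lt_trans h1 _; rewrite ltr_pM2r// (lt_le_trans gB0).
have [||||t] := @defect_root R kap kap_gt0 kap_lt1 g n P Q (P - eta * s) (P + eta * s).
- by have [[]] := away_near d0 d1 aw (ltW e0) ed pml.
- by lra.
- move=> t /andP[l r]; have tP : `|t - P| <= eta * s by rewrite ler_norml; lra.
  by have [[]] := away_near d0 d1 aw (ltW e0) ed tP.
- apply: (opposite_signs (end_sign _ _) (end_sign _ _)).
  + by rewrite addrAC subrr sub0r normrN ger0_norm.
  + by rewrite addrAC subrr add0r ger0_norm.
  rewrite mulrACA nmulr_rlt0; last first.
    rewrite addrAC subrr sub0r [P + _]addrC addrK mulNr oppr_lt0.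
    by rewrite !mulr_gt0.
  rewrite (_ : _ * _ = `|P - Q| ^+ 2 - (eta * s) ^+ 2); last first.
    by rewrite real_normK ?num_real//; ring.
  by rewrite subr_gt0 ltrXn2r ?nnegrE//; lra.
move=> /andP[tl tr] F0; exists t => a.
have tP : `|t - P| <= eta * s by rewrite ler_norml; lra.
have [[gS gP gt _] [t2s _ _ _ Ptg]] := away_near d0 d1 aw (ltW e0) ed tP.
have [[ar aN a16] ga] := Hnear P t eta aw (ltW e0) ed tP.
have [[tQ Qt _ A0 h1] _] := near t tP.
rewrite -/g -/a -/s in gS gP gt ar aN a16 ga A0 h1 t2s *.
have tQ0 : 0 < `|t - Q| by exact: lt_le_trans tQ.
have tP3 : `|t - P| <= 8 / gam * (a ^+ (2 * n) * s ^+ 3).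
  move/eqP: F0; rewrite subr_eq0 => /eqP/(congr1 Num.norm).
  rewrite normrM [X in _ = X]normrM -/a (ger0_norm A0) => e.
  by rewrite -(ler_pM2r tQ0) e.
have g8 : 0 < 8 / gam by rewrite divr_gt0.
have K2 : 0 <= K * (24 / gam * 256) by rewrite mulr_ge0 ?(ltW K0)// mulr_ge0// divr_ge0// ltW.
have As0 : 0 <= a ^+ (2 * n) * s ^+ 3 by rewrite mulr_ge0// exprn_ge0// ltW.
have C8 : 8 / gam <= C.
  by apply: ler_wpDr K2 _; rewrite ler_pM2r ?invr_gt0// ler_nat.
split; split=> //.
- exact: defect_quantized.
- by rewrite -normr_gt0.
- apply: (@le_trans _ _ (64 / gam * `|t - Q|)); last first.
    by rewrite ler_wpM2r// /C lerDl.
  apply: (@le_trans _ _ (2 * s * B * `|a|)); first by rewrite ler_wpM2r.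
  have as16 : s * `|a| <= 16.
    apply: le_trans a16; rewrite mulrC ler_wpM2l//.
    by rewrite expr2 ler_peMl// ltW.
  have : 0 <= 64 / gam by rewrite divr_ge0// ltW.
  move=> g64; apply: le_trans (ler_wpM2l g64 tQ).
  have -> : 64 / gam * (gam / 2 * B) = 2 * 16 * B by field; exact: lt0r_neq0.
  have -> : 2 * s * B * `|a| = 2 * (s * `|a|) * B by ring.
  by rewrite ler_wpM2r ?(ltW B0)// ler_wpM2l.
- have PP : `|P - P| <= eta * s by rewrite subrr normr0.
  have [[_ _ b16] gb] := Hnear P P eta aw (ltW e0) ed PP.
  rewrite -/g -/s in b16 gb.
  have [Da _ _] := mode_disp kap_gt0 kap_lt1 gS gt.
  have [Db _ _] := mode_disp kap_gt0 kap_lt1 gS gP.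
  have ab : 0 < a * mode g P.
    by have := mulr_gt0 ga gb; rewrite mulrACA (is_sign_sqr gS) mul1r.
  apply: le_trans (disp_dist kap_gt0 kap_lt1 Da Db ab) _; rewrite -/K -/a.
  apply: (@le_trans _ _ (K * (24 / gam * 256) * a ^+ (2 * n))); last first.
    by rewrite ler_wpM2r// /C lerDr divr_ge0// ltW.
  rewrite -mulrA; apply: ler_wpM2l; first exact: ltW.
  have tp : `|t ^+ 2 - P ^+ 2| <= 8 / gam * (a ^+ (2 * n) * s ^+ 3) * (3 * s).
    rewrite subr_sqr normrM ler_pM// (le_trans (ler_normD _ _))//.
    by move: t2s; rewrite /s; lra.
  have b0 := normr_ge0 (mode g P); have a0 := normr_ge0 a.
  have := ler_wpM2r (mulr_ge0 a0 b0) tp; move=> h; apply: le_trans h _.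
  have -> : 8 / gam * (a ^+ (2 * n) * s ^+ 3) * (3 * s) * (`|a| * `|mode g P|) =
      24 / gam * a ^+ (2 * n) * ((`|a| * s ^+ 2) * (`|mode g P| * s ^+ 2)).
    by field; exact: lt0r_neq0.
  have := ler_pM (mulr_ge0 a0 (sqr_ge0 s)) (mulr_ge0 b0 (sqr_ge0 s)) a16 b16.
  have g24 : 0 <= 24 / gam * a ^+ (2 * n) by rewrite mulr_ge0// divr_ge0// ltW.
  by move=> /(ler_wpM2l g24); lra.
- by apply: le_trans tP3 _; rewrite -[leRHS]mulrA ler_wpM2r.
Qed.

End Modes.

(** * Two edge modes when the ends are close *)

Section TwoModes.
Context {R : realType}.
Variable kap : R.
Hypotheses (kap_gt0 : 0 < kap) (kap_lt1 : kap < 1).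
Implicit Types (P Q x a t s d eps eta g : R) (n : nat).
Local Notation quantized := (quantized kap).
Local Notation mode := (mode kap).
Local Notation defect := (defect kap).
Local Notation side P := (Num.sg (P ^+ 2 - 1)).

Lemma two_modes_bounds d : 0 < d -> d <= 1 -> exists rho C,
  [/\ 0 < rho < 1, 0 < C & forall n P Q t, (1 < n)%N -> away d P -> `|t - P| <= d / 8 * (1 + `|P|) ->
    `|P - Q| <= d / 8 * (1 + `|P|) ->
    let A := mode (side P) t ^+ (2 * n) in
    [/\ 0 < A, A * `|(1 - P * t) * (1 - Q * t)| <= C * rho ^+ n,
        d / 4 * (1 + `|P|) ^+ 2 <= `|1 - Q * t| &
        0 < (1 - P ^+ 2) * (1 - Q * t)]].
Proof.
move=> d0 d1; have [rho r01 Hnear] := mode_near kap_gt0 kap_lt1 d0 d1.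
have [r0 r1] := andP r01.
exists rho, (8 * (16 * 16)); split=> //.
move=> n P Q t n1 aw tP PQ A.
have d8 : 0 <= d / 8 by rewrite divr_ge0// ltW.
have d84 : d / 8 <= d / 4 by lra.
have [_ [t2s _ Pt Ptl Ptg]] := away_near d0 d1 aw d8 d84 tP.
have [[ar aN a16] _] := Hnear P t _ aw d8 d84 tP.
rewrite -/A; set a := mode _ t in A ar aN a16 *; set s := 1 + `|P| in tP PQ t2s Pt Ptl a16 *.
have s1 : 1 <= s by rewrite lerDl.
have s0 : 0 < s by exact: lt_le_trans s1.
have A0 : 0 < A by rewrite /A exprM exprn_gt0// exprn_even_gt0//= aN.
have dif : `|(1 - Q * t) - (1 - P * t)| <= d / 4 * s ^+ 2.
  rewrite (_ : _ - _ = (P - Q) * t); last by ring.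
  rewrite normrM; have := ler_pM (normr_ge0 _) (normr_ge0 _) PQ t2s; lra.
have ds2 : d * s ^+ 2 <= s ^+ 2 by rewrite ler_piMl// sqr_ge0.
have ds0 : 0 < d * s ^+ 2 by rewrite mulr_gt0// exprn_gt0.
have Qt : `|1 - Q * t| <= 4 * s ^+ 2.
  by have := ler_distD (1 - P * t) (1 - Q * t) 0; rewrite !subr0; lra.
split=> //.
- have Ale : A <= `|a| ^+ 2 * rho ^+ n by exact: expr_even_le.
  have rn : 0 <= rho ^+ n by rewrite exprn_ge0// ltW.
  have := ler_pM (normr_ge0 _) (normr_ge0 _) Pt Qt; rewrite -normrM => h.
  have := ler_pM (ltW A0) (normr_ge0 _) Ale h => h'; apply: le_trans h' _.
  have -> : `|a| ^+ 2 * rho ^+ n * (2 * s ^+ 2 * (4 * s ^+ 2)) =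
    8 * rho ^+ n * ((`|a| * s ^+ 2) * (`|a| * s ^+ 2)) by ring.
  have as0 : 0 <= `|a| * s ^+ 2 by rewrite mulr_ge0// sqr_ge0.
  have := ler_pM as0 as0 a16 a16.
  have r8 : 0 <= 8 * rho ^+ n by rewrite mulr_ge0.
  by move=> /(ler_wpM2l r8); lra.
- have := ler_distD (1 - Q * t) (1 - P * t) 0; rewrite !subr0 distrC; lra.
move: Ptg dif Ptl; have [p|p] := ltP 0 (1 - P ^+ 2).
  rewrite pmulr_rgt0// => q; rewrite (gtr0_norm q) ler_norml => /andP[? ?] ?.
  by rewrite pmulr_rgt0//; lra.
move=> q; have p' : 1 - P ^+ 2 < 0.
  by rewrite lt_neqAle p andbT; apply: contraTneq q => ->; rewrite mul0r ltxx.
move: q; rewrite nmulr_rgt0// => q; rewrite (ltr0_norm q) ler_norml => /andP[? ?] ?.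
by rewrite nmulr_rgt0//; lra.
Qed.

(** At t = P the product (t - P)(t - Q) vanishes and the defect is negative. At distance d / 8 (1 +
    |P|) on either side [Q] is at most half as far from [P] as [t], so the product is positive and
    dominates. *)
Lemma two_modes d : 0 < d -> d <= 1 -> exists N, forall n P Q, (N <= n)%N ->
  away d P -> `|P - Q| <= d / 16 * (1 + `|P|) ->
  exists tm tp, [/\ tm < P < tp,
    `|tm - P| <= d / 8 * (1 + `|P|), `|tp - P| <= d / 8 * (1 + `|P|),
    quantized n P Q tm (mode (side P) tm) &
    quantized n P Q tp (mode (side P) tp)].
Proof.
move=> d0 d1; have [rho [C [r01 C0 B]]] := two_modes_bounds d0 d1.
have [r0 r1] := andP r01.
pose c := d / 8 * (d / 16) / C.
have c0 : 0 < c.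
  by apply: divr_gt0 => //; apply: mulr_gt0; exact: divr_gt0.
have rr : 0 <= rho < 1 by rewrite ltW.
have [N HN] := geometric_small rr c0.
exists (maxn N 2) => n P Q; rewrite geq_max => /andP[nN n2] aw PQ.
set s := 1 + `|P| in PQ *; set g := side P.
have s1 : 1 <= s by rewrite lerDl.
have s0 : 0 < s by exact: lt_le_trans s1.
have ds : 0 < d * s by rewrite mulr_gt0.
have PQ8 : `|P - Q| <= d / 8 * s by lra.
have d8 : 0 <= d / 8 by rewrite divr_ge0// ltW.
have d84 : d / 8 <= d / 4 by lra.
have small : C * rho ^+ n < d / 8 * s * (d / 16 * s).
  apply: (@lt_le_trans _ _ (C * c)); first by rewrite (ltr_pM2l C0) HN.
  have -> : C * c = d / 8 * (d / 16) by rewrite /c; field; exact: lt0r_neq0.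
  have := ler_pM d8 (_ : 0 <= d / 16) (_ : d / 8 <= d / 8 * s) (_ : d / 16 <= d / 16 * s).
  by apply; rewrite ?divr_ge0 ?ler_peMr ?divr_ge0// ltW.
have Dneg : defect g n P Q P < 0.
  have PP : `|P - P| <= d / 8 * s by rewrite subrr normr0 mulr_ge0// ltW.
  have [A0 _ _ sgn] := B n P Q P n2 aw PP PQ8.
  rewrite /defect subrr mul0r sub0r oppr_lt0; exact: mulr_gt0.
have Dpos t : `|t - P| = d / 8 * s -> 0 < defect g n P Q t.
  move=> te; have tle : `|t - P| <= d / 8 * s by rewrite te.
  have [A0 Ab _ _] := B n P Q t n2 aw tle PQ8.
  have uv : d / 8 * s * (d / 16 * s) <= (t - P) * (t - Q).
    have -> : (t - P) * (t - Q) = `|t - P| ^+ 2 + (t - P) * (P - Q).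
      by rewrite real_normK ?num_real//; ring.
    have : - (`|t - P| * `|P - Q|) <= (t - P) * (P - Q).
      by rewrite -normrM lerNl -normrN ler_norm.
    have : `|t - P| * `|P - Q| <= `|t - P| * (d / 16 * s) by rewrite ler_wpM2l.
    by rewrite te; lra.
  have nle : mode g t ^+ (2 * n) * ((1 - P * t) * (1 - Q * t)) <=
     mode g t ^+ (2 * n) * `|(1 - P * t) * (1 - Q * t)|.
    by rewrite ler_wpM2l ?ler_norm// ltW.
  rewrite /defect subr_gt0; apply: le_lt_trans nle _; apply: le_lt_trans Ab _.
  exact: lt_le_trans uv.
have near t : P - d / 8 * s <= t <= P + d / 8 * s -> `|t - P| <= d / 8 * s.
  by move=> /andP[? ?]; rewrite ler_norml; lra.
have gS t : `|t - P| <= d / 8 * s -> is_sign g /\ 0 < g * (t ^+ 2 - 1).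
  by move=> tP; have [[]] := away_near d0 d1 aw d8 d84 tP.
have ds8 : 0 < d / 8 * s by lra.
have eq1 : `|P - d / 8 * s - P| = d / 8 * s by rewrite addrAC subrr sub0r normrN gtr0_norm.
have eq2 : `|P + d / 8 * s - P| = d / 8 * s by rewrite addrAC subrr add0r gtr0_norm.
have gS0 : is_sign g by have [] := gS (P - d / 8 * s); rewrite ?eq1.
have [|||tm tmI Fm] := @defect_root R kap kap_gt0 kap_lt1 g n P Q (P - d / 8 * s) P gS0.
- by lra.
- by move=> t /andP[? ?]; have [] := gS t => //; apply: near; lra.
- by rewrite nmulr_llt0// (Dpos _ eq1).
have [|||tp tpI Fp] := @defect_root R kap kap_gt0 kap_lt1 g n P Q P (P + d / 8 * s) gS0.
- by lra.
- by move=> t /andP[? ?]; have [] := gS t => //; apply: near; lra.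
- by rewrite nmulr_rlt0// (Dpos _ eq2).
have tmP : `|tm - P| <= d / 8 * s by apply: near; lra.
have tpP : `|tp - P| <= d / 8 * s by apply: near; lra.
have [_ gm] := gS _ tmP; have [_ gp] := gS _ tpP.
exists tm, tp; split=> //; [|exact: defect_quantized|exact: defect_quantized].
have tmN : tm != P by apply/eqP => e; move: Dneg; rewrite e in Fm; rewrite Fm ltxx.
have tpN : tp != P by apply/eqP => e; move: Dneg; rewrite e in Fp; rewrite Fp ltxx.
move: tmI tpI => /andP[_ h1] /andP[h2 _].
by rewrite lt_neqAle tmN h1 lt_neqAle eq_sym tpN h2.
Qed.

(** By [coef_ratioE] the quantity |c2 / c1| |a|^(-2n) is |1 - Q t| / (|t - Q| |a|), so localization
    at both edges means that t - Q is small compared with 1 - Q t. *)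
Lemma two_modes_ratio d (M : R) : 0 < d -> d <= 1 -> 0 < M ->
  exists2 e, 0 < e & exists N, forall n P Q t, (N <= n)%N ->
    away d P -> `|P - Q| <= e * (1 + `|P|) -> `|t - P| <= d / 8 * (1 + `|P|) ->
    quantized n P Q t (mode (side P) t) ->
    [/\ 0 < (1 - P ^+ 2) * (1 - P * t), 0 < side P * (t ^+ 2 - 1), t - Q != 0 &
        M * (`|t - Q| * `|mode (side P) t|) <= `|1 - Q * t|].
Proof.
move=> d0 d1 M0; have [rho [C [r01 C0 B]]] := two_modes_bounds d0 d1.
have [r0 r1] := andP r01.
(* Chosen so that M (2 e s + nu) <= d / 4 s^2 with s = 1 + |P|, the lower bound on 1 - Q t. *)
pose e := Num.min (d / 8) (d / (16 * M)); pose nu := d / (8 * M).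
have M16 : 0 < 16 * M by rewrite mulr_gt0.
have nu0 : 0 < nu by rewrite divr_gt0// mulr_gt0.
have c0 : 0 < nu ^+ 2 / (2 * C) by rewrite divr_gt0 ?exprn_gt0// mulr_gt0.
have rr : 0 <= rho < 1 by rewrite ltW.
have [N HN] := geometric_small rr c0.
exists e; first by rewrite lt_min !divr_gt0.
exists (maxn N 2) => n P Q t; rewrite geq_max => /andP[nN n2] aw PQ tP q.
set s := 1 + `|P| in PQ tP; set a := mode _ t in q *.
have s1 : 1 <= s by rewrite lerDl.
have s0 : 0 < s by exact: lt_le_trans s1.
have d8 : 0 <= d / 8 by rewrite divr_ge0// ltW.
have d84 : d / 8 <= d / 4 by lra.
have PQ8 : `|P - Q| <= d / 8 * s.
  by apply: le_trans PQ _; rewrite ler_wpM2r ?(ltW s0)// ge_min lexx.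
have [A0 Ab Qt _] := B n P Q t n2 aw tP PQ8; rewrite -/a -/s in A0 Ab Qt.
have [[gS _ gt _] [_ _ _ Pt Ptg]] := away_near d0 d1 aw d8 d84 tP; rewrite -/s in Pt.
have ds2 : 0 < d * s ^+ 2 by rewrite mulr_gt0// exprn_gt0.
have [D a1 _] := mode_disp kap_gt0 kap_lt1 gS gt.
have E := quantized_blaschke kap_gt0 kap_lt1 D q.
have Pt0 : 1 - P * t != 0 by rewrite -normr_gt0; lra.
have Qt0 : 1 - Q * t != 0 by rewrite -normr_gt0; lra.
have tQ0 : t - Q != 0.
  apply/eqP => h; move: E; rewrite h mulr0 => /esym/eqP.
  by rewrite !mulf_eq0 (negbTE Pt0) (negbTE Qt0) gt_eqF.
split; [exact: Ptg|exact: gt|exact: tQ0|rewrite -/a].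
have E' : `|t - P| * `|t - Q| <= C * rho ^+ n.
  by rewrite -normrM E normrM (gtr0_norm A0).
(* Otherwise [t] is at least half as far from [P] as from [Q], and the product of the two distances
   would not be exponentially small. *)
have wle : `|t - Q| <= 2 * (e * s) + nu.
  rewrite leNgt; apply/negP => w.
  have es0 : 0 <= e * s by apply: le_trans PQ; exact: normr_ge0.
  have h : `|t - Q| / 2 <= `|t - P|.
    by have := ler_distD t P Q => h; move: (ler_distD P t Q); lra.
  have : 2 * C * rho ^+ n < nu * nu.
    by rewrite -ltr_pdivlMl ?mulr_gt0// mulrC -expr2 HN.
  have : nu * nu <= `|t - Q| * `|t - Q| by apply: ler_pM; rewrite ?(ltW nu0)//; lra.
  have : `|t - Q| / 2 * `|t - Q| <= `|t - P| * `|t - Q| by rewrite ler_wpM2r.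
  have : 0 < nu * nu by rewrite mulr_gt0.
  by lra.
apply: le_trans Qt.
apply: (@le_trans _ _ (M * (2 * (e * s) + nu))).
  rewrite ler_wpM2l ?(ltW M0)//; apply: le_trans wle.
  by rewrite ler_piMr// ltW.
have e16 : M * e <= d / 16.
  have : e <= d / (16 * M) by rewrite ge_min lexx orbT.
  move=> /(ler_wpM2l (ltW M0)) h; apply: le_trans h _.
  by have -> : M * (d / (16 * M)) = d / 16 by field; exact: lt0r_neq0.
have Mn : M * nu = d / 8 by rewrite /nu; field; exact: lt0r_neq0.
have : M * e * s <= d / 16 * s by rewrite ler_wpM2r// ltW.
have : d * s <= d * s ^+ 2 by rewrite ler_wpM2l ?(ltW d0)// expr2 ler_peMl// ltW.
have : d <= d * s by rewrite ler_peMr// ltW.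
by move: Mn; lra.
Qed.

End TwoModes.

(** * Asymptotic comparison *)

Section Asymptotics.
Context {R : realType}.
Implicit Types f g : R^nat.

Lemma limn_einf_gt0P (u : R^nat) :
  (0 < limn_einf (fun n => (u n)%:E))%E <->
  exists2 d : R, 0 < d & \forall n \near \oo, d <= u n.
Proof.
pose v n := (u n)%:E.
have E : limn_einf v = ereal_sup (range (einfs v)).
  by rewrite limn_einf_lim; apply/cvg_lim => //; exact: cvg_einfs_sup.
rewrite -/v E; split=> [|[d d0 [N _ H]]].
  move=> /ereal_sup_gt[_ [N _ <-]] h.
  have [d [d0 dN]] : exists d : R, 0 < d /\ (d%:E <= einfs v N)%E.
    case: (einfs v N) h => [r| |]//; first by rewrite lte_fin; exists r.
    by exists 1; split => //; rewrite leey.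
  exists d => //; exists N => // n /= Nn; rewrite -lee_fin (le_trans dN)//.
  by apply: ereal_inf_lbound; exists n.
apply: (@lt_le_trans _ _ d%:E); first by rewrite lte_fin.
apply: (@le_trans _ _ (einfs v N)); last by apply: ereal_sup_ubound; exists N.
by apply: le_ereal_inf_tmp => _ [n /= Nn <-]; rewrite lee_fin; exact: H.
Qed.

Lemma asymp_neq_near f g : asymp_neq f g -> exists2 d : R, 0 < d &
  \forall n \near \oo, d * Num.max `|f n| `|g n| <= `|f n - g n|.
Proof.
move=> [/limn_einf_gt0P[d d0 H] _]; exists d => //; apply: filterS H => n.
set m := Num.max _ _ => dm.
have m0 : 0 <= m by rewrite le_max normr_ge0.
move: m0; rewrite le_eqVlt => /predU1P[<-|m0]; first by rewrite mulr0.
by rewrite -ler_pdivlMr.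
Qed.

(** The condition at index 0 refutes [g = cst 0], the premise of the second clause of
    [asymp_neq]. *)
Lemma near_asymp_neq f g (d : R) : 0 < d -> g 0%N != 0 ->
  (\forall n \near \oo, g n != 0 /\ d * Num.max `|f n| `|g n| <= `|f n - g n|) ->
  asymp_neq f g.
Proof.
move=> d0 g0 H; split; last by move=> gE; rewrite gE eqxx in g0.
apply/limn_einf_gt0P; exists d => //; apply: filterS H => n [gn h].
by rewrite ler_pdivlMr// lt_max !normr_gt0 gn orbT.
Qed.

Lemma asymp_eq_near f g : asymp_eq f g -> g = cst 0 \/
  forall e : R, 0 < e -> \forall n \near \oo, `|f n - g n| <= e * `|f n|.
Proof. by move=> [[g0 _]|/eqoP h]; [left|right]. Qed.

Lemma near_asymp_eq f g :
  (forall e : R, 0 < e -> \forall n \near \oo, `|f n - g n| <= e * `|f n|) ->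
  asymp_eq f g.
Proof. by move=> h; right; apply/eqoP. Qed.

Lemma asymp_eq_cstP f (c : R) : asymp_eq f (cst c) <-> f @ \oo --> c.
Proof.
split=> [h|h].
  case: h => [[/(congr1 (@^~ 0%N)) /= -> //]|/eqoP h].
  apply/cvgrPdist_le => e e0.
  (* The bound 1 / 2 controls |f n| by 2 (|c| + 1); the other one then turns the relative error into
     [e]. *)
  pose e' := Num.min (1 / 2) (e / (2 * (`|c| + 1))).
  have c1 : 0 < 2 * (`|c| + 1) by rewrite mulr_gt0// ltr_wpDl.
  have e'0 : 0 < e' by rewrite lt_min divr_gt0//= divr_gt0.
  have e'1 : e' <= 1 / 2 by rewrite ge_min lexx.
  have e'2 : e' * (2 * (`|c| + 1)) <= e.
    by rewrite -ler_pdivlMr// ge_min lexx orbT.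
  have := h _ e'0; apply: filterS => n /=.
  have : `|f n| <= `|f n - c| + `|c| by rewrite -[X in `|X| <= _](subrK c) ler_normD.
  rewrite [`|c - _|]distrC => h1 h2; apply: le_trans (h2) (le_trans _ e'2).
  rewrite ler_wpM2l ?(ltW e'0)//.
  have : e' * `|f n| <= 1 / 2 * `|f n| by rewrite ler_wpM2r.
  by have := normr_ge0 c; lra.
have [c0|c0] := eqVneq c 0; first by left; rewrite -c0.
right; apply/eqoP => e e0.
have c2 : 0 < `|c| / 2 by rewrite divr_gt0 ?normr_gt0.
have ec : 0 < e * (`|c| / 2) by rewrite mulr_gt0.
move/cvgrPdist_le : h => h.
apply: filterS2 (h _ c2) (h _ ec) => n /= h1 h2.
rewrite distrC (le_trans h2)// ler_wpM2l ?(ltW e0)//.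
have := ler_distD (f n) c 0; rewrite !subr0; lra.
Qed.

End Asymptotics.

(** * States of the chain *)

Section States.
Context {R : realType}.
Variables k1 k2 : R.
Hypotheses (k1_gt0 : 0 < k1) (k1_lt_k2 : k1 < k2).
Implicit Types (P Q x a t w : R) (n : nat).
Local Notation kap := (k1 / k2).

Lemma k2_gt0 : 0 < k2. Proof. exact: lt_trans k1_lt_k2. Qed.

Lemma kap_gt0 : 0 < kap. Proof. by rewrite divr_gt0// k2_gt0. Qed.

Lemma kap_lt1 : kap < 1. Proof. by rewrite ltr_pdivrMr ?k2_gt0// mul1r. Qed.

Definition chain_state (k31 : R) x n : 'cV[R]_(2 * n) :=
  \col_i gsol kap (k31 / k2 - 1) x i.+1.

Lemma eigenstate_quantized (k31 k32 : R) n u w a : (0 < n)%N ->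
  eigenstate (chain_mx k1 k2 k31 k32 n) u w -> multiplier k1 k2 w a ->
  let x := (k1 + k2 - w ^+ 2) / k2 in
  [/\ disp kap x (- x / (1 + kap * a)) a,
     quantized kap n (k31 / k2 - 1) (k32 / k2 - 1) (- x / (1 + kap * a)) a,
     entry u 0 != 0 & u = entry u 0 *: chain_state k31 x n].
Proof.
move=> n0 [u0 w0 Lu] [aN a1 aE] x.
have k2N := lt0r_neq0 k2_gt0; have k1N := lt0r_neq0 k1_gt0.
have D : disp kap x (- x / (1 + kap * a)) a.
  apply: (disp_intro kap_gt0 kap_lt1 aN a1); rewrite aE /x; field.
  by rewrite k1N k2N.
have [uE f0] := chain_eigen_gsol k1_gt0 k2_gt0 n0 Lu.
split=> //; first by apply/(charf_quantized kap_gt0 n _ _ D); exact: f0.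
by apply: contra_neq u0 => e; rewrite uE e scale0r.
Qed.

(** -1 <= t gives x <= 1 + kap, so the argument of the square root is nonnegative. For a < 0 one has
    |x| < 1 - kap, the gap between the bands; for a > 0, x < -(1 + kap), above the upper band. *)
Lemma state_eigenstate (k31 k32 : R) n t a : (0 < n)%N -> -1 <= t ->
  `|a| < 1 -> let x := - (t * (1 + kap * a)) in
  let w := Num.sqrt (k1 + k2 - k2 * x) in
  disp kap x t a ->
  quantized kap n (k31 / k2 - 1) (k32 / k2 - 1) t a ->
  [/\ eigenstate (chain_mx k1 k2 k31 k32 n) (chain_state k31 x n) w,
     multiplier k1 k2 w a, ~ bands k1 k2 (w ^+ 2) & w ^+ 2 = k1 + k2 - k2 * x].
Proof.
move=> n0 t1 a1 x w D q; have [aN _ tE xE] := D.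
have k20 := k2_gt0; have k2N := lt0r_neq0 k20; have k1N := lt0r_neq0 k1_gt0.
have h0 := disp_factor_gt0 kap_gt0 kap_lt1 (ltW a1).
have ha : 1 + kap * a <= 1 + kap.
  move: (ltW a1); rewrite ler_norml => /andP[_ h].
  by have := ler_wpM2l (ltW kap_gt0) h; lra.
have xle : x <= 1 + kap.
  have := ler_wpM2r (ltW h0) t1; rewrite /x; lra.
have kk : k2 * (1 + kap) = k1 + k2 by field.
have w2 : w ^+ 2 = k1 + k2 - k2 * x.
  by rewrite sqr_sqrtr// subr_ge0 -kk ler_wpM2l// ltW.
have xw : (k1 + k2 - w ^+ 2) / k2 = x by rewrite w2; field.
have xsq := disp_sqr kap_gt0 kap_lt1 D.
split=> //.
- have := @chain_eigen_of_charf R k1 k2 k31 k32 w n k1_gt0 k20 n0 (sqrtr_ge0 _).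
  rewrite /= xw; apply; exact/(charf_quantized kap_gt0 n _ _ D).
- split=> //; first exact: ltW.
  have -> : a + a^-1 = (x ^+ 2 - 1 - kap ^+ 2) / kap.
    by rewrite xsq; field; rewrite aN k1N k2N.
  have -> : w ^+ 4 = (w ^+ 2) ^+ 2 by rewrite -exprM.
  by rewrite w2; field; rewrite k1N k2N.
have [lo|hi] : x ^+ 2 < (1 - kap) ^+ 2 \/ (1 + kap) ^+ 2 < x ^+ 2.
  have [a0|a0] := ltP 0 a.
    right; rewrite xsq -subr_gt0.
    rewrite (_ : _ - _ = kap * (1 - a) ^+ 2 / a); last by field; rewrite aN k2N.
    rewrite divr_gt0// mulr_gt0 ?kap_gt0// exprn_even_gt0//= subr_eq0 eq_sym.
    by move: a1; rewrite ltr_norml => /andP[_ /lt_eqF ->].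
  have a0' : a < 0 by rewrite lt_neqAle aN.
  left; rewrite xsq -subr_lt0.
  rewrite (_ : _ - _ = kap * (1 + a) ^+ 2 / a); last by field; rewrite aN k2N.
  rewrite nmulr_llt0 ?invr_lt0// mulr_gt0 ?kap_gt0// exprn_even_gt0//= addrC -[1]opprK subr_eq0.
  by move: a1; rewrite ltr_norml => /andP[/gt_eqF -> _].
- have l0 : 0 <= 1 - kap by rewrite subr_ge0 ltW// kap_lt1.
  have : `|x| < 1 - kap.
    by rewrite -(ltr_pXn2r (n := 2)) ?nnegrE// real_normK ?num_real.
  rewrite ltr_norml => /andP[x1 x2].
  have : k2 * x < k2 * (1 - kap) by rewrite ltr_pM2l.
  have : k2 * (- (1 - kap)) < k2 * x by rewrite ltr_pM2l.
  have -> : k2 * (- (1 - kap)) = k1 - k2 by field.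
  have -> : k2 * (1 - kap) = k2 - k1 by field.
  rewrite w2 => ? ?; case; rewrite /= in_itv/= => /andP[? ?]; lra.
have : 1 + kap < `|x|.
  by rewrite -(ltr_pXn2r (n := 2)) ?nnegrE ?addr_ge0 ?(ltW kap_gt0)// real_normK ?num_real.
rewrite ltr_normr => /orP[x1|x1]; first by move: xle; rewrite leNgt x1.
have : k2 * (1 + kap) < k2 * - x by rewrite ltr_pM2l.
rewrite kk w2 => ?; case; rewrite /= in_itv/= => /andP[? ?]; move: k1_gt0; lra.
Qed.

(** Since k1 + k2 a = (k1 + k2 / a)(a t)^2, both modes are [Z] times vectors with entries 1 and |a
    t| up to sign. Their determinant is proportional to 1 - (a t)^2, which is positive by
    [disp_at2]. *)
Lemma state_coefs (k31 : R) n t a w : (0 < n)%N -> `|a| < 1 ->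
  let x := - (t * (1 + kap * a)) in let P := k31 / k2 - 1 in
  disp kap x t a -> 1 - P * t != 0 -> w ^+ 2 = k1 + k2 - k2 * x ->
  exists sg c1 c2, [/\ branch k1 k2 w a sg,
    mode_coefs k1 k2 (chain_state k31 x n) a sg c1 c2 &
    coef_ratio c1 c2 = (`|t - P| / (`|a| * `|1 - P * t|))%:E].
Proof.
move=> n0 a1 x P D Pt w2; have [aN a1' tE _] := D.
have k20 := k2_gt0; have k2N := lt0r_neq0 k20; have k1N := lt0r_neq0 k1_gt0.
have h0 := disp_factor_gt0 kap_gt0 kap_lt1 a1'.
set h := 1 + kap * a in h0 tE.
have na0 : 0 < `|a| by rewrite normr_gt0.
have e1 : k1 + k2 / a = k2 * h / a by rewrite /h; field; rewrite aN k2N.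
have e2 : k1 + k2 * a = k2 * h / a * (a * t) ^+ 2.
  have -> : k2 * h / a * (a * t) ^+ 2 = k2 * (t ^+ 2 * a * h) by field.
  by rewrite tE; field.
pose Z := Num.sqrt `|k1 + k2 / a|.
have Z0 : 0 < Z.
  by rewrite sqrtr_gt0 normr_gt0 e1 !mulf_neq0 ?invr_neq0// lt0r_neq0.
have Z2 : Num.sqrt `|k1 + k2 * a| = Z * (`|a| * `|t|).
  by rewrite e2 -e1 normrM sqrtrM// normrX sqrtr_sqr normr_id normrM.
(* At t = 0, where a = -kap and both branches give the same frequency, the value is 1. *)
pose sg : R := if 0 <= t then 1 else -1.
have sgS : is_sign sg by rewrite /sg; case: ifP; [left|right].
have sgt : sg * `|t| = t.
  by rewrite /sg; case: lerP => [/ger0_norm ->|/ltr0_norm ->]; rewrite ?mul1r// mulN1r opprK.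
have sga : Num.sg a * `|a| = a by rewrite -numEsg.
pose den := kap * (1 - (a * t) ^+ 2) * Z.
have at1 : 0 < 1 - (a * t) ^+ 2.
  rewrite subr_gt0 exprMn -(real_normK (num_real a)) [`|a| ^+ 2]expr2 -mulrA.
  apply: le_lt_trans (ler_wpM2l (normr_ge0 a) (disp_at2 kap_gt0 kap_lt1 D)) _.
  by rewrite mulr1.
have den0 : den != 0 by rewrite !mulf_neq0 ?lt0r_neq0// invr_gt0.
(* Solution of the 2 by 2 system with right side 1 and (x + P) / kap, the first two entries of the
   state. *)
pose c1 := - a * (1 - P * t) / den.
pose c2 := sg * Num.sg a * (t - P) / den.
have s2 : (sg * Num.sg a) ^+ 2 = 1.
  by rewrite exprMn sqr_sg aN mulr1 expr2 is_sign_sqr.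
exists sg, c1, c2; split.
- split=> //; rewrite w2 e1 e2.
  have -> : k2 * h / a * (a * t) ^+ 2 * (k2 * h / a) = (k2 * h * t) ^+ 2 by field.
  rewrite sqrtr_sqr normrM gtr0_norm ?mulr_gt0// mulrCA sgt /x /h; ring.
- rewrite /mode_coefs; apply/colP => i; rewrite !mxE.
  have n2 : (1 < 2 * n)%N by rewrite leq_pmulr.
  rewrite !(entry_col (fun i => gsol kap P x i.+1))// 1?ltnW// gsol1 gsolSS.
  rewrite gsol1 gsol0 /coupling /= mul1r opprK mulr1 -/Z Z2.
  have d1 : 1 - (a * t) ^+ 2 != 0 by rewrite lt0r_neq0.
  have sat : sg * Num.sg a * (`|a| * `|t|) = a * t.
    transitivity ((sg * `|t|) * (Num.sg a * `|a|)); first by ring.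
    by rewrite sgt sga mulrC.
  have Zn := lt0r_neq0 Z0.
  have kN : kap != 0 by rewrite mulf_neq0 ?invr_neq0.
  have rel : kap * (1 - (a * t) ^+ 2) = a * (t ^+ 2 - 1).
    transitivity (kap + a - a * (t ^+ 2 * a * kap) - a); first by field.
    by rewrite -tE /h; field.
  have D10 : kap * (1 - (a * t) ^+ 2) != 0 by rewrite mulf_neq0.
  set D1 := kap * _ in rel D10.
  have c1Z : c1 * Z = - a * (1 - P * t) / D1.
    by rewrite /c1 /den -/D1; field; rewrite D10 Zn.
  have c2Z : c2 * Z = sg * Num.sg a * (t - P) / D1.
    by rewrite /c2 /den -/D1; field; rewrite D10 Zn.
  case: ifP => _.
    rewrite mulrA c2Z c1Z -[LHS](mulfV D10) {1}rel.
    have -> : - a * (1 - P * t) / D1 + sg * Num.sg a * (t - P) / D1 * (`|a| * `|t|) =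
       (- a * (1 - P * t) + sg * Num.sg a * (`|a| * `|t|) * (t - P)) / D1.
      by field.
    by rewrite sat; congr (_ / _); ring.
  have -> : c1 * (- sg * Num.sg a * (Z * (`|a| * `|t|))) + c2 * (- sg * Num.sg a * Z) =
     - (c1 * Z * (sg * Num.sg a * (`|a| * `|t|)) + c2 * Z * (sg * Num.sg a)) by ring.
  rewrite c1Z c2Z sat.
  have -> : sg * Num.sg a * (t - P) / D1 * (sg * Num.sg a) = (sg * Num.sg a) ^+ 2 * (t - P) / D1.
    by field.
  rewrite s2 mul1r; apply: (mulfI D10).
  have -> : D1 * - (- a * (1 - P * t) / D1 * (a * t) + (t - P) / D1) =
     a * (1 - P * t) * (a * t) - (t - P) by field.
  have -> : D1 * ((x + P) / kap) = (1 - (a * t) ^+ 2) * (x + P) by rewrite /D1; field; rewrite k1N k2N.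
  transitivity (P * (1 - (a * t) ^+ 2) - t * (1 - (a * t) ^+ 2) - t * a * D1).
    by rewrite /x /D1 /h; ring.
  by rewrite rel; ring.
- rewrite /coef_ratio /c1 /c2.
  have c1N : - a * (1 - P * t) / den != 0 by rewrite !mulf_neq0 ?oppr_eq0 ?invr_neq0.
  rewrite (negbTE c1N); congr (_%:E).
  have -> : sg * Num.sg a * (t - P) / den / (- a * (1 - P * t) / den) =
     - (sg * Num.sg a) * ((t - P) / (a * (1 - P * t))).
    by field; rewrite Pt aN den0.
  have s1 : `|sg * Num.sg a| = 1.
    by rewrite normrM normr_sg aN mulr1; case: sgS => ->; rewrite ?normrN normr1.
  by rewrite normrM normrN s1 mul1r normrM normfV normrM.
Qed.

End States.

(** * Slow eigenstates and their limit frequencies *)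

Section Slow.
Context {R : realType}.
Variables (k1 k2 : R) (k31 k32 : R^nat).
Hypotheses (k1_gt0 : 0 < k1) (k1_lt_k2 : k1 < k2).
Implicit Types (x a t w d e s : R) (n : nat).
Local Notation kap := (k1 / k2).
Local Notation P n := (k31 n / k2 - 1).
Local Notation Q n := (k32 n / k2 - 1).
Local Notation chain n := (chain_mx k1 k2 (k31 n) (k32 n) n).
Let k20 : 0 < k2 := k2_gt0 k1_gt0 k1_lt_k2.
Let kap0 : 0 < kap := kap_gt0 k1_gt0 k1_lt_k2.
Let kap1 : kap < 1 := kap_lt1 k1_gt0 k1_lt_k2.

Lemma stiffness_shift (k : R) : k - k2 = k2 * (k / k2 - 1).
Proof. by field; rewrite lt0r_neq0. Qed.

Lemma norm_stiffness_shift (k : R) : `|k - k2| = k2 * `|k / k2 - 1|.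
Proof. by rewrite stiffness_shift normrM gtr0_norm. Qed.

Lemma near_away (k : R^nat) : asymp_neq (fun n => `|k n - k2|) (cst k2) ->
  exists2 d, 0 < d <= 1 & \forall n \near \oo, away d (k n / k2 - 1).
Proof.
move=> /asymp_neq_near[d d0 H]; exists (Num.min 1 (d / 2)).
  by rewrite lt_min ltr01 divr_gt0//= ge_min lexx.
apply: filterS H => n /=; rewrite /away norm_stiffness_shift; set p := `|k n / k2 - 1|.
have p0 : 0 <= p by exact: normr_ge0.
have -> : k2 * p - k2 = k2 * (p - 1) by ring.
rewrite normrM normrM (ger0_norm p0) (gtr0_norm k20) -[X in Num.max _ X]mulr1 -maxr_pMr ?(ltW k20)//.
rewrite mulrCA ler_pM2l// => h; apply: le_trans h.
have m1 : p <= Num.max p 1 by rewrite le_max lexx.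
have m2 : 1 <= Num.max p 1 by rewrite le_max lexx orbT.
apply: (@le_trans _ _ (d / 2 * (1 + p))).
  by rewrite ler_wpM2r ?addr_ge0// ge_min lexx orbT.
have : d * (1 + p) <= d * (2 * Num.max p 1) by rewrite ler_wpM2l ?(ltW d0)//; lra.
lra.
Qed.

Lemma near_one (k : R^nat) : asymp_eq (fun n => `|k n - k2|) (cst k2) ->
  forall e, 0 < e -> \forall n \near \oo, `| `|k n / k2 - 1| - 1| <= e.
Proof.
move=> /asymp_eq_cstP/cvgrPdist_le h e e0.
have := h (k2 * e) (mulr_gt0 k20 e0); apply: filterS => n.
rewrite norm_stiffness_shift distrC.
have -> : k2 * `|k n / k2 - 1| - k2 = k2 * (`|k n / k2 - 1| - 1) by ring.
by rewrite normrM gtr0_norm// ler_pM2l.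
Qed.

Lemma away_far d s (p : R) : away d p -> is_sign s -> far d s p.
Proof.
rewrite /away /far => h sS; apply: le_trans h _.
have -> : `|p| = `|s * p| by rewrite normrM; case: sS => ->; rewrite ?normrN normr1 mul1r.
by rewrite distrC -[X in `|X - _|]normr1; exact: ler_dist_dist.
Qed.

Lemma eigenstate_slow eps n u w a : (0 < n)%N ->
  eigenstate (chain n) u w -> multiplier k1 k2 w a -> 1 - eps < `|a| ->
  slow kap eps n (P n) (Q n) ((k1 + k2 - w ^+ 2) / k2).
Proof.
move=> n0 eu ma ea; have [D q _ _] := eigenstate_quantized k1_gt0 k1_lt_k2 n0 eu ma.
by exists (- ((k1 + k2 - w ^+ 2) / k2) / (1 + kap * a)), a.
Qed.

Lemma eigenstates_proportional n u w a u' w' a' : (0 < n)%N ->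
  eigenstate (chain n) u w -> multiplier k1 k2 w a ->
  eigenstate (chain n) u' w' -> multiplier k1 k2 w' a' ->
  (k1 + k2 - w ^+ 2) / k2 = (k1 + k2 - w' ^+ 2) / k2 -> exists c, u' = c *: u.
Proof.
move=> n0 eu ma eu' ma' xx.
have [_ _ u0 uE] := eigenstate_quantized k1_gt0 k1_lt_k2 n0 eu ma.
have [_ _ _ uE'] := eigenstate_quantized k1_gt0 k1_lt_k2 n0 eu' ma'.
exists (entry u' 0 / entry u 0).
have -> : entry u' 0 / entry u 0 *: u =
    entry u' 0 / entry u 0 *: (entry u 0 *: chain_state k1 k2 (k31 n) ((k1 + k2 - w ^+ 2) / k2) n).
  by rewrite -uE.
by rewrite scalerA divfK// xx -uE'.
Qed.

Lemma at_most_slow0 :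
  asymp_neq (fun n => `|k31 n - k2|) (cst k2) ->
  asymp_neq (fun n => `|k32 n - k2|) (cst k2) -> at_most_slow k1 k2 k31 k32 0.
Proof.
move=> /near_away[d1 /andP[d10 d11] H1] /near_away[d2 /andP[d20 d21] H2].
pose d := Num.min d1 d2.
have d0 : 0 < d by rewrite lt_min d10.
have dle1 : d <= 1 by rewrite ge_min d11.
have [e e0 [N H]] := no_slow kap0 kap1 d0 dle1.
exists e => //; near=> n => u Hu; exfalso.
have n0 : (0 < n)%N by near: n; exists 1%N.
have nN : (N <= n)%N by near: n; exists N.
have [w [a [eu ma /andP[ea _]]]] := Hu ord0.
apply: (H n _ _ _ nN _ _ (eigenstate_slow n0 eu ma ea)) => s sS.
  have : away d1 (P n) by near: n.
  by move=> /away_far -/(_ _ sS); apply: le_trans; rewrite ler_wpM2r ?addr_ge0// ge_min lexx.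
have : away d2 (Q n) by near: n.
by move=> /away_far -/(_ _ sS); apply: le_trans; rewrite ler_wpM2r ?addr_ge0// ge_min lexx orbT.
Unshelve. all: by end_near.
Qed.

Lemma at_most_slow1 :
  asymp_neq (fun n => `|k31 n - k2|) (cst k2) ->
  asymp_eq (fun n => `|k32 n - k2|) (cst k2) -> at_most_slow k1 k2 k31 k32 1.
Proof.
move=> /near_away[d /andP[d0 d1] H1] /near_one H2.
have [e e0 [N H]] := slow_at_most_one kap0 kap1 d0 d1.
have d4 : 0 < d / 4 by rewrite divr_gt0.
exists e => //; near=> n => u Hu.
have n0 : (0 < n)%N by near: n; exists 1%N.
have nN : (N <= n)%N by near: n; exists N.
have aw : away d (P n) by near: n.
have nQ : `| `|Q n| - 1| <= d / 4 by near: n; exact: H2.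
exists ord0, ord_max; split=> //.
have [w [a [eu ma /andP[ea _]]]] := Hu ord0.
have [w' [a' [eu' ma' /andP[ea' _]]]] := Hu ord_max.
apply: (eigenstates_proportional n0 eu ma eu' ma').
apply: (H n (P n) (Q n) nN _ nQ).
- by move=> s; exact: away_far.
- exact: eigenstate_slow n0 eu ma ea.
- exact: eigenstate_slow n0 eu' ma' ea'.
Unshelve. all: by end_near.
Qed.

Lemma at_most_slow2 :
  asymp_eq (fun n => `|k31 n - k2|) (cst k2) ->
  asymp_eq (fun n => `|k32 n - k2|) (cst k2) -> at_most_slow k1 k2 k31 k32 2.
Proof.
move=> /near_one H1 /near_one H2.
have [e e0 [N H]] := slow_at_most_two kap0 kap1.
have d4 : 0 < 1 / 4 :> R by rewrite divr_gt0.
exists e => //; near=> n => u Hu.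
have n0 : (0 < n)%N by near: n; exists 1%N.
have nN : (N <= n)%N by near: n; exists N.
have nP : `| `|P n| - 1| <= 1 / 4 by near: n; exact: H1.
have nQ : `| `|Q n| - 1| <= 1 / 4 by near: n; exact: H2.
pose i0 : 'I_3 := ord0; pose i2 : 'I_3 := ord_max.
have [i1 v1] : exists i1 : 'I_3, val i1 = 1%N by exists (inord 1); rewrite /= inordK.
have i01 : i0 != i1 by rewrite -val_eqE v1.
have i02 : i0 != i2 by [].
have i12 : i1 != i2 by rewrite -val_eqE v1.
have [w0 [a0 [eu0 ma0 /andP[ea0 _]]]] := Hu i0.
have [w1 [a1 [eu1 ma1 /andP[ea1 _]]]] := Hu i1.
have [w2 [a2 [eu2 ma2 /andP[ea2 _]]]] := Hu i2.
have S0 := eigenstate_slow n0 eu0 ma0 ea0.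
have S1 := eigenstate_slow n0 eu1 ma1 ea1.
have S2 := eigenstate_slow n0 eu2 ma2 ea2.
have [x01|x01] := eqVneq ((k1 + k2 - w0 ^+ 2) / k2) ((k1 + k2 - w1 ^+ 2) / k2).
  by exists i0, i1; split=> //; exact: (eigenstates_proportional n0 eu0 ma0 eu1 ma1 x01).
have [x02|x02] := eqVneq ((k1 + k2 - w0 ^+ 2) / k2) ((k1 + k2 - w2 ^+ 2) / k2).
  by exists i0, i2; split=> //; exact: (eigenstates_proportional n0 eu0 ma0 eu2 ma2 x02).
have [x12|x12] := eqVneq ((k1 + k2 - w1 ^+ 2) / k2) ((k1 + k2 - w2 ^+ 2) / k2).
  by exists i1, i2; split=> //; exact: (eigenstates_proportional n0 eu1 ma1 eu2 ma2 x12).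
by case: (H n _ _ nN nP nQ _ _ _ S0 S1 S2 x01 x02 x12).
Unshelve. all: by end_near.
Qed.

(** With both ends far from tau sg, [t] can only tend to -tau sg, and w^2 = k1 + k2 + k2 t (1 + kap
    a) is continuous in [t] and [a]. *)
Lemma slow_freq_limit d (tau sg : R) : 0 < d -> is_sign tau -> is_sign sg ->
  (\forall n \near \oo, far d (tau * sg) (P n) /\ far d (tau * sg) (Q n)) ->
  slow_freq k1 k2 k31 k32 tau (k1 + k2 - sg * (k1 + tau * k2)).
Proof.
move=> d0 tS sS [M _ HM] phi u w a phi_mono Hu /asymp_eq_cstP ha.
apply/asymp_eq_cstP.
have tau1 : `|tau| = 1 by case: tS => ->; rewrite ?normrN normr1.
have tsS : is_sign (- (tau * sg)).
  by case: tS => ->; case: sS => ->; rewrite ?mulrNN ?mul1r ?mulr1 ?mulrN1 ?opprK; [right|left|left|right].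
have phi_ge j : (j <= phi j)%N.
  by elim: j => // j IH; exact: leq_ltn_trans IH (phi_mono _ _ (ltnSn j)).
pose t j := - ((k1 + k2 - w j ^+ 2) / k2) / (1 + kap * a j).
have ht : t @ \oo --> - (tau * sg).
  apply/cvgrPdist_le => e e0.
  have [e' e'0 [N H]] := slowly_t_sign kap0 kap1 d0 e0.
  move/cvgrPdist_lt : ha => /(_ _ e'0) ha.
  near=> j.
  have [eu ma] := Hu j; have [_ a1 _] := ma.
  have ja : (maxn N 1 <= phi j)%N by apply: leq_trans (phi_ge j); near: j; exists (maxn N 1).
  move: ja; rewrite geq_max => /andP[jN j0].
  have [D q _ _] := eigenstate_quantized k1_gt0 k1_lt_k2 j0 eu ma.
  rewrite distrC; apply: (H (phi j) (a j) jN _ a1 _ _ _ _ _ tsS D _ _ q).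
  - have : `|tau - a j| < e' by near: j; exact: ha.
    have := ler_distD (a j) tau 0; rewrite !subr0 tau1; lra.
  - rewrite opprK; suff [] : far d (tau * sg) (P (phi j)) /\ far d (tau * sg) (Q (phi j)) by [].
    by apply: HM => /=; apply: leq_trans (phi_ge j); near: j; exists M.
  - rewrite opprK; suff [] : far d (tau * sg) (P (phi j)) /\ far d (tau * sg) (Q (phi j)) by [].
    by apply: HM => /=; apply: leq_trans (phi_ge j); near: j; exists M.
have wE : \forall j \near \oo, k1 + k2 + k2 * (t j * (1 + kap * a j)) = w j ^+ 2.
  near=> j; have [_ [_ a1 _]] := Hu j.
  have h0 := lt0r_neq0 (disp_factor_gt0 kap0 kap1 a1).
  rewrite /t divfK// mulrN mulrC divfK ?lt0r_neq0//; ring.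
have -> : k1 + k2 - sg * (k1 + tau * k2) = k1 + k2 + k2 * (- (tau * sg) * (1 + kap * tau)).
  have t2 := is_sign_sqr tS.
  transitivity (k1 + k2 - sg * ((tau * tau) * k1 + tau * k2)); first by rewrite t2 mul1r.
  by field; rewrite lt0r_neq0.
apply: (@cvg_trans _ ((fun j => k1 + k2 + k2 * (t j * (1 + kap * a j))) @ \oo)).
  by apply: near_eq_cvg.
apply: cvgD; first exact: cvg_cst.
apply: cvgM; first exact: cvg_cst.
apply: cvgM => //; apply: cvgD; first exact: cvg_cst.
by apply: cvgM => //; exact: cvg_cst.
Unshelve. all: by end_near.
Qed.

(** The shifted stiffness tends to -s, where 1 - s p and 1 + |p| both tend to 2; any constant below
    1 would do. *)
Lemma near_far_opposite (k : R^nat) s : is_sign s ->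
  asymp_eq (fun n => k n - k2) (cst (- (s * k2))) ->
  \forall n \near \oo, far (1 / 2) s (k n / k2 - 1).
Proof.
move=> sS /asymp_eq_cstP/cvgrPdist_le h.
have k4 : 0 < k2 / 4 by rewrite divr_gt0.
have := h _ k4; apply: filterS => n.
rewrite stiffness_shift; set p := k n / k2 - 1.
have -> : - (s * k2) - k2 * p = k2 * (- s - p) by ring.
rewrite normrM gtr0_norm// ler_pM2l// => hp.
have {}hp : `|s + p| <= 1 / 4 by rewrite -normrN opprD; lra.
rewrite /far; have s1 : `|s| = 1 by case: sS => ->; rewrite ?normrN normr1.
have p1 : `|p| <= 5 / 4.
  by have := ler_distD (- s) p 0; rewrite !subr0 opprK normrN s1 addrC [p + s]addrC; lra.
have -> : 1 - s * p = 2 - s * (s + p).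
  by have := is_sign_sqr sS; lra.
have : s * (s + p) <= 1 / 4 by apply: le_trans (ler_norm _) _; rewrite normrM s1 [leLHS]mul1r.
by move=> h1; apply: le_trans (ler_norm _); lra.
Qed.

End Slow.

(** * From stiffnesses to ends, and states localized at both edges *)

Section EdgeStates.
Context {R : realType}.
Variables (k1 k2 : R) (k31 k32 : R^nat).
Hypotheses (k1_gt0 : 0 < k1) (k1_lt_k2 : k1 < k2).
Hypotheses (k31_ge0 : forall n, 0 <= k31 n) (k32_ge0 : forall n, 0 <= k32 n).
Implicit Types (x a t w d e s : R) (n : nat).
Local Notation kap := (k1 / k2).
Local Notation P n := (k31 n / k2 - 1).
Local Notation Q n := (k32 n / k2 - 1).
Local Notation side p := (Num.sg (p ^+ 2 - 1)).
Let k20 : 0 < k2 := k2_gt0 k1_gt0 k1_lt_k2.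
Let kap0 : 0 < kap := kap_gt0 k1_gt0 k1_lt_k2.
Let kap1 : kap < 1 := kap_lt1 k1_gt0 k1_lt_k2.

Lemma PgeN1 n : -1 <= P n.
Proof. by rewrite lerDr divr_ge0// ltW. Qed.

Lemma QgeN1 n : -1 <= Q n.
Proof. by rewrite lerDr divr_ge0// ltW. Qed.

(** Supplies the condition of [state_eigenstate]: either |t| < 1, or [p] is positive and p t > 1. *)
Lemma side_ge (p t : R) : -1 <= p -> 0 < (1 - p ^+ 2) * (1 - p * t) ->
  0 < side p * (t ^+ 2 - 1) -> -1 <= t.
Proof.
move=> p1 h; have [c|c] := ltP (p ^+ 2) 1.
  rewrite ltr0_sg ?subr_lt0// mulN1r oppr_gt0 subr_lt0 => t2.
  have : `|t| < 1 by rewrite -(ltr_pXn2r (n := 2)) ?nnegrE// expr1n real_normK ?num_real.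
  by rewrite ltr_norml => /andP[/ltW].
move=> _; have c' : 1 - p ^+ 2 < 0.
  by rewrite lt_neqAle subr_le0 c andbT; apply: contraTneq h => ->; rewrite mul0r ltxx.
have p0 : 0 < p.
  rewrite ltNge; apply/negP => p0; have : `|p| <= 1 by rewrite ler_norml p1 (le_trans p0).
  rewrite -(ler_pXn2r (n := 2)) ?nnegrE// expr1n real_normK ?num_real//; lra.
move: h; rewrite nmulr_rgt0// subr_lt0 => pt.
by have : 0 < t by [rewrite -(pmulr_rgt0 _ p0); exact: lt_trans pt]; lra.
Qed.

(** The quadratic defining [atilde] is k2^3 times the relation between [t] and the multiplier, taken
    at t = p. *)
Lemma atilde_mode (k : R) : let p := k / k2 - 1 in
  is_sign (side p) -> 0 < side p * (p ^+ 2 - 1) ->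
  atilde k1 k2 k = mode kap (side p) p.
Proof.
move=> p gS gp; have [D m1 _] := mode_disp kap0 kap1 gS gp.
have kN := lt0r_neq0 k20.
have kE : k - k2 = k2 * p by exact: (stiffness_shift k1_gt0 k1_lt_k2).
have polyE (z : R) : (k - k2) ^+ 2 * k1 * z ^+ 2 + (k2 * (k - k2) ^+ 2 - k2 ^+ 3) * z - k1 * k2 ^+ 2 =
   k2 ^+ 3 * (p ^+ 2 * z * (1 + kap * z) - (kap + z)).
  by rewrite kE; field.
apply: xget_unique; first by split=> //; have [_ _ tE _] := D; rewrite polyE tE subrr mulr0.
move=> z [z1]; rewrite polyE => /eqP; rewrite mulf_eq0 expf_eq0 (negbTE kN) andbF /= subr_eq0 => /eqP zE.
apply: (mode_unique kap0 kap1 gS gp (x := - (p * (1 + kap * z)))).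
split=> //; [|exact: ltW].
apply: contra_eq_neq zE => ->.
by rewrite !(mulr0, mul0r) addr0 eq_sym lt0r_neq0.
Qed.

Lemma near_stiffness_close d : 0 < d ->
  (\forall n \near \oo, away d (P n)) -> asymp_eq k32 k31 ->
  forall e, 0 < e -> \forall n \near \oo, `|P n - Q n| <= e * (1 + `|P n|).
Proof.
move=> d0 aw /asymp_eq_near[k0|h] e e0.
  (* A vanishing left stiffness means P = -1, which [away] excludes. *)
  apply: filterS aw => n; rewrite /away k0 /= mul0r sub0r normrN normr1 subrr normr0.
  by rewrite (_ : 1 + 1 = 2)// pmulr_lle0// leNgt d0.
pose e' := Num.min (1 / 2) (e / 2).
have e'0 : 0 < e' by rewrite lt_min !divr_gt0.
have := h _ e'0; apply: filterS => n hn.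
have e1 : e' <= 1 / 2 by rewrite ge_min lexx.
have e2 : e' <= e / 2 by rewrite ge_min lexx orbT.
have k3 := k32_ge0 n; have k3' := k31_ge0 n.
rewrite (ger0_norm k3) in hn.
have k3le : k32 n <= 2 * k31 n.
  have := ler_wpM2r k3 e1; have := ler_norm (k32 n - k31 n); lra.
have h1 : `|k32 n - k31 n| <= e * k31 n.
  apply: le_trans hn _; have := ler_wpM2r k3 e2.
  have := ler_wpM2l (ltW e0) k3le; lra.
have -> : P n - Q n = - (k32 n - k31 n) / k2 by field; rewrite lt0r_neq0.
rewrite normrM normrN normfV (gtr0_norm k20) ler_pdivrMr// (le_trans h1)//.
rewrite -mulrA ler_wpM2l ?(ltW e0)//; set p := P n.
have kP : k31 n = (1 + p) * k2 by rewrite /p; field; rewrite lt0r_neq0.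
by rewrite kP ler_wpM2r ?(ltW k20)// lerD2l ler_norm.
Qed.

(** [asymp_neq] measures relative to the larger of 1 + P and 1 + Q, which could be small next to 1 +
    |P| + |Q|; but [away] bounds 1 + P below by [d]. With [m] the maximum, d (2 m + 3) <= 5 m
    explains the 5. *)
Lemma near_stiffness_apart d : 0 < d -> d <= 1 ->
  (\forall n \near \oo, away d (P n)) -> asymp_neq k32 k31 ->
  exists2 gam, 0 < gam & \forall n \near \oo,
    gam * (1 + `|P n| + `|Q n|) <= `|P n - Q n|.
Proof.
move=> d0 d1 aw /asymp_neq_near[e e0 h].
have ed : 0 < e * d by rewrite mulr_gt0.
exists (e * d / 5); first by rewrite divr_gt0.
apply: filterS2 aw h => n aw.
have p1 := PgeN1 n; have q1 := QgeN1 n; rewrite /away in aw.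
rewrite (ger0_norm (k31_ge0 n)) (ger0_norm (k32_ge0 n)).
set p := P n in aw p1 *; set q := Q n in q1 *.
have kP : k31 n = k2 * (1 + p) by rewrite /p; field; rewrite lt0r_neq0.
have kQ : k32 n = k2 * (1 + q) by rewrite /q; field; rewrite lt0r_neq0.
have -> : k32 n - k31 n = - (k2 * (p - q)) by rewrite kP kQ; ring.
rewrite kP kQ -maxr_pMr ?(ltW k20)// normrN normrM (gtr0_norm k20) mulrCA ler_pM2l//.
move=> h; apply: le_trans h; set m := Num.max _ _.
have mp : 1 + p <= m by rewrite le_max lexx orbT.
have mq : 1 + q <= m by rewrite le_max lexx.
have p0 := normr_ge0 p; have dp : 0 <= d * `|p| by rewrite mulr_ge0// ltW.
have dm : d <= m.
  apply: le_trans mp; have [c|c] := lerP 0 p; first by lra.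
  move: aw; rewrite (ltr0_norm c) ler0_norm; last by lra.
  by have : 0 <= d * - p by [rewrite mulr_ge0 ?oppr_ge0// ltW]; lra.
have pm : `|p| <= m + 1 by rewrite ler_norml; apply/andP; split; lra.
have qm : `|q| <= m + 1 by rewrite ler_norml; apply/andP; split; lra.
have : d * (1 + `|p| + `|q|) <= d * (2 * m + 3) by rewrite ler_wpM2l ?(ltW d0)//; lra.
have : d * m <= m by rewrite ler_piMl//; lra.
move=> u v; have {}v : d * (1 + `|p| + `|q|) <= 5 * m by lra.
by have := ler_wpM2l (ltW e0) v; lra.
Qed.

(** Trades the tiny t - P for t - Q and makes the factor a^(2n) explicit. *)
Lemma coef_ratioE n t a : a != 0 -> 1 - P n * t != 0 -> t - Q n != 0 ->
  (t - P n) * (t - Q n) = a ^+ (2 * n) * ((1 - P n * t) * (1 - Q n * t)) ->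
  `|t - P n| / (`|a| * `|1 - P n * t|) = `|a| ^+ (2 * n) * (`|1 - Q n * t| / (`|t - Q n| * `|a|)).
Proof.
move=> aN Pt Qt /(congr1 Num.norm); rewrite !normrM normrX => e.
have n1 : `|a| != 0 by rewrite normr_eq0.
have n2 : `|1 - P n * t| != 0 by rewrite normr_eq0.
have n3 : `|t - Q n| != 0 by rewrite normr_eq0.
transitivity ((`|t - P n| * `|t - Q n|) / (`|t - Q n| * `|a| * `|1 - P n * t|)).
  by field; rewrite n1 n2 n3.
by rewrite e; field; rewrite n1 n2 n3.
Qed.

Lemma both_edges_intro d (t : R^nat) : 0 < d -> d <= 1 ->
  (\forall n \near \oo, away d (P n)) -> asymp_eq k32 k31 ->
  (\forall n \near \oo, `|t n - P n| <= d / 8 * (1 + `|P n|) /\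
     quantized kap n (P n) (Q n) (t n) (mode kap (side (P n)) (t n))) ->
  both_edges k1 k2 k31 k32 (fun n => chain_state k1 k2 (k31 n)
     (- (t n * (1 + kap * mode kap (side (P n)) (t n)))) n).
Proof.
move=> d0 d1 aw k3 ht.
pose a n := mode kap (side (P n)) (t n).
pose x n := - (t n * (1 + kap * a n)).
pose w n := Num.sqrt (k1 + k2 - k2 * x n).
have [e e0 [N H]] := two_modes_ratio kap0 kap1 d0 d1 ltr01.
have cl := near_stiffness_close d0 aw k3.
have d8 : 0 <= d / 8 by rewrite divr_ge0// ltW.
have d84 : d / 8 <= d / 4 by lra.
have pt : \forall n \near \oo, [/\ (0 < n)%N, disp kap (x n) (t n) (a n), `|a n| < 1,
    -1 <= t n & 1 - P n * t n != 0] /\ t n - Q n != 0.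
  near=> n.
  have n0 : (0 < n)%N by near: n; exists 1%N.
  have nN : (N <= n)%N by near: n; exists N.
  have awn : away d (P n) by near: n.
  have cln : `|P n - Q n| <= e * (1 + `|P n|) by near: n; exact: cl.
  have [tP q] : `|t n - P n| <= d / 8 * (1 + `|P n|) /\
     quantized kap n (P n) (Q n) (t n) (mode kap (side (P n)) (t n)) by near: n.
  have [Pt gt Qt _] := H n _ _ _ nN awn cln tP q.
  have [[gS _ _ _] _] := away_near d0 d1 awn d8 d84 tP.
  have [D a1 _] := mode_disp kap0 kap1 gS gt.
  split=> //; split=> //; first exact: (side_ge (PgeN1 n) Pt).
  by apply: contraTneq Pt => ->; rewrite mulr0 ltxx.
have /choice[c Hc] : forall n, exists c : R * R * R,
   [/\ (0 < n)%N, disp kap (x n) (t n) (a n), `|a n| < 1,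
      1 - P n * t n != 0 & w n ^+ 2 = k1 + k2 - k2 * x n] ->
   [/\ branch k1 k2 (w n) (a n) c.1.1,
    mode_coefs k1 k2 (chain_state k1 k2 (k31 n) (x n) n) (a n) c.1.1 c.1.2 c.2 &
    coef_ratio c.1.2 c.2 = (`|t n - P n| / (`|a n| * `|1 - P n * t n|))%:E].
  move=> n.
  have [pp|npp] := pselect ([/\ (0 < n)%N, disp kap (x n) (t n) (a n), `|a n| < 1,
      1 - P n * t n != 0 & w n ^+ 2 = k1 + k2 - k2 * x n]); last by exists (0, 0, 0) => /npp.
  have [n0 D a1 Pt w2] := pp.
  have [sg [c1 [c2 hh]]] := state_coefs k1_gt0 k1_lt_k2 n0 a1 D Pt w2.
  by exists (sg, c1, c2).
exists w, a, (fun n => (c n).1.1), (fun n => (c n).1.2), (fun n => (c n).2); split.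
  near=> n.
  have [[n0 D a1 t1 Pt] Qt] : [/\ (0 < n)%N, disp kap (x n) (t n) (a n), `|a n| < 1,
    -1 <= t n & 1 - P n * t n != 0] /\ t n - Q n != 0 by near: n.
  have [_ q] : `|t n - P n| <= d / 8 * (1 + `|P n|) /\
     quantized kap n (P n) (Q n) (t n) (mode kap (side (P n)) (t n)) by near: n.
  have [eu mu _ w2] := state_eigenstate k1_gt0 k1_lt_k2 n0 t1 a1 D q.
  have [//|br mc _] := Hc n.
  split=> //; split=> //.
  by move: a1; rewrite ltr_norml => /andP[/gt_eqF -> /lt_eqF ->].
apply/cvgeyPge => A; pose M := Num.max A 1.
have M0 : 0 < M by rewrite lt_max ltr01 orbT.
have [e' e'0 [N' H']] := two_modes_ratio kap0 kap1 d0 d1 M0.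
near=> n.
have [[n0 D a1 t1 Pt] Qt] : [/\ (0 < n)%N, disp kap (x n) (t n) (a n), `|a n| < 1,
  -1 <= t n & 1 - P n * t n != 0] /\ t n - Q n != 0 by near: n.
have [tP q] : `|t n - P n| <= d / 8 * (1 + `|P n|) /\
   quantized kap n (P n) (Q n) (t n) (mode kap (side (P n)) (t n)) by near: n.
have [_ _ _ w2] := state_eigenstate k1_gt0 k1_lt_k2 n0 t1 a1 D q.
have [//|_ _ ->] := Hc n.
have nN : (N' <= n)%N by near: n; exists N'.
have awn : away d (P n) by near: n.
have cln : `|P n - Q n| <= e' * (1 + `|P n|) by near: n; exact: cl.
have [_ _ _ ratio] := H' n _ _ _ nN awn cln tP q.
have [aN _ _ _] := D.
have E := quantized_blaschke kap0 kap1 D q.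
rewrite -EFinM lee_fin (coef_ratioE aN Pt Qt E) normfV normrX mulrAC mulfV; last first.
  by rewrite expf_neq0// normr_eq0.
rewrite mul1r; apply: (@le_trans _ _ M); first by rewrite le_max lexx.
by rewrite ler_pdivlMr// mulr_gt0 ?normr_gt0.
Unshelve. all: by end_near.
Qed.

End EdgeStates.

(** * Independence of the two edge states, comparison of powers *)

Section EdgeStates2.
Context {R : realType}.
Variables (k1 k2 : R) (k31 k32 : R^nat).
Hypotheses (k1_gt0 : 0 < k1) (k1_lt_k2 : k1 < k2).
Hypotheses (k31_ge0 : forall n, 0 <= k31 n) (k32_ge0 : forall n, 0 <= k32 n).
Implicit Types (x a t w d e s : R) (n : nat).
Local Notation kap := (k1 / k2).
Local Notation P n := (k31 n / k2 - 1).
Local Notation Q n := (k32 n / k2 - 1).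
Local Notation side p := (Num.sg (p ^+ 2 - 1)).
Let k20 : 0 < k2 := k2_gt0 k1_gt0 k1_lt_k2.
Let kap0 : 0 < kap := kap_gt0 k1_gt0 k1_lt_k2.
Let kap1 : kap < 1 := kap_lt1 k1_gt0 k1_lt_k2.

Lemma chain_state_entry0 (k x : R) n : (0 < n)%N -> entry (chain_state k1 k2 k x n) 0 = 1.
Proof.
move=> n0; rewrite (entry_col (fun i => gsol kap (k / k2 - 1) x i.+1)) ?gsol1//.
by rewrite muln_gt0.
Qed.

Lemma chain_state_entry1 (k x : R) n : (0 < n)%N ->
  entry (chain_state k1 k2 k x n) 1 = (x + (k / k2 - 1)) / kap.
Proof.
move=> n0; rewrite (entry_col (fun i => gsol kap (k / k2 - 1) x i.+1)); last by rewrite leq_pmulr.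
by rewrite gsolSS gsol1 gsol0 /coupling /= mul1r mulr1 opprK.
Qed.

Lemma entryZ m (u : 'cV[R]_m) (c : R) j : entry (c *: u) j = c * entry u j.
Proof. by rewrite /entry; case: insub => [i|]; rewrite ?mxE ?mulr0. Qed.

(** Both states have first entry 1, and the second entry is affine in [x]. *)
Lemma chain_state_free (k x x' : R) n : (0 < n)%N -> x != x' ->
  free [:: chain_state k1 k2 k x n; chain_state k1 k2 k x' n].
Proof.
move=> n0 xx; rewrite free_cons span_seq1 seq1_free; apply/andP; split.
  apply/negP => /vlineP[c e]; move/eqP: xx; apply.
  have := congr1 (fun u => entry u 0) e; rewrite entryZ !chain_state_entry0// mulr1 => c1.
  have := congr1 (fun u => entry u 1) e; rewrite entryZ !chain_state_entry1// -c1 mul1r.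
  by move/(mulIf _)/addIr; apply; rewrite invr_eq0 lt0r_neq0.
apply/eqP => e; have := congr1 (fun u => entry u 0) e.
rewrite chain_state_entry0// -[X in entry X 0](scale0r (chain_state k1 k2 k x' n)) entryZ mul0r.
by move/eqP; rewrite oner_eq0.
Qed.

Lemma two_both_edges d : 0 < d -> d <= 1 ->
  (\forall n \near \oo, away d (P n)) -> asymp_eq k32 k31 ->
  exists u u' : forall n, 'cV[R]_(2 * n),
    [/\ both_edges k1 k2 k31 k32 u, both_edges k1 k2 k31 k32 u' &
        \forall n \near \oo, free [:: u n; u' n]].
Proof.
move=> d0 d1 aw k3; have d16 : 0 < d / 16 by rewrite divr_gt0.
have cl := near_stiffness_close k1_gt0 k1_lt_k2 k31_ge0 k32_ge0 d0 aw k3 d16.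
have [N H] := two_modes kap0 kap1 d0 d1.
have /choice[t Ht] : forall n, exists t : R * R,
    [/\ (N <= n)%N, away d (P n) & `|P n - Q n| <= d / 16 * (1 + `|P n|)] ->
    [/\ t.1 < P n < t.2,
    `|t.1 - P n| <= d / 8 * (1 + `|P n|), `|t.2 - P n| <= d / 8 * (1 + `|P n|),
    quantized kap n (P n) (Q n) t.1 (mode kap (side (P n)) t.1) &
    quantized kap n (P n) (Q n) t.2 (mode kap (side (P n)) t.2)].
  move=> n.
  have [[nN awn cln]|npp] := pselect [/\ (N <= n)%N, away d (P n) & `|P n - Q n| <= d / 16 * (1 + `|P n|)].
    by have [tm [tp h]] := H n _ _ nN awn cln; exists (tm, tp).
  by exists (0, 0) => /npp.
have near_t : \forall n \near \oo, [/\ (t n).1 < P n < (t n).2,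
    `|(t n).1 - P n| <= d / 8 * (1 + `|P n|), `|(t n).2 - P n| <= d / 8 * (1 + `|P n|),
    quantized kap n (P n) (Q n) (t n).1 (mode kap (side (P n)) (t n).1) &
    quantized kap n (P n) (Q n) (t n).2 (mode kap (side (P n)) (t n).2)].
  near=> n; apply: Ht; split; [by near: n; exists N|by near: n|by near: n].
pose x1 n := - ((t n).1 * (1 + kap * mode kap (side (P n)) (t n).1)).
pose x2 n := - ((t n).2 * (1 + kap * mode kap (side (P n)) (t n).2)).
exists (fun n => chain_state k1 k2 (k31 n) (x1 n) n), (fun n => chain_state k1 k2 (k31 n) (x2 n) n).
split.
- apply: (both_edges_intro k1_gt0 k1_lt_k2 k31_ge0 k32_ge0 (t := fun n => (t n).1) d0 d1 aw k3).
  by apply: filterS near_t => n [].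
- apply: (both_edges_intro k1_gt0 k1_lt_k2 k31_ge0 k32_ge0 (t := fun n => (t n).2) d0 d1 aw k3).
  by apply: filterS near_t => n [].
have d8 : 0 <= d / 8 by rewrite divr_ge0// ltW.
have d84 : d / 8 <= d / 4 by lra.
near=> n.
have n0 : (0 < n)%N by near: n; exists 1%N.
have awn : away d (P n) by near: n.
have [tt t1 t2 q1 q2] : [/\ (t n).1 < P n < (t n).2,
    `|(t n).1 - P n| <= d / 8 * (1 + `|P n|), `|(t n).2 - P n| <= d / 8 * (1 + `|P n|),
    quantized kap n (P n) (Q n) (t n).1 (mode kap (side (P n)) (t n).1) &
    quantized kap n (P n) (Q n) (t n).2 (mode kap (side (P n)) (t n).2)] by near: n.
apply: chain_state_free => //; apply/eqP => xx.
have [[gS _ gt1 _] _] := away_near d0 d1 awn d8 d84 t1.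
have [[_ _ gt2 _] _] := away_near d0 d1 awn d8 d84 t2.
have [D1 _ _] := mode_disp kap0 kap1 gS gt1.
have [D2 _ _] := mode_disp kap0 kap1 gS gt2.
rewrite -/(x1 n) xx in D1; have [e _] := disp_inj kap0 kap1 D1 D2.
by move: tt; rewrite e => /andP[l1 l2]; have := lt_trans l1 l2; rewrite ltxx.
Unshelve. all: by end_near.
Qed.

Lemma expr_bernoulli (h : R) n : 0 <= h -> n%:R * h <= (1 + h) ^+ n.
Proof.
move=> h0; suff : 1 + n%:R * h <= (1 + h) ^+ n by lra.
elim: n => [|n IH]; first by rewrite mul0r addr0 expr0.
rewrite exprS; have h1 : 0 <= 1 + h by rewrite addr_ge0.
have := ler_wpM2l h1 IH; rewrite -(natr1 n).
have : 0 <= n%:R * h ^+ 2 by rewrite mulr_ge0// sqr_ge0.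
lra.
Qed.

(** With r the square root of [rho], n r^n is bounded by Bernoulli's inequality, and a second factor
    r^n tends to 0. *)
Lemma mul_geometric_small (rho c : R) : 0 < rho < 1 -> 0 < c ->
  exists N, forall n, (N <= n)%N -> n%:R * rho ^+ n < c.
Proof.
move=> /andP[r0 r1] c0; pose r := Num.sqrt rho.
have r2 : r ^+ 2 = rho by rewrite sqr_sqrtr// ltW.
have rP : 0 < r by rewrite sqrtr_gt0.
have rlt : r < 1 by rewrite -(ltr_pXn2r (n := 2)) ?nnegrE ?ltW// expr1n r2.
pose h := r^-1 - 1.
have h0 : 0 < h by rewrite subr_gt0 invf_gt1.
have rh : r = (1 + h)^-1 by rewrite /h addrC subrK invrK.
have r01 : 0 <= r < 1 by rewrite ltW.
have [N H] := geometric_small r01 (mulr_gt0 c0 h0).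
exists N => n /H rn.
have nr : n%:R * h * r ^+ n <= 1.
  have rn0 : 0 <= r ^+ n by rewrite exprn_ge0// ltW.
  apply: le_trans (ler_wpM2r rn0 (expr_bernoulli n (ltW h0))) _.
  by rewrite rh exprVn mulfV// expf_neq0// lt0r_neq0// addr_gt0.
rewrite -r2 -exprM mulnC exprM expr2 -(ltr_pM2r h0).
have : n%:R * h * r ^+ n * r ^+ n <= 1 * r ^+ n by rewrite ler_wpM2r// exprn_ge0// ltW.
lra.
Qed.

(** [a] and [b] agree up to a relative error C rho^n, which over 2 n factors costs at most 1 / 2, as
    n rho^n tends to 0. *)
Lemma expr_compare (C rho : R) : 0 < C -> 0 < rho < 1 -> exists N, forall n a b,
  (N <= n)%N -> `|a| <= rho -> `|a - b| <= C * a ^+ (2 * n) ->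
  a ^+ (2 * n) <= 2 * `|b| ^+ (2 * n).
Proof.
move=> C0 r01; have [r0 r1] := andP r01.
have c0 : 0 < (4 * C)^-1 by rewrite invr_gt0 mulr_gt0.
have [N H] := mul_geometric_small r01 c0.
exists (maxn N 1) => n a b; rewrite geq_max => /andP[nN n1] ar ab.
have a0 := normr_ge0 a.
have A := expr_even_le n1 ar r1; rewrite expr1 in A.
have rn0 : 0 <= rho ^+ n by rewrite exprn_ge0// ltW.
have rn : n%:R * (C * rho ^+ n) <= 1 / 4.
  have C4 : 0 < 4 * C by rewrite mulr_gt0.
  by have := H n nN; rewrite -(ltr_pM2l C4) mulfV ?lt0r_neq0//; lra.
have u0 : 0 <= C * rho ^+ n by rewrite mulr_ge0// ltW.
have u1 : C * rho ^+ n <= 1.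
  have : 1 * (C * rho ^+ n) <= n%:R * (C * rho ^+ n) by rewrite ler_wpM2r// ler1n.
  lra.
have l : (1 - C * rho ^+ n) * `|a| <= `|b|.
  have := ler_distD b a 0; rewrite !subr0.
  by have := ler_wpM2l (ltW C0) A; lra.
have l0 : 0 <= (1 - C * rho ^+ n) * `|a| by rewrite mulr_ge0// subr_ge0.
have := lerXn2r (2 * n) l0 (le_trans l0 l) l; rewrite exprMn.
have B : 1 / 2 <= (1 - C * rho ^+ n) ^+ (2 * n).
  apply: le_trans (bernoulli_le _ _); last by rewrite u0.
  by rewrite natrM; lra.
have -> : `|a| ^+ (2 * n) = a ^+ (2 * n) by rewrite !exprM real_normK ?num_real.
have A0 : 0 <= a ^+ (2 * n) by rewrite exprM exprn_ge0// sqr_ge0.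
by have := ler_wpM2r A0 B; lra.
Qed.

End EdgeStates2.

(** * The left edge state and its multiplier *)

Section LeftEdge.
Context {R : realType}.
Variables (k1 k2 : R) (k31 k32 : R^nat).
Hypotheses (k1_gt0 : 0 < k1) (k1_lt_k2 : k1 < k2).
Hypotheses (k31_ge0 : forall n, 0 <= k31 n) (k32_ge0 : forall n, 0 <= k32 n).
Implicit Types (x a t w d e s : R) (n : nat).
Local Notation kap := (k1 / k2).
Local Notation P n := (k31 n / k2 - 1).
Local Notation Q n := (k32 n / k2 - 1).
Local Notation side p := (Num.sg (p ^+ 2 - 1)).
Local Notation at_ n := (mode kap (side (P n)) (P n)).
Let k20 : 0 < k2 := k2_gt0 k1_gt0 k1_lt_k2.
Let kap0 : 0 < kap := kap_gt0 k1_gt0 k1_lt_k2.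
Let kap1 : kap < 1 := kap_lt1 k1_gt0 k1_lt_k2.

(** This bound and the next one come from a + kap = t^2 a (1 + kap a). *)
Lemma disp_distN x t a : disp kap x t a -> `|a + kap| <= 2 * t ^+ 2.
Proof.
move=> [_ a1 tE _]; rewrite addrC -tE -mulrA normrM ger0_norm ?sqr_ge0//.
rewrite mulrC ler_wpM2r ?sqr_ge0// normrM.
have h0 := disp_factor_gt0 kap0 kap1 a1.
have h2 : 1 + kap * a <= 2.
  move: a1; rewrite ler_norml => /andP[_ a1].
  by have := ler_wpM2l (ltW kap0) a1; move: kap1; lra.
rewrite (gtr0_norm h0) -[2]mul1r; apply: ler_pM => //; exact: ltW.
Qed.

Lemma disp_apart x t a : disp kap x t a ->
  kap * (1 - kap) * Num.min 1 (t ^+ 2) <= `|a + kap|.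
Proof.
move=> [aN a1 tE _]; have k1' : 0 < 1 - kap by rewrite subr_gt0.
have h0 := disp_factor_gt0 kap0 kap1 a1.
have m1 : Num.min 1 (t ^+ 2) <= 1 by rewrite ge_min lexx.
have m2 : Num.min 1 (t ^+ 2) <= t ^+ 2 by rewrite ge_min lexx orbT.
have m0 : 0 <= Num.min 1 (t ^+ 2) by rewrite le_min ler01 sqr_ge0.
have c0 : 0 <= kap * (1 - kap) by rewrite mulr_ge0 ?(ltW kap0)// ltW.
have [a0|a0] := ltP 0 a.
  rewrite ger0_norm ?addr_ge0 ?(ltW a0) ?(ltW kap0)//.
  have : kap * (1 - kap) * Num.min 1 (t ^+ 2) <= kap * (1 - kap) * 1 by rewrite ler_wpM2l.
  by have : 0 <= kap * kap by [rewrite mulr_ge0// ltW]; lra.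
have le : kap + a <= 0.
  by rewrite -tE pmulr_lle0// mulr_ge0_le0// sqr_ge0.
have hk : 1 - kap <= 1 + kap * a.
  move: a1; rewrite ler_norml => /andP[a1 _].
  by have := ler_wpM2l (ltW kap0) a1; lra.
have -> : `|a + kap| = t ^+ 2 * (`|a| * (1 + kap * a)).
  by rewrite addrC -tE !normrM (gtr0_norm h0) -expr2 real_normK ?num_real// mulrA.
rewrite [leLHS]mulrC; apply: ler_pM => //; apply: ler_pM => //; try exact: ltW.
by rewrite ler0_norm//; lra.
Qed.

(** [left_mode] gives errors in powers of [a]; [expr_compare] converts them into powers of [atilde],
    the multiplier at t = P. *)
Lemma exists_left_edge d (gam : R) : 0 < d -> d <= 1 -> 0 < gam ->
  (\forall n \near \oo, away d (P n)) ->
  (\forall n \near \oo, gam * (1 + `|P n| + `|Q n|) <= `|P n - Q n|) ->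
  exists (u : forall n, 'cV[R]_(2 * n)) (w a : R^nat),
    [/\ left_edge_state k1 k2 k31 k32 u w a,
       (\forall n \near \oo, k31 n = k2) ->
         asymp_eq a (cst (- (k1 / k2))) /\
         (fun n => a n + k1 / k2) =O_\oo (fun n => (k1 / k2) ^+ (4 * n)),
       asymp_eq k31 (cst k2) ->
         asymp_eq a (cst (- (k1 / k2))) /\
         (fun n => a n - atilde k1 k2 (k31 n))
           =O_\oo (fun n => `|atilde k1 k2 (k31 n)| ^+ (2 * n)) &
       asymp_neq k31 (cst k2) ->
         [/\ asymp_eq a (fun n => atilde k1 k2 (k31 n)),
            asymp_neq (fun n => atilde k1 k2 (k31 n)) (cst (- (k1 / k2))) &
            (fun n => a n - atilde k1 k2 (k31 n))
              =O_\oo (fun n => `|atilde k1 k2 (k31 n)| ^+ (2 * n))]].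
Proof.
move=> d0 d1 g0 aw ap.
have [C [rho [N [C0 r01 H]]]] := left_mode kap0 kap1 d0 d1 g0.
have [r0 r1] := andP r01; have rr : 0 <= rho < 1 by rewrite ltW.
have [N' HN'] := expr_compare C0 r01.
have /choice[t Ht] : forall n, exists t,
    [/\ (N <= n)%N, away d (P n) & gam * (1 + `|P n| + `|Q n|) <= `|P n - Q n|] ->
    let a := mode kap (side (P n)) t in
      [/\ is_sign (side (P n)), 0 < side (P n) * (t ^+ 2 - 1),
         0 < side (P n) * (P n ^+ 2 - 1), quantized kap n (P n) (Q n) t a & `|a| <= rho] /\
      [/\ 0 < (1 - P n ^+ 2) * (1 - P n * t), t - Q n != 0, `|1 - Q n * t| * `|a| <= C * `|t - Q n|,
         `|a - at_ n| <= C * a ^+ (2 * n) &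
         `|t - P n| <= C * a ^+ (2 * n) * (1 + `|P n|) ^+ 3].
  move=> n.
  have [[nN awn apn]|npp] := pselect [/\ (N <= n)%N, away d (P n) & gam * (1 + `|P n| + `|Q n|) <= `|P n - Q n|].
    by have [t h] := H n _ _ nN awn apn; exists t.
  by exists 0 => /npp.
pose a n := mode kap (side (P n)) (t n).
pose x n := - (t n * (1 + kap * a n)).
pose w n := Num.sqrt (k1 + k2 - k2 * x n).
have pt : \forall n \near \oo,
    [/\ (0 < n)%N, disp kap (x n) (t n) (a n), `|a n| <= rho, -1 <= t n & 1 - P n * t n != 0] /\
    [/\ t n - Q n != 0, quantized kap n (P n) (Q n) (t n) (a n) & `|1 - Q n * t n| * `|a n| <= C * `|t n - Q n|].
  near=> n; have [|] := Ht n.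
    by split; [near: n; exists N|near: n|near: n].
  rewrite -/(a n) => -[gS gt gP q ar] [Pt Qt rat _ _].
  have n0 : (0 < n)%N by near: n; exists 1%N.
  have [D _ _] := mode_disp kap0 kap1 gS gt.
  split; split=> //; first exact: (side_ge (PgeN1 k1_gt0 k1_lt_k2 k31_ge0 n) Pt).
  by apply: contraTneq Pt => ->; rewrite mulr0 ltxx.
have pd : \forall n \near \oo,
    [/\ exists x', disp kap x' (P n) (at_ n), atilde k1 k2 (k31 n) = at_ n,
       `|a n - at_ n| <= C * (`|a n| * rho ^+ n),
       `|a n - at_ n| <= 2 * C * `|at_ n| ^+ (2 * n) &
       `|t n - P n| <= 2 * C * `|at_ n| ^+ (2 * n) * (1 + `|P n|) ^+ 3].
  near=> n; have [|] := Ht n.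
    by split; [near: n; exists N|near: n|near: n].
  rewrite -/(a n) => -[gS gt gP q ar] [_ _ _ dist tP].
  have n1 : (1 <= n)%N by near: n; exists 1%N.
  have nN' : (N' <= n)%N by near: n; exists N'.
  have [D _ _] := mode_disp kap0 kap1 gS gP.
  have A := HN' _ _ _ nN' ar dist.
  have A' : C * a n ^+ (2 * n) <= 2 * C * `|at_ n| ^+ (2 * n).
    by have := ler_wpM2l (ltW C0) A; lra.
  split.
  - by eexists; exact: D.
  - exact: (atilde_mode k1_gt0 k1_lt_k2).
  - apply: le_trans dist _; rewrite ler_wpM2l ?(ltW C0)//.
    by have := expr_even_le n1 ar r1; rewrite expr1.
  - exact: le_trans dist A'.
  - apply: le_trans tP _; rewrite ler_wpM2r// exprn_ge0// addr_ge0//.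
(* The error is relative to [a], as [asymp_eq] demands: with an unbounded left stiffness [a] need
   not stay away from 0. *)
have a_near0 e : 0 < e -> \forall n \near \oo, `|a n - at_ n| <= e * `|a n|.
  move=> e0; have [M HM] := geometric_small rr (divr_gt0 e0 C0).
  near=> n.
  have [_ _ h _ _] : [/\ exists x', disp kap x' (P n) (at_ n), atilde k1 k2 (k31 n) = at_ n,
       `|a n - at_ n| <= C * (`|a n| * rho ^+ n),
       `|a n - at_ n| <= 2 * C * `|at_ n| ^+ (2 * n) &
       `|t n - P n| <= 2 * C * `|at_ n| ^+ (2 * n) * (1 + `|P n|) ^+ 3] by near: n.
  have nM : (M <= n)%N by near: n; exists M.
  apply: le_trans h _; have -> : C * (`|a n| * rho ^+ n) = C * rho ^+ n * `|a n| by ring.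
  rewrite ler_wpM2r//; have := HM n nM.
  by rewrite ltr_pdivlMr// mulrC => /ltW.
have bigO : (fun n => a n - atilde k1 k2 (k31 n)) =O_\oo (fun n => `|atilde k1 k2 (k31 n)| ^+ (2 * n)).
  apply/eqO_exP; exists (2 * C); first by rewrite mulr_gt0.
  apply: filterS pd => n [_ -> _ h _].
  by rewrite (ger0_norm (exprn_ge0 _ (normr_ge0 _))).
have a_lim : k31 @ \oo --> k2 -> asymp_eq a (cst (- (k1 / k2))).
  move=> kl; apply/asymp_eq_cstP/cvgrPdist_le => e e0.
  have e2 : 0 < e / 2 by rewrite divr_gt0.
  pose e' := Num.min 1 (e / 4).
  have e'0 : 0 < e' by rewrite lt_min ltr01 divr_gt0.
  have e'1 : e' <= 1 by rewrite ge_min lexx.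
  have e'4 : e' <= e / 4 by rewrite ge_min lexx orbT.
  move/cvgrPdist_le : kl => /(_ _ (mulr_gt0 k20 e'0)) kl.
  near=> n.
  have [[x' D] _ _ _ _] : [/\ exists x', disp kap x' (P n) (at_ n), atilde k1 k2 (k31 n) = at_ n,
       `|a n - at_ n| <= C * (`|a n| * rho ^+ n),
       `|a n - at_ n| <= 2 * C * `|at_ n| ^+ (2 * n) &
       `|t n - P n| <= 2 * C * `|at_ n| ^+ (2 * n) * (1 + `|P n|) ^+ 3] by near: n.
  have [[_ _ ar _ _] _] : [/\ (0 < n)%N, disp kap (x n) (t n) (a n), `|a n| <= rho, -1 <= t n & 1 - P n * t n != 0] /\
    [/\ t n - Q n != 0, quantized kap n (P n) (Q n) (t n) (a n) & `|1 - Q n * t n| * `|a n| <= C * `|t n - Q n|] by near: n.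
  have ha : `|a n - at_ n| <= e / 2 * `|a n| by near: n; exact: a_near0.
  have hk : `|k2 - k31 n| <= k2 * e' by near: n.
  move: hk; rewrite distrC (norm_stiffness_shift k1_gt0 k1_lt_k2) ler_pM2l// => hp.
  have p2 : P n ^+ 2 <= e'.
    rewrite -(real_normK (num_real (P n))) expr2 -[leRHS]mulr1.
    by apply: ler_pM => //; exact: le_trans e'1.
  have h1 := disp_distN D.
  have h2 : e / 2 * `|a n| <= e / 2 by rewrite ler_piMr ?(ltW e2)// (le_trans ar)// ltW.
  rewrite distrC opprK.
  have -> : a n + k1 / k2 = (a n - at_ n) + (at_ n + k1 / k2) by ring.
  by apply: le_trans (ler_normD _ _) _; lra.
exists (fun n => chain_state k1 k2 (k31 n) (x n) n), w, a; split.
- have /choice[c Hc] : forall n, exists c : R * R * R,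
     [/\ (0 < n)%N, disp kap (x n) (t n) (a n), `|a n| < 1,
        1 - P n * t n != 0 & w n ^+ 2 = k1 + k2 - k2 * x n] ->
     [/\ branch k1 k2 (w n) (a n) c.1.1,
      mode_coefs k1 k2 (chain_state k1 k2 (k31 n) (x n) n) (a n) c.1.1 c.1.2 c.2 &
      coef_ratio c.1.2 c.2 = (`|t n - P n| / (`|a n| * `|1 - P n * t n|))%:E].
    move=> n.
    have [pp|npp] := pselect ([/\ (0 < n)%N, disp kap (x n) (t n) (a n), `|a n| < 1,
        1 - P n * t n != 0 & w n ^+ 2 = k1 + k2 - k2 * x n]); last by exists (0, 0, 0) => /npp.
    have [n0 D a1 Pt w2] := pp.
    have [sg [c1 [c2 hh]]] := state_coefs k1_gt0 k1_lt_k2 n0 a1 D Pt w2.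
    by exists (sg, c1, c2).
  split.
    split.
      apply: filterS pt => n [[n0 D ar t1 Pt] [Qt q _]].
      by have [] := state_eigenstate k1_gt0 k1_lt_k2 n0 t1 (le_lt_trans ar r1) D q.
    apply: (near_asymp_neq (d := 1 - rho)); rewrite ?subr_gt0 ?oner_neq0//.
    apply: filterS pt => n [[_ _ ar _ _] _]; rewrite oner_neq0; split=> //.
    have ar1 : `|a n| <= 1 by rewrite (le_trans ar)// ltW.
    rewrite normr_id normr1 (max_idPr ar1) mulr1 distrC ger0_norm ?subr_ge0//.
    by rewrite lerB.
  exists (fun n => (c n).1.1), (fun n => (c n).1.2), (fun n => (c n).2); split.
    apply: filterS pt => n [[n0 D ar t1 Pt] [Qt q _]].
    have a1 := le_lt_trans ar r1.
    have [_ _ _ w2] := state_eigenstate k1_gt0 k1_lt_k2 n0 t1 a1 D q.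
    by have [] := Hc n.
  exists C => //; apply: filterS pt => n [[n0 D ar t1 Pt] [Qt q rat]].
  have a1 := le_lt_trans ar r1.
  have [_ _ _ w2] := state_eigenstate k1_gt0 k1_lt_k2 n0 t1 a1 D q.
  have [//|_ _ ->] := Hc n.
  have [aN _ _ _] := D; have E := quantized_blaschke kap0 kap1 D q.
  have na0 : `|a n| != 0 by rewrite normr_eq0.
  have nQ0 : `|t n - Q n| != 0 by rewrite normr_eq0.
  (* This cancels the power in [coef_ratioE] and leaves |1 - Q t| |a| / |t - Q|, bounded by
     [left_mode]. *)
  have -> : `|a n ^ (2%:Z - (2 * n)%:Z)| = `|a n| ^+ 2 / `|a n| ^+ (2 * n).
    by rewrite expfzDr// normrM -exprnN normfV !normrX.
  rewrite -EFinM lee_fin (coef_ratioE aN Pt Qt E).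
  have -> : `|a n| ^+ (2 * n) * (`|1 - Q n * t n| / (`|t n - Q n| * `|a n|)) *
     (`|a n| ^+ 2 / `|a n| ^+ (2 * n)) = `|1 - Q n * t n| * `|a n| / `|t n - Q n|.
    by set A := `|a n| ^+ (2 * n); field; rewrite na0 nQ0 /A expf_neq0.
  by rewrite ler_pdivrMr// normr_gt0.
- move=> kk; split.
    apply: a_lim; apply/cvgrPdist_le => e e0.
    by apply: filterS kk => n ->; rewrite subrr normr0 ltW.
  (* Here P = 0, so the bound on t - P says that [t] is of order kap^(2n); a + kap is quadratic in
     [t], hence the exponent 4 n. *)
  apply/eqO_exP; exists (2 * (2 * C) ^+ 2); first by rewrite mulr_gt0// exprn_gt0// mulr_gt0.
  apply: filterS3 kk pt pd => n kn [[_ D _ _ _] _] [[x' D'] _ _ _ h].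
  have P0 : P n = 0 by rewrite kn divff ?lt0r_neq0// subrr.
  have b : at_ n = - kap.
    have [_ _ e _] := D'; move: e; rewrite {1}P0 expr0n /= !mul0r => /esym/eqP.
    by rewrite addrC addr_eq0 => /eqP.
  move: h; rewrite b P0 subr0 normr0 addr0 expr1n mulr1 normrN (gtr0_norm kap0) => h.
  rewrite (ger0_norm (exprn_ge0 _ (ltW kap0))).
  apply: le_trans (disp_distN D) _; rewrite -mulrA ler_wpM2l//.
  rewrite -(real_normK (num_real (t n))).
  have -> : (2 * C) ^+ 2 * kap ^+ (4 * n) = (2 * C * kap ^+ (2 * n)) ^+ 2.
    by rewrite [RHS]exprMn -exprM [(2 * n * 2)%N]mulnC mulnA.
  by rewrite lerXn2r ?nnegrE// (le_trans _ h).
- by move=> /asymp_eq_cstP kl; split; [exact: a_lim|exact: bigO].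
move=> /asymp_neq_near[del del0 hk]; split; last exact: bigO.
- apply: near_asymp_eq => e e0; apply: filterS2 pd (a_near0 _ e0) => n [_ -> _ _ _].
  exact.
pose m := Num.min 1 (del ^+ 2).
have m0 : 0 < m by rewrite lt_min ltr01 exprn_gt0.
apply: (near_asymp_neq (d := kap * (1 - kap) * m)).
- by apply: mulr_gt0 => //; apply: mulr_gt0 => //; rewrite subr_gt0.
- by rewrite oppr_eq0 lt0r_neq0.
apply: filterS2 hk pd => n hk [[x' D] -> _ _ _]; split; first by rewrite oppr_eq0 lt0r_neq0.
have [_ b1 _ _] := D.
have M1 : Num.max `|at_ n| `|cst (- (k1 / k2)) n| <= 1.
  by rewrite ge_max b1 /= normrN gtr0_norm// ltW.
have mP : m <= Num.min 1 (P n ^+ 2).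
  rewrite le_min ge_min lexx /= -(real_normK (num_real (P n))).
  apply: (@le_trans _ _ (del ^+ 2)); first by rewrite ge_min lexx orbT.
  rewrite lerXn2r ?nnegrE ?(ltW del0)//.
  move: hk => /=; rewrite (norm_stiffness_shift k1_gt0 k1_lt_k2) => hk.
  have : del * k2 <= k2 * `|P n|.
    apply: le_trans hk; rewrite ler_wpM2l ?(ltW del0)// le_max [`|k2|]gtr0_norm// lexx orbT//.
  by rewrite [del * k2]mulrC (ler_pM2l k20).
have c0 : 0 <= kap * (1 - kap) by rewrite mulr_ge0 ?(ltW kap0)// subr_ge0 ltW.
rewrite /= opprK; apply: le_trans (disp_apart D); apply: (@le_trans _ _ (kap * (1 - kap) * m)).
  by rewrite ler_piMr// mulr_ge0// ltW.
by rewrite ler_wpM2l.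
Unshelve. all: by end_near.
Qed.

End LeftEdge.

Lemma is_sign_mul (R : realType) (u v : R) : is_sign u -> is_sign v -> is_sign (u * v).
Proof.
by case=> ->; case=> ->; rewrite ?mulrNN ?mulr1 ?mul1r; [left|right|right|left].
Qed.

Lemma far_le (R : realType) (d d' s p : R) : d <= d' -> far d' s p -> far d s p.
Proof.
by move=> dd; apply: le_trans; rewrite ler_wpM2r// addr_ge0.
Qed.

Theorem theorem4p17 (R : realType) (k1 k2 : R) (k31 k32 : R^nat)
    (k1_gt0 : 0 < k1) (k1_lt_k2 : k1 < k2)
    (k31_ge0 : forall n, 0 <= k31 n) (k32_ge0 : forall n, 0 <= k32 n) :
  (* (A) *)
  (asymp_neq (fun n => `|k31 n - k2|) (cst k2) ->
    [/\ (* (A1) *)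
        asymp_eq k32 k31 ->
        exists u u' : forall n, 'cV[R]_(2 * n),
          [/\ both_edges k1 k2 k31 k32 u, both_edges k1 k2 k31 k32 u' &
              \forall n \near \oo, free [:: u n; u' n]],
        (* (A2) *)
        asymp_neq k32 k31 ->
        exists (u : forall n, 'cV[R]_(2 * n)) (w a : R^nat),
          [/\ left_edge_state k1 k2 k31 k32 u w a,
              (\forall n \near \oo, k31 n = k2) ->
                asymp_eq a (cst (- (k1 / k2))) /\
                (fun n => a n + k1 / k2) =O_\oo (fun n => (k1 / k2) ^+ (4 * n)),
              asymp_eq k31 (cst k2) ->
                asymp_eq a (cst (- (k1 / k2))) /\
                (fun n => a n - atilde k1 k2 (k31 n))
                  =O_\oo (fun n => `|atilde k1 k2 (k31 n)| ^+ (2 * n)) &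
              asymp_neq k31 (cst k2) ->
                [/\ asymp_eq a (fun n => atilde k1 k2 (k31 n)),
                    asymp_neq (fun n => atilde k1 k2 (k31 n))
                            (cst (- (k1 / k2))) &
                    (fun n => a n - atilde k1 k2 (k31 n))
                      =O_\oo (fun n => `|atilde k1 k2 (k31 n)| ^+ (2 * n))]],
        (* (A3) *)
        asymp_neq (fun n => `|k32 n - k2|) (cst k2) ->
        at_most_slow k1 k2 k31 k32 0 &
        (* (A4) *)
        asymp_eq (fun n => `|k32 n - k2|) (cst k2) ->
        at_most_slow k1 k2 k31 k32 1 /\
        forall tau sg : R, is_sign tau -> is_sign sg ->
          asymp_eq (fun n => k32 n - k2) (cst (- (tau * sg * k2))) ->
          slow_freq k1 k2 k31 k32 tau (k1 + k2 - sg * (k1 + tau * k2))])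
  /\
  (* (B) *)
  (asymp_eq (fun n => `|k31 n - k2|) (cst k2) ->
   asymp_eq (fun n => `|k32 n - k2|) (cst k2) ->
   at_most_slow k1 k2 k31 k32 2 /\
   forall tau sg : R, is_sign tau -> is_sign sg ->
     asymp_eq (fun n => k31 n - k2) (cst (- (tau * sg * k2))) ->
     asymp_eq (fun n => k32 n - k2) (cst (- (tau * sg * k2))) ->
     slow_freq k1 k2 k31 k32 tau (k1 + k2 - sg * (k1 + tau * k2))).
Proof.
split.
  move=> h1; have [d /andP[d0 d1] aw] := near_away k1_gt0 k1_lt_k2 h1; split.
  - exact: (two_both_edges k1_gt0 k1_lt_k2 k31_ge0 k32_ge0 d0 d1 aw).
  - move=> k3.
    have [gam g0 ap] := near_stiffness_apart k1_gt0 k1_lt_k2 k31_ge0 k32_ge0 d0 d1 aw k3.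
    exact: (exists_left_edge k1_gt0 k1_lt_k2 k31_ge0 d0 d1 g0 aw ap).
  - exact: (at_most_slow0 k1_gt0 k1_lt_k2).
  - move=> h2; split; first exact: (at_most_slow1 k1_gt0 k1_lt_k2).
    move=> tau sg tS sS hq.
    have tsS := is_sign_mul tS sS.
    have e0 : 0 < Num.min d (1 / 2) by rewrite lt_min d0 divr_gt0.
    apply: (slow_freq_limit k1_gt0 k1_lt_k2 e0 tS sS).
    (* The left end is far from both signs, and the right end tends to the sign opposite to tau
       sg. *)
    apply: filterS2 aw (near_far_opposite k1_gt0 k1_lt_k2 tsS hq) => n awn fn.
    split; first by apply: far_le (away_far awn tsS); rewrite ge_min lexx.
    by apply: far_le fn; rewrite ge_min lexx orbT.
move=> h1 h2; split; first exact: (at_most_slow2 k1_gt0 k1_lt_k2).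
move=> tau sg tS sS hp hq.
have tsS := is_sign_mul tS sS.
have e0 : 0 < 1 / 2 :> R by rewrite divr_gt0.
apply: (slow_freq_limit k1_gt0 k1_lt_k2 e0 tS sS).
by apply: filterS2 (near_far_opposite k1_gt0 k1_lt_k2 tsS hp)
  (near_far_opposite k1_gt0 k1_lt_k2 tsS hq) => n.
Qed.
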